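(* Let $(\mathcal W^{-\infty},\mathcal H,V,\mathcal P,q)$ be a tuple satisfying the axioms (i)–(vi) listed in the context. Then: (i) There exists a continuous seminorm $p'$ on $S^0_{1,0}=S^0_{1,0}(V)$ such that $\|q(a)\|\le p'(a)$ for all $a\in S^0_{1,0}$, the norm being the norm of bounded operators on $\mathcal H$. (ii) The map $S^0_{1,0}\ni a\mapsto q(a)\in\mathcal L(\mathcal H)$ is well defined and continuous. (iii) If $a\in S^m_{1,0}$, $m\ge0$, is elliptic and real valued, then $q(a)$ (with domain $\mathcal W^{-\infty}\mathcal H$) is essentially self-adjoint.
   Context: Symbols. $V\to M$ is a smooth orthogonal vector bundle with an orthogonal connection $\nabla$ over a manifold $M$ (possibly with corners); either $M$ is compact, or $V=TM$ and $M$ has bounded geometry. Put $\langle v\rangle=(1+\|v\|^2)^{1/2}$, $v\in V$. For $m\in\mathbb R$, $S^m_{1,0}=S^m_{1,0}(V)$ is the space of smooth $a:V\to\mathbb C$ such that, for a locally finite cover of $M$ by open sets trivializing $V$ (normal coordinate balls in the bounded geometry case) and a subordinate smooth partition of unity $(\phi_i)$, $|\partial_x^\alpha\partial_\xi^\beta(\phi_i(x)a(x,\xi))|\le C(\alpha,\beta)\langle\xi\rangle^{m-|\beta|}$ for all $i,\alpha,\beta$; the best constants $C(\alpha,\beta)$ define its topology. $S^\infty_{1,0}=\bigcup_m S^m_{1,0}$, $S^{-\infty}=\bigcap_m S^m_{1,0}$. A symbol $a\in S^m_{1,0}$ is elliptic if there is $b\in S^{-m}_{1,0}$ with $ab-1\in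 S^{-1}_{1,0}$. For $\mu\in\mathbb C$, $m=\mathrm{Re}\,\mu$, a symbol $a\in S^m_{1,0}$ is homogeneous of order $\mu$ if for some $\rho>0$ one has $a(sv)=s^\mu a(v)$ whenever $s>0$ and $\|v\|,\|sv\|\ge \rho$. $S^\mu_{cl}$ (classical symbols of order $\mu$) is the set of $a\in S^m_{1,0}$ for which there are $a_j\in S^{m-j}_{1,0}$ homogeneous of order $\mu-j$ with $a-\sum_{j<k}a_j\in S^{m-k}_{1,0}$ for all $k$. $S^0_{cl}$ has its usual Fréchet topology (identify it with smooth functions on the closed unit ball bundle, the radial compactification of $V$ via $\xi\mapsto\langle\xi\rangle^{-1}\xi$, with seminorms $\max_{l\le n}\|\nabla^l a\|_\infty$), and $S^\mu_{cl}=\langle\cdot\rangle^\mu S^0_{cl}$ has the corresponding topology. Axioms. (i) $\mathcal H$ is a Hilbert space, $\mathcal W^{-\infty}=\bigcup_{k\ge1}\mathcal W^{-\infty}_k$ is a strict inductive limit of Fréchet spaces (each $\mathcal W^{-\infty}_k$ closed in $\mathcal W^{-\infty}_{k+1}$ with the subspace topology) and an algebra with $\mathcal W^{-\infty}_k\mathcal W^{-\infty}_l\subset\mathcal W^{-\infty}_{k+l}$ and continuous multiplication $\mathcal W^{-\infty}_k\times\mathcal W^{-\infty}_l\to\mathcal W^{-\infty}_{k+l}$ (an $LF$-algebra), continuously embedded in the bounded operators $\mathcal L(\mathcal H)$, and $T\mapsto T^*$ maps $\mathcal W^{-\infty}$, and each $\mathcal W^{-\infty}_k$, continuously onto itself.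 (ii) There is an injective $R=R^*\in\mathcal W^{-\infty}_1$ (hence $\mathcal W^{-\infty}\mathcal H$ is dense in $\mathcal H$). (iii) With $\mathcal W^{-\infty}\mathcal H$ the linear span of $\{T\xi\}$, $q:S^\infty_{1,0}\to\mathrm{Hom}(\mathcal W^{-\infty}\mathcal H,\mathcal H)$ is linear, $q(1)=I$, $q(a)$ is symmetric for real $a$, and $q$ restricts to a continuous map $S^{-\infty}\to\mathcal W^{-\infty}_1$. (iv) $q(S^m_{1,0})\mathcal W^{-\infty}_k\subset\mathcal W^{-\infty}_{k+1}$. (v) $\mathcal P:S^\infty_{1,0}\times S^\infty_{1,0}\to S^\infty_{1,0}$ is bilinear; $(a,b)\mapsto q(a)q(b)-q(\mathcal P(a,b))$ is well defined and continuous with values in $\mathcal W^{-\infty}_1$; and the maps $\mathcal P:S^m_{1,0}\times S^n_{1,0}\to S^{m+n}_{1,0}$, $\mathcal P:S^\mu_{cl}\times S^\nu_{cl}\to S^{\mu+\nu}_{cl}$, $(a,b)\mapsto\mathcal P(a,b)-ab:S^m_{1,0}\times S^n_{1,0}\to S^{m+n-1}_{1,0}$ are well defined and continuous. (vi) There are $d>0$ and a continuous seminorm $p$ on $S^{-d-1}_{1,0}$ such that $q(a)$ extends to a bounded operator on $\mathcal H$ with $\|q(a)\|\le p(a)$ for $a\in S^{-d-1}_{1,0}$.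
   Formalization: The compactification is ξ↦ξ/(1+⟨ξ⟩): under ξ/⟨ξ⟩ the symbol ⟨ξ⟩^{-1} becomes √(1-|u|²), not smooth on the closed ball. For bounded geometry, ∇ is Levi-Civita, and the balls have one radius and bounded overlap, with the φ_i uniformly bounded in all derivatives (else 1 is not in S^0). *)

(* Defs.v *)
From HB Require Import structures.
From mathcomp Require Import all_boot all_order all_algebra.
From mathcomp Require Import all_classical all_reals all_analysis.
From mathcomp.real_closed Require Import complex.

Set Implicit Arguments.
Unset Strict Implicit.
Unset Printing Implicit Defensive.

Import Order.TTheory GRing.Theory Num.Theory.
Import numFieldNormedType.Exports.

Local Open Scope classical_set_scope.
Local Open Scope ring_scope.

(** * Partial derivatives and smoothness on subsets of R^N *)

Section Calculus.
Variable R : realType.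
Implicit Type N : nat.

Definition partial N (j : 'I_N) (f : 'rV[R]_N -> R) : 'rV[R]_N -> R :=
  fun x => 'D_(delta_mx ord0 j : 'rV[R]_N) f x.

(* The list [s] plays the role of a multi-index: [size s] is its order. *)
Definition pder N (s : seq 'I_N) (f : 'rV[R]_N -> R) : 'rV[R]_N -> R :=
  foldr (@partial N) f s.

Definition cpder N (s : seq 'I_N) (f : 'rV[R]_N -> R[i]) : 'rV[R]_N -> R[i] :=
  fun x => (pder s (fun y => complex.Re (f y)) x
            +i* pder s (fun y => complex.Im (f y)) x)%C.

Definition smooth_open N (O : set 'rV[R]_N) (f : 'rV[R]_N -> R) : Prop :=
  forall s x, O x ->
    {for x, continuous (pder s f)} /\
    forall j : 'I_N, derivable (pder s f) x (delta_mx ord0 j).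

(* Smoothness on an arbitrary set: local existence of smooth extensions, the
   usual convention at boundary and corner points. *)
Definition smooth_on N (A : set 'rV[R]_N) (f : 'rV[R]_N -> R) : Prop :=
  forall x, A x -> exists O (F : 'rV[R]_N -> R),
    [/\ open O, O x, smooth_open O F & forall y, O y -> A y -> F y = f y].

Definition csmooth_on N (A : set 'rV[R]_N) (f : 'rV[R]_N -> R[i]) : Prop :=
  smooth_on A (fun y => complex.Re (f y)) /\
  smooth_on A (fun y => complex.Im (f y)).

(* The library norm on 'rV is the sup norm; this is the Euclidean one. *)
Definition enorm N (x : 'rV[R]_N) : R := Num.sqrt (\sum_j x ord0 j ^+ 2).

Definition cabs (z : R[i]) : R :=
  Num.sqrt (complex.Re z ^+ 2 + complex.Im z ^+ 2).

Definition cpow (t : R) (mu : R[i]) : R[i] :=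
  (t `^ complex.Re mu * cos (complex.Im mu * ln t)
   +i* (t `^ complex.Re mu * sin (complex.Im mu * ln t)))%C.

(* Covariant derivative of covariant tensors with respect to a local frame
   [E_0, ..., E_(N-1)]: [E l] is the derivation defined by the l-th frame
   field, the connection is [D_(E_l) E_i = \sum_m w l i m E_m], and a tensor of
   degree k is given by its components [T s], [size s = k].  The direction of
   differentiation is the first index. *)
Definition covd N K (E : 'I_N -> ('rV[R]_K -> R) -> 'rV[R]_K -> R)
    (w : 'I_N -> 'I_N -> 'I_N -> 'rV[R]_K -> R)
    (T : seq 'I_N -> 'rV[R]_K -> R) : seq 'I_N -> 'rV[R]_K -> R :=
  fun s y => if s is l :: t then
    E l (T t) y - \sum_(p < size t) \sum_(m < N)
                    w l (nth l t p) m y * T (set_nth l t p m) y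
  else 0.

(* Squared norm of a covariant k-tensor; [K] is the inverse of the Gram matrix
   of the frame. *)
Definition tnorm2 N k (K : 'M[R]_N) (T : seq 'I_N -> R) : R :=
  \sum_(s : k.-tuple 'I_N) \sum_(t : k.-tuple 'I_N)
    (\prod_(p < k) K (tnth s p) (tnth t p)) * T s * T t.

End Calculus.

(** * Orthogonal vector bundles over manifolds with corners *)

Section Charts.
Variables (R : realType) (B : topologicalType) (F : B -> lmodType R).
Variables (n r : nat).

(* A coordinate chart of the base together with a trivialization of the bundle
   over its domain.  [co], [par], [triv] and [frm] are total functions that are
   only meaningful over [dom].  The chart takes values in the quadrant
   [quad cor]; charts with [cor = 0] have open images in R^n. *)
Record bchart := BChart {
  dom : set B;
  cor : nat;
  co : B -> 'rV[R]_n;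
  par : 'rV[R]_n -> B;
  triv : forall x, F x -> 'rV[R]_r;
  frm : forall x, 'rV[R]_r -> F x }.

Definition quad (k : nat) : set 'rV[R]_n :=
  [set y | forall j : 'I_n, (j < k)%N -> 0 <= y ord0 j].

Definition img (c : bchart) : set 'rV[R]_n := co c @` dom c.

(* The interior of the chart image in R^n. *)
Definition cint (c : bchart) : set 'rV[R]_n :=
  [set y | img c y /\ forall j : 'I_n, (j < cor c)%N -> 0 < y ord0 j].

Definition ovl (c d : bchart) : set 'rV[R]_n := co c @` (dom c `&` dom d).

Definition trans (c d : bchart) (y : 'rV[R]_n) : 'rV[R]_n := co d (par c y).

Definition jac (c d : bchart) (y : 'rV[R]_n) : 'M[R]_n :=
  \matrix_(a, b) partial a (fun y' => trans c d y' ord0 b) y.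

(* Row [a] holds the coordinates of the a-th frame vector of [c] in the frame
   of [d], so that coordinate rows transform by [xi |-> xi *m gtrans c d y]. *)
Definition gtrans (c d : bchart) (y : 'rV[R]_n) : 'M[R]_r :=
  \matrix_(a, b) triv d (frm c (par c y) (delta_mx ord0 a)) ord0 b.

Definition is_bchart (c : bchart) : Prop :=
  [/\ open (dom c),
      exists2 O, open O & img c = O `&` quad (cor c),
      forall x, dom c x -> par c (co c x) = x,
      {within dom c, continuous (co c)} /\ {within img c, continuous (par c)} &
      forall x, dom c x ->
        [/\ forall k (v w : F x), triv c (k *: v + w) = k *: triv c v + triv c w,
            forall v : F x, frm c x (triv c v) = v &
            forall xi, triv c (frm c x xi) = xi]].

Definition bcompat (c d : bchart) : Prop :=
  (forall j : 'I_n, smooth_on (ovl c d) (fun y => trans c d y ord0 j)) /\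
  (forall a b : 'I_r, smooth_on (ovl c d) (fun y => gtrans c d y a b)).

End Charts.

Record orth_bundle (R : realType) (n r : nat) := OrthBundle {
  base : topologicalType;
  base_hausdorff : hausdorff_space base;
  base_second_countable : @second_countable base;
  fib : base -> lmodType R;
  fip : forall x, fib x -> fib x -> R;
  fip_sym : forall x (v w : fib x), fip v w = fip w v;
  fip_lin : forall x k (u v w : fib x), fip (k *: u + v) w = k * fip u w + fip v w;
  fip_pos : forall x (v : fib x), v != 0 -> 0 < fip v v;
  atlas : set (bchart fib n r);
  atlas_chart : forall c, atlas c -> is_bchart c;
  atlas_cover : forall x, exists2 c, atlas c & dom c x;
  atlas_compat : forall c d, atlas c -> atlas d -> bcompat c d;
  atlas_max : forall c, is_bchart c ->
    (forall d, atlas d -> bcompat c d /\ bcompat d c) -> atlas c;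
  fip_smooth : forall c, atlas c -> forall a b : 'I_r,
    smooth_on (img c) (fun y => fip (frm c (par c y) (delta_mx ord0 a))
                                    (frm c (par c y) (delta_mx ord0 b))) }.

Section Geometry.
Variables (R : realType) (n r : nat) (V : orth_bundle R n r).
Local Notation chart := (bchart (@fib R n r V) n r).

Definition gram (c : chart) (y : 'rV[R]_n) : 'M[R]_r :=
  \matrix_(a, b) fip (frm c (par c y) (delta_mx ord0 a))
                     (frm c (par c y) (delta_mx ord0 b)).

(* A Riemannian metric on the base, given by its matrix in each chart. *)
Record rmetric := RMetric {
  rmx :> chart -> 'rV[R]_n -> 'M[R]_n;
  rmx_sym : forall c y, atlas c -> img c y -> (rmx c y)^T = rmx c y;
  rmx_pos : forall c y, atlas c -> img c y -> forall v : 'rV[R]_n, v != 0 ->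
    0 < (v *m rmx c y *m v^T) ord0 ord0;
  rmx_smooth : forall c, atlas c -> forall a b : 'I_n,
    smooth_on (img c) (fun y => rmx c y a b);
  rmx_trans : forall c d y, atlas c -> atlas d -> cint c y -> ovl c d y ->
    rmx c y = jac c d y *m rmx d (trans c d y) *m (jac c d y)^T }.

(* An orthogonal connection on the bundle: in the frame (e_a) of the chart [c],
   [nabla_(d_l) e_a = \sum_b omx c y l a b e_b].  The last two fields are the
   change-of-frame rule and the compatibility with the fibre metric. *)
Record oconnection := OConnection {
  omx :> chart -> 'rV[R]_n -> 'I_n -> 'M[R]_r;
  omx_smooth : forall c, atlas c -> forall l (a b : 'I_r),
    smooth_on (img c) (fun y => omx c y l a b);
  omx_trans : forall c d y l, atlas c -> atlas d -> cint c y -> ovl c d y ->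
    omx c y l *m gtrans c d y =
      (\matrix_(a, b) partial l (fun y' => gtrans c d y' a b) y)
      + gtrans c d y *m \sum_k jac c d y l k *: omx d (trans c d y) k;
  omx_orth : forall c y l, atlas c -> cint c y ->
    \matrix_(a, b) partial l (fun y' => gram c y' a b) y =
      omx c y l *m gram c y + gram c y *m (omx c y l)^T }.

Variables (g : rmetric) (nab : oconnection).

(* Levi-Civita connection: [D_(d_i) d_j = \sum_m christoffel c i j m d_m]. *)
Definition christoffel (c : chart) (i j m : 'I_n) (y : 'rV[R]_n) : R :=
  2^-1 * \sum_k invmx (g c y) m k *
    (partial i (fun z => g c z j k) y + partial j (fun z => g c z i k) y
     - partial k (fun z => g c z i j) y).

Definition curvature (c : chart) (s : seq 'I_n) (y : 'rV[R]_n) : R :=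
  if s is [:: i; j; k; l] then
    \sum_m g c y m l *
      (partial i (christoffel c j k m) y - partial j (christoffel c i k m) y
       + \sum_p (christoffel c i p m y * christoffel c j k p y
                 - christoffel c j p m y * christoffel c i k p y))
  else 0.

Definition nabla_curvature (c : chart) (k : nat) : seq 'I_n -> 'rV[R]_n -> R :=
  iter k (covd (@partial R n) (christoffel c)) (curvature c).

(** * Symbols *)

Definition tot : Type := {x : base V & fib x}.

Definition symb : Type := tot -> R[i].

Definition fnorm (v : tot) : R := Num.sqrt (fip (projT2 v) (projT2 v)).

Definition vscale (s : R) (v : tot) : tot :=
  existT _ (projT1 v) (s *: projT2 v).

Definition loc (c : chart) (a : symb) (z : 'rV[R]_(n + r)) : R[i] :=
  a (existT _ (par c (lsubmx z)) (frm c (par c (lsubmx z)) (rsubmx z))).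

Definition smooth_symb (a : symb) : Prop :=
  forall c, atlas c -> csmooth_on [set z | img c (lsubmx z)] (loc c a).

(* [jbr t] is the Japanese bracket of a vector of norm t. *)
Definition jbr (t : R) : R := Num.sqrt (1 + t ^+ 2).

(* A locally finite cover of the base by bundle charts with a subordinate
   smooth partition of unity. *)
Record pou := Pou {
  pidx : choiceType;
  pch : pidx -> chart;
  pfun : pidx -> base V -> R;
  pou_atlas : forall j, atlas (pch j);
  pou_cover : forall x, exists j, dom (pch j) x;
  pou_locfin : forall x : base V, exists2 U, nbhs x U &
    finite_set [set j | U `&` dom (pch j) !=set0];
  pou_smooth : forall j c, atlas c ->
    smooth_on (img c) (fun y => pfun j (par c y));
  pou_ge0 : forall j (x : base V), 0 <= pfun j x;
  pou_supp : forall j, closure [set x | pfun j x != 0] `<=` dom (pch j);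
  pou_sum1 : forall x : base V, \sum_(j \in [set: pidx]) pfun j x = 1 }.

Variable pu : pou.

(* The values over which the best constant C(alpha, beta) is the supremum.
   Points of [cint] suffice: all derivatives extend continuously to the
   boundary points of the chart image. *)
Definition symb_quot (m : R) (st : seq 'I_n * seq 'I_r) (a : symb) : set R :=
  [set w | exists (j : pidx pu) (y : 'rV[R]_n) (xi : 'rV[R]_r),
     cint (pch j) y /\
     w = cabs (cpder ([seq lshift r i | i <- st.1] ++ [seq rshift n i | i <- st.2])
                 (loc (pch j) (fun v => (pfun j (projT1 v))%:C%C * a v))
                 (row_mx y xi))
         * jbr (enorm xi) `^ ((size st.2)%:R - m)].

Definition inS (m : R) : set symb :=
  [set a | smooth_symb a /\ forall st, has_ubound (symb_quot m st a)].

Definition inS_infty : set symb := [set a | exists m, inS m a].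

Definition inS_minfty : set symb := [set a | forall m, inS m a].

(* The defining seminorms of S^m, i.e. the best constants. *)
Definition symb_sn (m : R) (st : seq 'I_n * seq 'I_r) (a : symb) : R :=
  sup (symb_quot m st a).

(* The projective limit topology of S^{-infty}. *)
Definition symb_sn_minfty (i : R * (seq 'I_n * seq 'I_r)) (a : symb) : R :=
  symb_sn i.1 i.2 a.

Definition elliptic (m : R) (a : symb) : Prop :=
  inS m a /\
  exists2 b, inS (- m) b & inS (- 1) (fun v => a v * b v - 1).

Definition real_symb (a : symb) : Prop := forall v, complex.Im (a v) = 0.

Definition homogeneous (mu : R[i]) (a : symb) : Prop :=
  inS (complex.Re mu) a /\
  exists2 rho : R, 0 < rho & forall s v, 0 < s -> rho <= fnorm v ->
    rho <= fnorm (vscale s v) -> a (vscale s v) = cpow s mu * a v.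

Definition inScl (mu : R[i]) : set symb :=
  [set a | inS (complex.Re mu) a /\
     exists a_ : nat -> symb, forall k : nat,
       homogeneous (mu - k%:R) (a_ k) /\
       inS (complex.Re mu - k%:R) (fun v => a v - \sum_(j < k) a_ j v)].

(* Pull-back of [<.>^(-mu) a] to the open unit ball bundle under the radial
   compactification [v |-> v / (1 + <v>)], whose inverse is
   [u |-> 2 u / (1 - |u|^2)].  (For [v |-> v / <v>] the function [1 / <v>], which
   is classical of order -1, would become [sqrt (1 - |u|^2)], which is not
   smooth up to the boundary.) *)
Definition compactify (mu : R[i]) (a : symb) : symb := fun u =>
  let v := vscale (2 / (1 - fnorm u ^+ 2)) u in
  cpow (jbr (fnorm v)) (- mu) * a v.

(* The frame of T(V) over a chart: horizontal lifts of the coordinate fields,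
   followed by the vertical fields of the bundle frame. *)
Definition hv_der (c : chart) (l : 'I_(n + r)) (f : 'rV[R]_(n + r) -> R) :
    'rV[R]_(n + r) -> R :=
  fun z => match fintype.split l with
  | inl i => partial l f z
      - \sum_a \sum_b rsubmx z ord0 a * nab c (lsubmx z) i a b
                      * partial (rshift n b) f z
  | inr _ => partial l f z
  end.

(* The sum of the pulled back Levi-Civita connection on horizontal vectors and
   of the pulled back bundle connection on vertical ones. *)
Definition hv_con (c : chart) (l i m : 'I_(n + r)) (z : 'rV[R]_(n + r)) : R :=
  match fintype.split l, fintype.split i, fintype.split m with
  | inl l', inl i', inl m' => christoffel c l' i' m' (lsubmx z)
  | inl l', inr a, inr b => nab c (lsubmx z) l' a b
  | _, _, _ => 0
  end.

Definition hv_nabla (c : chart) (k : nat) (f : 'rV[R]_(n + r) -> R) :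
    seq 'I_(n + r) -> 'rV[R]_(n + r) -> R :=
  iter k (covd (hv_der c) (hv_con c)) (fun=> f).

Definition hv_nabla_norm (c : chart) (k : nat) (f : symb) (z : 'rV[R]_(n + r)) : R :=
  let K := invmx (block_mx (g c (lsubmx z)) 0 0 (gram c (lsubmx z))) in
  Num.sqrt (
    tnorm2 k K (fun s => hv_nabla c k (fun z' => complex.Re (loc c f z')) s z) +
    tnorm2 k K (fun s => hv_nabla c k (fun z' => complex.Im (loc c f z')) s z)).

(* The seminorms of S^mu_cl: maximal C^k-norms on the ball bundle. *)
Definition scl_sn (mu : R[i]) (k : nat) (a : symb) : R :=
  sup [set w | exists (l : nat) (c : chart) (y : 'rV[R]_n) (eta : 'rV[R]_r),
    [/\ (l <= k)%N, atlas c, cint c y,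
        fnorm (existT _ (par c y) (frm c (par c y) eta)) < 1 &
        w = hv_nabla_norm c l (compactify mu a) (row_mx y eta)]].

End Geometry.

(** * The two geometric settings *)

Section Tangent.
Variables (R : realType) (n : nat) (V : orth_bundle R n n).
Variables (g : rmetric V) (nab : oconnection V).
Local Notation chart := (bchart (@fib R n n V) n n).

(* An identification V = TM, given by the charts whose frame is the coordinate
   frame. *)
Definition tangent_frames (cf : set chart) : Prop :=
  [/\ cf `<=` atlas (o:=V),
      forall x, exists2 c, cf c & dom c x,
      forall c d y, cf c -> cf d -> cint c y -> ovl c d y ->
        gtrans c d y = jac c d y &
      forall c, atlas c ->
        (forall d y, cf d -> cint c y -> ovl c d y -> gtrans c d y = jac c d y) ->
        cf c].

(* Normal coordinates on a geodesic ball: the metric is Euclidean at the origin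
   and the radial lines are geodesics. *)
Definition normal_chart (cf : set chart) (rho : R) (p : base V) (c : chart) : Prop :=
  [/\ cf c, cor c = 0%N, img c = [set y | enorm y < rho], par c 0 = p &
      g c 0 = 1%:M /\
      forall y k, img c y ->
        \sum_i \sum_j christoffel g c i j k y * y ord0 i * y ord0 j = 0].

(* [rinj] is a positive lower bound for the injectivity radius. *)
Definition bounded_geometry (cf : set chart) (rinj : R) : Prop :=
  [/\ 0 < rinj,
      forall p, exists c, normal_chart cf rinj p c &
      forall k, exists C, forall c y, cf c -> cint c y ->
        Num.sqrt (tnorm2 (k + 4) (invmx (g c y))
                    (fun s => nabla_curvature g c k s y)) <= C].

(* The usual cover of a manifold of bounded geometry by normal coordinate balls
   of a fixed radius, uniformly locally finite, with a partition of unity that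
   has uniformly bounded derivatives in normal coordinates. *)
Definition uniform_pou (cf : set chart) (rho : R) (pu : pou V) : Prop :=
  [/\ forall j : pidx pu, exists p, normal_chart cf rho p (pch j),
      exists N : nat, forall x (s : seq (pidx pu)), uniq s ->
        (forall j, j \in s -> dom (pch j) x) -> (size s <= N)%N &
      forall s : seq 'I_n, exists C, forall (j : pidx pu) y, cint (pch j) y ->
        `|pder s (fun z => pfun j (par (pch j) z)) y| <= C].

End Tangent.

(* In the compact case the metric on the base is auxiliary.  In the bounded
   geometry case the metric and the connection are those of V = TM. *)
Inductive setting (R : realType) : forall (n r : nat) (V : orth_bundle R n r),
    rmetric V -> oconnection V -> pou V -> Prop :=
| setting_compact n r (V : orth_bundle R n r) (g : rmetric V)
    (nab : oconnection V) (pu : pou V) :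
    compact [set: base V] -> setting g nab pu
| setting_bounded n (V : orth_bundle R n n) (g : rmetric V)
    (nab : oconnection V) (pu : pou V)
    (cf : set (bchart (@fib R n n V) n n)) (rinj rho : R) :
    tangent_frames cf ->
    (forall c y, cf c -> img c y -> g c y = gram c y) ->
    (forall c y, cf c -> cint c y -> forall l a b,
       nab c y l a b = christoffel g c l a b y) ->
    bounded_geometry g cf rinj ->
    0 < rho < rinj ->
    uniform_pou g cf rho pu ->
    setting g nab pu.

(** * Topologies defined by seminorms *)

Section Seminorms.
Variable R : realType.

(* Continuity on [D] for the topologies generated by the families [p] and [q]. *)
Definition sn_continuous (X Y : zmodType) (I J : eqType) (D : set X)
    (p : I -> X -> R) (q : J -> Y -> R) (f : X -> Y) : Prop :=
  forall x, D x -> forall j e, 0 < e ->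
    exists (s : seq I) (d : R), 0 < d /\
      forall y, D y -> (forall i, i \in s -> p i (y - x) < d) ->
        q j (f y - f x) < e.

Definition sn_prod (X Y : zmodType) (I J : Type)
    (p : I -> X -> R) (q : J -> Y -> R) (k : I + J) (z : X * Y) : R :=
  match k with inl i => p i z.1 | inr j => q j z.2 end.

Definition is_subspace (X : lmodType R[i]) (D : set X) : Prop :=
  D 0 /\ forall k x y, D x -> D y -> D (k *: x + y).

Definition seminorm_on (X : lmodType R[i]) (D : set X) (p : X -> R) : Prop :=
  [/\ forall x, D x -> 0 <= p x,
      forall k x, D x -> p (k *: x) = cabs k * p x &
      forall x y, D x -> D y -> p (x + y) <= p x + p y].

Definition sn_closed (X : zmodType) (I : eqType) (D D' : set X)
    (p : I -> X -> R) : Prop :=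
  forall x, D' x ->
    (forall (s : seq I) d, 0 < d ->
       exists2 y, D y & forall i, i \in s -> p i (y - x) < d) -> D x.

(* [D] with the countable family [p] is a Frechet space. *)
Definition frechet (X : lmodType R[i]) (D : set X) (p : nat -> X -> R) : Prop :=
  [/\ is_subspace D,
      forall i, seminorm_on D (p i),
      forall x, D x -> (forall i, p i x = 0) -> x = 0 &
      forall u : nat -> X, (forall k, D (u k)) ->
        (forall i e, 0 < e -> exists N : nat, forall k l : nat,
           (N <= k)%N -> (N <= l)%N -> p i (u k - u l) < e) ->
        exists2 x, D x & forall i e, 0 < e -> exists N : nat, forall k : nat,
           (N <= k)%N -> p i (u k - x) < e].

Definition abs_sn (_ : unit) (x : R) : R := `|x|.

Definition continuous_seminorm (X : lmodType R[i]) (I : eqType) (D : set X)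
    (sn : I -> X -> R) (p : X -> R) : Prop :=
  seminorm_on D p /\ sn_continuous D sn abs_sn p.

End Seminorms.

(** * Hilbert spaces and operators *)

Record hilbert (R : realType) := Hilbert {
  hcar :> lmodType R[i];
  hip : hcar -> hcar -> R[i];
  hip_lin : forall k x y z, hip (k *: x + y) z = k * hip x z + hip y z;
  hip_conj : forall x y, hip y x = (hip x y)^*%C;
  hip_ge0 : forall x, 0 <= hip x x;
  hip_eq0 : forall x, hip x x = 0 -> x = 0;
  hip_complete : forall u : nat -> hcar,
    let hn x := Num.sqrt (complex.Re (hip x x)) in
    (forall e, 0 < e -> exists N : nat, forall k l : nat,
       (N <= k)%N -> (N <= l)%N -> hn (u k - u l) < e) ->
    exists x, forall e, 0 < e -> exists N : nat, forall k : nat,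
       (N <= k)%N -> hn (u k - x) < e }.

Section Operators.
Variables (R : realType) (H : hilbert R).
Implicit Types (T S : H -> H) (D : set H).

Definition hnorm (x : H) : R := Num.sqrt (complex.Re (hip x x)).

Definition bounded_op T : Prop :=
  (forall k x y, T (k *: x + y) = k *: T x + T y) /\
  exists C, forall x, hnorm (T x) <= C * hnorm x.

Definition opnorm T : R := sup [set hnorm (T x) | x in [set x | hnorm x <= 1]].

Definition opnorm_sn (_ : unit) T : R := opnorm T.

Definition adjoint T S : Prop := forall x y, hip (T x) y = hip x (S y).

Definition dense_in D : Prop :=
  forall x e, 0 < e -> exists2 y, D y & hnorm (x - y) < e.

(* [T], defined on [D], extends to the bounded operator [S]. *)
Definition extends_to D T S : Prop :=
  bounded_op S /\ forall x, D x -> S x = T x.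

Definition linear_on D T : Prop :=
  forall k x y, D x -> D y -> T (k *: x + y) = k *: T x + T y.

Definition symmetric_on D T : Prop :=
  forall x y, D x -> D y -> hip (T x) y = hip x (T y).

Definition graph_on D T : set (H * H) := [set p | D p.1 /\ p.2 = T p.1].

Definition graph_closure (G : set (H * H)) : set (H * H) :=
  [set p | forall e, 0 < e ->
     exists2 p', G p' & hnorm (p.1 - p'.1) < e /\ hnorm (p.2 - p'.2) < e].

(* The graph of the adjoint of the operator with graph [G]. *)
Definition graph_adjoint (G : set (H * H)) : set (H * H) :=
  [set p | forall p', G p' -> hip p'.2 p.1 = hip p'.1 p.2].

(* Densely defined, symmetric, and the closure is self-adjoint. *)
Definition essentially_self_adjoint D T : Prop :=
  [/\ dense_in D, linear_on D T, symmetric_on D T &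
      graph_adjoint (graph_closure (graph_on D T)) =
      graph_closure (graph_on D T)].

End Operators.

(** * The axioms *)

Section QuantizationAxioms.
Variables (R : realType) (n r : nat) (V : orth_bundle R n r).
Variables (g : rmetric V) (nab : oconnection V) (pu : pou V).
Variables (H : hilbert R).
(* [W k] stands for W^{-infty}_k, as a space of operators on H, and [wsn k] for
   a family of seminorms that defines its topology; only k >= 1 matters. *)
Variables (W : nat -> set (H -> H)) (wsn : nat -> nat -> (H -> H) -> R).
Variables (P : symb V -> symb V -> symb V) (q : symb V -> H -> H).

Definition W_infty : set (H -> H) := [set T | exists2 k, (0 < k)%N & W k T].

(* The linear span of the vectors T xi; the domain of all the [q a]. *)
Definition WH : set H :=
  [set x | exists (N : nat) (T : 'I_N -> H -> H) (xi : 'I_N -> H),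
     (forall i, W_infty (T i)) /\ x = \sum_i T i (xi i)].

(* Continuity on the inductive limit W^{-infty} is continuity on each W k. *)
Definition axiom_i : Prop :=
  [/\ forall k, (0 < k)%N -> frechet (W k) (wsn k),
      forall k, (0 < k)%N ->
        [/\ W k `<=` W k.+1,
            sn_continuous (W k) (wsn k) (wsn k.+1) id,
            sn_continuous (W k) (wsn k.+1) (wsn k) id &
            sn_closed (W k) (W k.+1) (wsn k.+1)],
      forall k l, (0 < k)%N -> (0 < l)%N ->
        (forall T S, W k T -> W l S -> W (k + l)%N (T \o S)) /\
        sn_continuous (W k `*` W l) (sn_prod (wsn k) (wsn l)) (wsn (k + l)%N)
          (fun z : (H -> H) * (H -> H) => z.1 \o z.2),
      forall k, (0 < k)%N ->
        W k `<=` @bounded_op R H /\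
        sn_continuous (W k) (wsn k) (@opnorm_sn R H) id &
      exists star : (H -> H) -> H -> H, forall k, (0 < k)%N ->
        [/\ forall T, W k T -> adjoint T (star T),
            star @` W k = W k &
            sn_continuous (W k) (wsn k) (wsn k) star]].

Definition axiom_ii : Prop :=
  exists T, [/\ W 1 T, adjoint T T & injective T].

Definition axiom_iii : Prop :=
  [/\ forall a, inS_infty pu a -> linear_on WH (q a),
      forall k a b, inS_infty pu a -> inS_infty pu b -> forall x, WH x ->
        q (fun v => k * a v + b v) x = k *: q a x + q b x,
      forall x, WH x -> q (fun=> 1) x = x,
      forall a, inS_infty pu a -> real_symb a -> symmetric_on WH (q a) &
      exists K : symb V -> H -> H,
        (forall a, inS_minfty pu a ->
           W 1 (K a) /\ forall x, WH x -> K a x = q a x) /\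
        sn_continuous (inS_minfty pu)
          (symb_sn_minfty pu) (wsn 1) K].

Definition axiom_iv : Prop :=
  forall m a k T, inS pu m a -> (0 < k)%N -> W k T -> W k.+1 (q a \o T).

Definition axiom_v : Prop :=
  [/\ (forall a b, inS_infty pu a -> inS_infty pu b -> inS_infty pu (P a b)) /\
      (forall k a a' b, inS_infty pu a -> inS_infty pu a' -> inS_infty pu b ->
         P (fun v => k * a v + a' v) b = (fun v => k * P a b v + P a' b v) /\
         P b (fun v => k * a v + a' v) = (fun v => k * P b a v + P b a' v)),
      exists K : symb V -> symb V -> H -> H,
        (forall a b, inS_infty pu a -> inS_infty pu b ->
           W 1 (K a b) /\
           forall x, WH x -> K a b x = q a (q b x) - q (P a b) x) /\
        (forall m m' : R,
           sn_continuous (inS pu m `*` inS pu m')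
             (sn_prod (symb_sn pu m) (symb_sn pu m')) (wsn 1)
             (fun z => K z.1 z.2)),
      forall m m' : R,
        (forall a b, inS pu m a -> inS pu m' b -> inS pu (m + m') (P a b)) /\
        sn_continuous (inS pu m `*` inS pu m')
          (sn_prod (symb_sn pu m) (symb_sn pu m')) (symb_sn pu (m + m'))
          (fun z => P z.1 z.2),
      forall mu nu : R[i],
        (forall a b, inScl pu mu a -> inScl pu nu b -> inScl pu (mu + nu) (P a b)) /\
        sn_continuous (inScl pu mu `*` inScl pu nu)
          (sn_prod (scl_sn g nab mu) (scl_sn g nab nu)) (scl_sn g nab (mu + nu))
          (fun z => P z.1 z.2) &
      forall m m' : R,
        (forall a b, inS pu m a -> inS pu m' b ->
           inS pu (m + m' - 1) (fun v => P a b v - a v * b v)) /\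
        sn_continuous (inS pu m `*` inS pu m')
          (sn_prod (symb_sn pu m) (symb_sn pu m')) (symb_sn pu (m + m' - 1))
          (fun z => (fun v => P z.1 z.2 v - z.1 v * z.2 v))].

Definition axiom_vi : Prop :=
  exists (d : R) (p : symb V -> R),
    [/\ 0 < d,
        continuous_seminorm (inS pu (- d - 1))
          (symb_sn pu (- d - 1)) p &
        forall a, inS pu (- d - 1) a ->
          exists2 S, extends_to WH (q a) S & opnorm S <= p a].

Definition quantization_axioms : Prop :=
  [/\ axiom_i, axiom_ii & axiom_iii] /\ [/\ axiom_iv, axiom_v & axiom_vi].

End QuantizationAxioms.

(* Main.v *)
(* Symbols of negative order quantize to bounded operators: for order [-d - 1]
   this is axiom (vi), and [q(a)^* q(a) = q(P(conj a, a)) + K] halves the order.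
   For order [0] rescale so that [|a| <= 1/2] and put [b = sqrt (1 - |a|^2)];
   then [q(b)^2 + q(a)^* q(a) - 1] has order [-1], so [q(a)] is bounded, with a
   bound that is uniform over bounded sets of symbols.  As the topology of
   [S^0] is given by countably many seminorms, this makes [a |-> ||q(a)||] a
   continuous seminorm.

   That [b] is a symbol is deduced from the algebra structure of [S^0], which
   axiom (v) provides: a differential operator [L] satisfies
   [L(f(u)) = \sum_k f^(k)(u) G_k], where [G_k] does not depend on [f] and is a
   combination of the [u^j L(u^i)], and the powers [u^i] lie in [S^0].  This
   avoids changes of charts.

   If [a] is real and elliptic, then [q(a) B = 1 + E] where [B] and [E] are, up
   to [W^{-infty}], quantizations of symbols of order [-m].  A pair [(y, h)] in
   the graph of [q(a)^*] then satisfies [y = B^* h - E^* y], and the boundedness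
   of [q(a) B^*] and [q(a) E^*] puts [(y, h)] in the graph of the closure. *)
Require Import Defs.
From mathcomp Require Import all_boot all_order all_algebra.
From mathcomp Require Import all_classical all_reals all_analysis.
From mathcomp.real_closed Require Import complex.
From mathcomp Require Import ring lra.

Set Implicit Arguments.
Unset Strict Implicit.
Unset Printing Implicit Defensive.

Import Order.TTheory GRing.Theory Num.Theory.
Import numFieldNormedType.Exports.
Local Open Scope classical_set_scope.
Local Open Scope ring_scope.
(** * Hilbert spaces and bounded operators *)

(** The axioms state continuity without explicit estimates, and the square root trick is not linear
    in the symbol, so no seminorm bounding [q a] can be read off along the way. Estimates are
    therefore made for bounded families of symbols. Such families pass through every continuous map
    that is homogeneous under dilations, and also through the nonlinear passage to a square root.
    One argument by contradiction then converts boundedness on bounded families into continuity.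

    The geometry enters through two properties of the partition of unity: uniformly bounded
    derivatives of the cutoffs, which put the constant 1 in order 0, and a bounded number of charts
    over each point, which makes symbols of order 0 bounded functions.

    For self-adjointness, an error of order -1 in the parametrix is too weak: [q a] composed with
    the adjoint of the error must have order at most 0. The error is improved by repeated squaring,
    which requires a calculus of operators modulo W^{-infty}. *)

Section Cabs.
Variable R : realType.
Implicit Types z w : R[i].

Lemma cabsE z : `|z| = (cabs z)%:C%C.
Proof. by case: z => x y; rewrite normc_def. Qed.

Lemma cabs_ge0 z : 0 <= cabs z.
Proof. exact: sqrtr_ge0. Qed.

Lemma cabsM z w : cabs (z * w) = cabs z * cabs w.
Proof. by apply: complexI; rewrite rmorphM /= -!cabsE normrM. Qed.

Lemma cabsD z w : cabs (z + w) <= cabs z + cabs w.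
Proof. by have := ler_normD z w; rewrite !cabsE -rmorphD /= lecR. Qed.

Lemma cabsN z : cabs (- z) = cabs z.
Proof. by rewrite /cabs; case: z => x y /=; rewrite !sqrrN. Qed.

Lemma cabs0 : cabs (0 : R[i]) = 0.
Proof. by rewrite /cabs /= expr0n /= addr0 sqrtr0. Qed.

Lemma cabs_real (x : R) : cabs x%:C%C = `|x|.
Proof. by rewrite /cabs /= expr0n /= addr0 sqrtr_sqr. Qed.

Lemma cabs_Re z : `|complex.Re z| <= cabs z.
Proof. by rewrite -sqrtr_sqr ler_wsqrtr// lerDl sqr_ge0. Qed.

Lemma cabs_conj z : cabs z^*%C = cabs z.
Proof. by rewrite /cabs; case: z => x y /=; rewrite sqrrN. Qed.

Lemma cabs_sqr z : cabs z ^+ 2 = complex.Re z ^+ 2 + complex.Im z ^+ 2.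
Proof. by rewrite sqr_sqrtr// addr_ge0// sqr_ge0. Qed.

End Cabs.

Section Hilbert.
Variables (R : realType) (H : hilbert R).
Implicit Types (x y z : H) (D : set H).

Lemma hipDl x y z : hip (x + y) z = hip x z + hip y z.
Proof. by have := hip_lin 1 x y z; rewrite scale1r mul1r. Qed.

Lemma hip0l z : hip 0 z = 0.
Proof. by apply: (addrI (hip 0 z)); rewrite -hipDl !addr0. Qed.

Lemma hipZl k x z : hip (k *: x) z = k * hip x z.
Proof. by have := hip_lin k x 0 z; rewrite addr0 hip0l addr0. Qed.

Lemma hipNl x z : hip (- x) z = - hip x z.
Proof. by rewrite -scaleN1r hipZl mulN1r. Qed.

Lemma hipDr x y z : hip z (x + y) = hip z x + hip z y.
Proof. by rewrite hip_conj hipDl rmorphD /= -!hip_conj. Qed.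

Lemma hipZr k x z : hip z (k *: x) = k^*%C * hip z x.
Proof. by rewrite hip_conj hipZl rmorphM /= -hip_conj. Qed.

Lemma hipNr x z : hip z (- x) = - hip z x.
Proof. by rewrite hip_conj hipNl rmorphN /= -hip_conj. Qed.

Lemma hip0r z : hip z 0 = 0.
Proof. by rewrite hip_conj hip0l rmorph0. Qed.

Lemma hip_inj x y : (forall z, hip z x = hip z y) -> x = y.
Proof.
move=> h; apply/eqP; rewrite -subr_eq0; apply/eqP; apply: hip_eq0.
by rewrite {1}/GRing.add /= hipDr hipNr h subrr.
Qed.

(** The underlying real inner product. The complex one is recovered by testing with [x] and with
    ['i] times [x], so Cauchy-Schwarz and orthogonality can be treated over the reals. *)
Definition rip x y : R := complex.Re (hip x y).

Lemma hip_self x : hip x x = (rip x x)%:C%C.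
Proof.
by have := hip_ge0 x; rewrite /rip; case: (hip x x) => a b; rewrite lecE /= => /andP[/eqP ->].
Qed.

Lemma rip_ge0 x : 0 <= rip x x.
Proof. by have := hip_ge0 x; rewrite lecE /= => /andP[_]. Qed.

Lemma ripC x y : rip x y = rip y x.
Proof. by rewrite /rip hip_conj; case: (hip y x). Qed.

Lemma ripDl x y z : rip (x + y) z = rip x z + rip y z.
Proof. by rewrite /rip hipDl raddfD. Qed.

Lemma ripNl x z : rip (- x) z = - rip x z.
Proof. by rewrite /rip hipNl raddfN. Qed.

Lemma ripBl x y z : rip (x - y) z = rip x z - rip y z.
Proof. by rewrite ripDl ripNl. Qed.

Lemma ripZl (t : R) x z : rip (t%:C%C *: x) z = t * rip x z.
Proof. by rewrite /rip hipZl; case: (hip x z) => a b /=; rewrite mul0r subr0. Qed.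

Lemma ripBr x y z : rip z (x - y) = rip z x - rip z y.
Proof. by rewrite !(ripC z) ripBl. Qed.

Lemma ripDr x y z : rip z (x + y) = rip z x + rip z y.
Proof. by rewrite !(ripC z) ripDl. Qed.

Lemma ripZr (t : R) x z : rip z (t%:C%C *: x) = t * rip z x.
Proof. by rewrite !(ripC z) ripZl. Qed.

Lemma hnorm_ge0 x : 0 <= hnorm x.
Proof. exact: sqrtr_ge0. Qed.

Lemma hnorm_sqr x : hnorm x ^+ 2 = rip x x.
Proof. by rewrite sqr_sqrtr// rip_ge0. Qed.

Lemma hnorm0 : hnorm (0 : H) = 0.
Proof. by rewrite /hnorm hip0l /= sqrtr0. Qed.

Lemma hnorm_eq0 x : hnorm x = 0 -> x = 0.
Proof.
move=> h; apply: hip_eq0; rewrite hip_self -hnorm_sqr h expr0n.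
by rewrite /= rmorph0.
Qed.

Lemma hnormZ k x : hnorm (k *: x) = cabs k * hnorm x.
Proof.
apply/eqP; rewrite -(@eqrXn2 _ 2)// ?mulr_ge0 ?hnorm_ge0 ?cabs_ge0//.
rewrite exprMn !hnorm_sqr cabs_sqr /rip hipZl hipZr hip_self.
case: k => a b /=; apply/eqP; ring.
Qed.

Lemma hnormN x : hnorm (- x) = hnorm x.
Proof. by rewrite -scaleN1r hnormZ cabsN /cabs /= expr0n addr0 expr1n sqrtr1 mul1r. Qed.

Lemma hnormC x y : hnorm (x - y) = hnorm (y - x).
Proof. by rewrite -hnormN opprB. Qed.

(** The square of the norm of [hnorm y] times [x] minus [hnorm x] times [y] is nonnegative;
    expanded, it is the claim multiplied by [2 * hnorm x * hnorm y]. Working with the real part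
    avoids the choice of a phase. *)
Lemma rip_le x y : rip x y <= hnorm x * hnorm y.
Proof.
have [->|y0] := eqVneq y 0.
  by rewrite ripC /rip hip0l hnorm0 mulr0.
have n0 : 0 < hnorm y.
  by rewrite lt_neqAle hnorm_ge0 andbT eq_sym; apply: contra_neq y0; exact: hnorm_eq0.
have [->|x0] := eqVneq x 0.
  by rewrite /rip hip0l hnorm0 mul0r.
have := rip_ge0 ((hnorm y)%:C%C *: x - (hnorm x)%:C%C *: y).
rewrite ripBl !ripBr !ripZl !ripZr -!hnorm_sqr (ripC y x).
have m0 : 0 < hnorm x.
  by rewrite lt_neqAle hnorm_ge0 andbT eq_sym; apply: contra_neq x0; exact: hnorm_eq0.
move=> h; rewrite -(ler_pM2l (mulr_gt0 m0 n0)); nra.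
Qed.

Lemma rip_abs x y : `|rip x y| <= hnorm x * hnorm y.
Proof.
rewrite ler_norml rip_le andbT lerNl -ripNl (le_trans (rip_le _ _))//.
by rewrite hnormN.
Qed.

Lemma hnormD x y : hnorm (x + y) <= hnorm x + hnorm y.
Proof.
rewrite -(@ler_pXn2r _ 2)// ?nnegrE ?addr_ge0 ?hnorm_ge0//.
rewrite hnorm_sqr ripDl !ripDr -!hnorm_sqr (ripC y x) sqrrD.
have := rip_le x y; lra.
Qed.

Lemma hnorm_tri z x y : hnorm (x - y) <= hnorm (x - z) + hnorm (z - y).
Proof. by rewrite (le_trans _ (hnormD _ _))// addrA subrK. Qed.

Lemma hnorm_small x : (forall e, 0 < e -> hnorm x < e) -> x = 0.
Proof.
move=> h; apply: hnorm_eq0; apply/eqP; rewrite eq_le hnorm_ge0 andbT leNgt.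
by apply/negP => x0; have := h _ x0; rewrite ltxx.
Qed.

Definition hlim (u : nat -> H) x := forall e, 0 < e ->
  exists N, forall k, (N <= k)%N -> hnorm (u k - x) < e.

Lemma hlim_uniq u x y : hlim u x -> hlim u y -> x = y.
Proof.
move=> ux uy; apply/eqP; rewrite -subr_eq0; apply/eqP; apply: hnorm_small => e e0.
have [N1 h1] := ux _ (divr_gt0 e0 (ltr0n R 2)).
have [N2 h2] := uy _ (divr_gt0 e0 (ltr0n R 2)).
rewrite (le_lt_trans (hnorm_tri (u (maxn N1 N2)) _ _))//.
rewrite hnormC (splitr e) ltrD// ?h1 ?h2// ?leq_maxl ?leq_maxr//.
Qed.

Lemma hlim_lip (u v : nat -> H) x y C :
  (forall k, hnorm (v k - y) <= C * hnorm (u k - x)) -> hlim u x -> hlim v y.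
Proof.
move=> h ux e e0.
(* [C] carries no sign, hence the positive denominator. *)
have C0 : 0 < `|C| + 1 by rewrite ltr_wpDl.
have [N hN] := ux _ (divr_gt0 e0 C0).
exists N => k /hN; rewrite ltr_pdivlMr// => hk.
rewrite (le_lt_trans (h k))// (le_lt_trans _ hk)// mulrC ler_wpM2l ?hnorm_ge0//.
by rewrite (le_trans (ler_norm _))// lerDl.
Qed.

Lemma hlimD u v x y : hlim u x -> hlim v y -> hlim (fun k => u k + v k) (x + y).
Proof.
move=> ux vy e e0.
have [N1 h1] := ux _ (divr_gt0 e0 (ltr0n R 2)).
have [N2 h2] := vy _ (divr_gt0 e0 (ltr0n R 2)).
exists (maxn N1 N2) => k; rewrite geq_max => /andP[k1 k2].
rewrite opprD addrACA (le_lt_trans (hnormD _ _))//.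
by rewrite (splitr e) ltrD// ?h1 ?h2.
Qed.

Lemma hlimZ k u x : hlim u x -> hlim (fun n => k *: u n) (k *: x).
Proof. by apply: (@hlim_lip _ _ _ _ (cabs k)) => n; rewrite -scalerBr hnormZ. Qed.

(** An identity of inner products survives the limit along two different sequences. Real parts are
    compared after scaling the second arguments by [w]; [w = 1] and [w = 'i] give the two
    components. *)
Lemma hlim_hip u v x y a b : hlim u x -> hlim v y ->
  (forall k, hip (u k) a = hip (v k) b) -> hip x a = hip y b.
Proof.
move=> ux vy h.
have hr (w : R[i]) : rip x (w *: a) = rip y (w *: b).
  apply/eqP; rewrite -subr_eq0 -normr_le0; apply/ler_addgt0Pr => e e0; rewrite add0r.
  have ea : 0 < hnorm (w *: a) + 1 by rewrite ltr_wpDl// hnorm_ge0.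
  have eb : 0 < hnorm (w *: b) + 1 by rewrite ltr_wpDl// hnorm_ge0.
  have [N1 h1] := ux _ (divr_gt0 (divr_gt0 e0 (ltr0n R 2)) ea).
  have [N2 h2] := vy _ (divr_gt0 (divr_gt0 e0 (ltr0n R 2)) eb).
  pose k := maxn N1 N2.
  have := h1 k (leq_maxl _ _); have := h2 k (leq_maxr _ _).
  rewrite (ltr_pdivlMr _ _ ea) (ltr_pdivlMr _ _ eb) => t2 t1.
  have hk : rip (u k) (w *: a) = rip (v k) (w *: b) by rewrite /rip !hipZr h.
  have -> : rip x (w *: a) - rip y (w *: b) =
      rip (v k - y) (w *: b) - rip (u k - x) (w *: a).
    by rewrite !ripBl hk; ring.
  have r1 := rip_abs (u k - x) (w *: a); have r2 := rip_abs (v k - y) (w *: b).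
  have g1 := hnorm_ge0 (u k - x); have g2 := hnorm_ge0 (v k - y).
  rewrite mulrDr mulr1 in t1; rewrite mulrDr mulr1 in t2.
  apply: le_trans (ler_normB _ _) _; apply: le_trans (lerD r2 r1) _.
  rewrite (splitr e) lerD//; first by apply: ltW; apply: le_lt_trans t2; rewrite lerDl.
  by apply: ltW; apply: le_lt_trans t1; rewrite lerDl.
apply/eqP; rewrite eq_complex; apply/andP; split; apply/eqP.
  by have := hr 1; rewrite !scale1r.
have := hr 'i%C; rewrite /rip !hipZr.
by case: (hip x a) => a1 b1; case: (hip y b) => a2 b2 /=; lra.
Qed.

Definition hsub D := D 0 /\ forall (k : R[i]) x y, D x -> D y -> D (k *: x + y).

Lemma hsubD D x y : hsub D -> D x -> D y -> D (x + y).
Proof. by move=> [_ h] dx dy; have := h 1 _ _ dx dy; rewrite scale1r. Qed.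

Lemma hsubZ D k x : hsub D -> D x -> D (k *: x).
Proof. by move=> [d0 h] dx; have := h k _ _ dx d0; rewrite addr0. Qed.

Lemma hsubB D x y : hsub D -> D x -> D y -> D (x - y).
Proof.
by move=> hD dx dy; apply: hsubD => //; rewrite -scaleN1r; apply: hsubZ.
Qed.

Lemma hsub_sum D (I : Type) (s : seq I) (F : I -> H) :
  hsub D -> (forall i, D (F i)) -> D (\sum_(i <- s) F i).
Proof. by move=> hD dF; elim/big_rec: _ => [|i x _ dx]; [case: hD|exact: hsubD]. Qed.

Lemma dense_seq D x : dense_in D -> exists2 u, forall k, D (u k) & hlim u x.
Proof.
move=> dD.
have inv k : 0 < (k.+1%:R : R)^-1 by rewrite invr_gt0.
have /choice[u hu] : forall k, exists y, D y /\ hnorm (x - y) < (k.+1%:R)^-1.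
  by move=> k; have [y Dy hy] := dD x _ (inv k); exists y.
exists u; first by move=> k; case: (hu k).
move=> e e0.
exists (Num.truncn e^-1) => k hk.
have [_] := hu k; rewrite hnormC => /lt_le_trans; apply.
rewrite -(invrK e) lef_pV2 ?posrE ?invr_gt0 ?ltr0n//.
rewrite (le_trans (ltW (truncnS_gt _)))// ler_nat//.
Qed.

Definition hcauchy (u : nat -> H) := forall e, 0 < e -> exists N, forall k l,
  (N <= k)%N -> (N <= l)%N -> hnorm (u k - u l) < e.

Lemma hlim_cauchy u x : hlim u x -> hcauchy u.
Proof.
move=> ux e e0; have [N hN] := ux _ (divr_gt0 e0 (ltr0n R 2)).
exists N => k l hk hl; rewrite (le_lt_trans (hnorm_tri x _ _))//.
by rewrite (hnormC x) (splitr e) ltrD ?hN.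
Qed.

Lemma hcauchy_lim u : hcauchy u -> exists x, hlim u x.
Proof. by move=> h; apply: (@hip_complete R H u h). Qed.

Lemma parallelogram x y :
  hnorm (x - y) ^+ 2 = 2 * hnorm x ^+ 2 + 2 * hnorm y ^+ 2 - hnorm (x + y) ^+ 2.
Proof.
rewrite !hnorm_sqr !ripDl !ripDr !ripNl !(ripC _ (- _)) !ripNl.
rewrite (ripC y x); ring.
Qed.

(* A subspace whose orthogonal complement vanishes is dense: otherwise a point
   of its closure nearest to some [x] would differ from [x] by a non-zero
   vector orthogonal to it. *)
Lemma dense_orth D : hsub D ->
  (forall v, (forall x, D x -> hip x v = 0) -> v = 0) -> dense_in D.
Proof.
move=> hD orth x.
pose E := [set hnorm (x - y) | y in D].
have E0 : E !=set0 by exists (hnorm (x - 0)); exists 0 => //; case: hD.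
have lbE : has_lbound E by exists 0 => _ [y _ <-]; exact: hnorm_ge0.
have infE : has_inf E by [].
pose d := inf E.
have d0 : 0 <= d by apply: lb_le_inf => // _ [y _ <-]; exact: hnorm_ge0.
have dle y : D y -> d <= hnorm (x - y) by move=> Dy; apply: ge_inf => //; exists y.
have inv k : 0 < (k.+1%:R : R)^-1 by rewrite invr_gt0.
have /choice[u hu] : forall k, exists y, D y /\ hnorm (x - y) < d + (k.+1%:R)^-1.
  move=> k; have [_ [y Dy <-] hy] := inf_adherent (inv k) infE.
  by exists y.
have Du k : D (u k) by case: (hu k).
(* The midpoint of [u k] and [u l] lies in the subspace, so its distance to [x] is at least [d]. *)
have mid k l : 4 * d ^+ 2 <= hnorm ((x - u k) + (x - u l)) ^+ 2.
  have -> : (x - u k) + (x - u l) = 2%:C%C *: (x - 2^-1%:C%C *: (u k + u l)).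
    rewrite scalerBr scalerA -rmorphM /= mulfV ?pnatr_eq0// scale1r.
    rewrite addrACA -opprD; congr (_ - _).
    by rewrite -mulr2n -scaler_nat rmorph_nat.
  rewrite hnormZ cabs_real normr_nat exprMn.
  have : 0 <= d <= hnorm (x - 2^-1%:C%C *: (u k + u l)).
    by rewrite d0 dle//; apply: hsubZ => //; apply: hsubD.
  by case/andP => *; nra.
have cau : hcauchy u.
  move=> e e0.
  (* If both distances are below [d + c'] with [c' <= 1], the parallelogram identity and [mid] bound
     the squared distance of [u k] and [u l] by [8 d c' + 4 c'^2], which is below
     [8 (d + 1) c' <= e^2]. *)
  pose c := e ^+ 2 / (8 * (d + 1)).
  have c0 : 0 < c by rewrite divr_gt0 ?exprn_gt0 ?mulr_gt0 ?ltr_wpDl.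
  have : 0 < Num.min c 1 by rewrite lt_min c0 ltr01.
  set c' := Num.min c 1 => c'0.
  have c'c : c' <= c by rewrite ge_min lexx.
  have c'1 : c' <= 1 by rewrite ge_min lexx orbT.
  have hc : c * (8 * (d + 1)) = e ^+ 2.
    by rewrite divfK// mulf_neq0 ?gt_eqF ?ltr_wpDl.
  exists (Num.truncn c'^-1).+1.
  have small k : (Num.truncn c'^-1 < k)%N -> hnorm (x - u k) < d + c'.
    move=> hk; have [_ /lt_le_trans] := hu k; apply; rewrite lerD2l.
    rewrite -(invrK c') lef_pV2 ?posrE ?invr_gt0 ?ltr0n//.
    rewrite (le_trans (ltW (truncnS_gt _)))// ler_nat; exact: ltnW.
  move=> k l /small hk /small hl.
  rewrite -(@ltr_pXn2r _ 2)// ?nnegrE ?hnorm_ge0 ?ltW//.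
  have -> : u k - u l = (x - u l) - (x - u k) by rewrite opprB [RHS]addrC addrA subrK.
  rewrite parallelogram.
  have := mid l k; have := hnorm_ge0 (x - u l); have := hnorm_ge0 (x - u k).
  nra.
have [y uy] := hcauchy_lim cau.
have dE : hnorm (x - y) <= d.
  apply/ler_addgt0Pr => e e0.
  have [N hN] := uy _ (divr_gt0 e0 (ltr0n R 2)).
  pose k := maxn N (Num.truncn (e / 2)^-1).
  have [_ h1] := hu k.
  have h2 := hN k (leq_maxl _ _).
  have h3 : (k.+1%:R)^-1 <= e / 2.
    rewrite -(invrK (e/2)) lef_pV2 ?posrE ?invr_gt0 ?divr_gt0 ?ltr0n//.
    rewrite (le_trans (ltW (truncnS_gt _)))// ler_nat; exact: leq_maxr.
  move: (hnorm_tri (u k) x y) h1 h2 h3.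
  move: (hnorm (x - y)) (hnorm (x - u k)) (hnorm (u k - y)) (_^-1) => *; lra.
have dley w : D w -> d <= hnorm (x - y - w).
  move=> Dw; apply/ler_addgt0Pr => e e0.
  have [N hN] := uy _ e0.
  have h1 := dle _ (hsubD hD (Du N) Dw).
  have h2 := hN N (leqnn _).
  rewrite (le_trans h1)// (_ : x - (u N + w) = (x - y - w) - (u N - y)).
    by rewrite (le_trans (hnormD _ _))// hnormN lerD2l ltW.
  by rewrite opprB (addrAC x) [RHS]addrA subrK opprD addrA addrAC.
(* First variation at the minimizer: the quadratic polynomial [key] in [t] is nonnegative, and its
   value at [t = rip v w / rip w w] forces [rip v w = 0]. *)
have re0 w : D w -> rip (x - y) w = 0.
  move=> Dw; move: dE dley; move: (x - y) => v dE dley.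
  have key (t : R) : 0 <= t ^+ 2 * rip w w - 2 * t * rip v w.
    have := dley _ (hsubZ t%:C%C hD Dw).
    move/(le_trans dE); rewrite -(@ler_pXn2r _ 2)// ?nnegrE ?hnorm_ge0//.
    rewrite !hnorm_sqr ripBl !ripBr !ripZl !ripZr (ripC w v).
    move=> ?; nra.
  have [w0|w0] := eqVneq (rip w w) 0.
    by have := key (rip v w); rewrite w0; nra.
  have := key (rip v w / rip w w).
  have wp : 0 < rip w w by rewrite lt_neqAle eq_sym w0 rip_ge0.
  have hs : rip v w / rip w w * rip w w = rip v w by rewrite divfK.
  set s := rip v w / rip w w in hs *.
  rewrite -hs => ?; have : s ^+ 2 * rip w w <= 0 by nra.
  rewrite pmulr_lle0// => ?; have : s ^+ 2 = 0 by apply/eqP; rewrite eq_le sqr_ge0 andbT.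
  by move=> /eqP; rewrite sqrf_eq0 => /eqP ->; rewrite mul0r.
have v0 : x - y = 0.
  apply: orth => w Dw; rewrite hip_conj.
  suff -> : hip (x - y) w = 0 by rewrite rmorph0.
  apply/eqP; rewrite eq_complex; apply/andP; split; apply/eqP; first exact: re0.
  have := re0 _ (hsubZ 'i%C hD Dw).
  rewrite /rip hipZr; case: (hip _ w) => a b /=; lra.
move=> e e0; have [N hN] := uy _ e0; exists (u N) => //.
have -> : x = y by apply/eqP; rewrite -subr_eq0 v0.
by rewrite hnormC hN.
Qed.

End Hilbert.

Section BoundedOperators.
Variables (R : realType) (H : hilbert R).
Implicit Types (S T : H -> H) (D : set H).

Lemma linear_onB D T x y : hsub D -> linear_on D T -> D x -> D y ->
  T (x - y) = T x - T y.
Proof.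
by move=> hD lT dx dy; rewrite addrC -scaleN1r lT// scaleN1r addrC.
Qed.

Lemma linear_on0 D T : hsub D -> linear_on D T -> T 0 = 0.
Proof.
by move=> hD lT; have := linear_onB hD lT hD.1 hD.1; rewrite !subrr.
Qed.

Lemma linear_onZ D T (k : R[i]) x : hsub D -> linear_on D T -> D x ->
  T (k *: x) = k *: T x.
Proof.
move=> hD lT dx; have := lT k x 0 dx hD.1.
by rewrite (linear_on0 hD lT) !addr0.
Qed.

Lemma linear_onD D T x y : hsub D -> linear_on D T -> D x -> D y ->
  T (x + y) = T x + T y.
Proof. by move=> hD lT dx dy; have := lT 1 x y dx dy; rewrite !scale1r. Qed.

Lemma linear_on_sum D T (I : Type) (s : seq I) (F : I -> H) :
  hsub D -> linear_on D T -> (forall i, D (F i)) ->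
  T (\sum_(i <- s) F i) = \sum_(i <- s) T (F i).
Proof.
move=> hD lT dF; elim: s => [|i s IH]; first by rewrite !big_nil (linear_on0 hD lT).
by rewrite !big_cons (linear_onD hD)// ?IH//; exact: hsub_sum.
Qed.

Lemma hsubT : hsub [set: H].
Proof. by []. Qed.

Lemma bounded_lin T : bounded_op T -> linear_on setT T.
Proof. by move=> [lT _] k x y _ _; exact: lT. Qed.

Lemma hlim_bounded T u x : bounded_op T -> hlim u x -> hlim (T \o u) (T x).
Proof.
move=> bT; have [_ [C hC]] := bT; apply: (@hlim_lip _ _ _ _ _ _ C) => k /=.
by rewrite -(linear_onB hsubT (bounded_lin bT)).
Qed.

Lemma bounded_dense_eq D S T : dense_in D -> bounded_op S -> bounded_op T ->
  (forall x, D x -> S x = T x) -> S = T.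
Proof.
move=> dD bS bT h; apply/funext => x.
have [u Du ux] := dense_seq x dD.
apply: (hlim_uniq (hlim_bounded bS ux)).
by rewrite (_ : S \o u = T \o u); [exact: hlim_bounded|apply/funext => k /=; rewrite h].
Qed.

Lemma hlim_norm_le (u v : nat -> H) x y C : hlim u x -> hlim v y ->
  (forall k, hnorm (v k) <= C * hnorm (u k)) -> hnorm y <= C * hnorm x.
Proof.
move=> ux vy h; apply/ler_addgt0Pr => e e0.
have C0 : 0 < `|C| + 1 by rewrite ltr_wpDl.
have [N1 h1] := ux _ (divr_gt0 (divr_gt0 e0 (ltr0n R 2)) C0).
have [N2 h2] := vy _ (divr_gt0 e0 (ltr0n R 2)).
pose k := maxn N1 N2.
have t1 := h1 k (leq_maxl _ _); have t2 := h2 k (leq_maxr _ _).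
rewrite ltr_pdivlMr// in t1.
have t3 := hnorm_tri (v k) y 0; rewrite !subr0 (hnormC y) in t3.
have t4 := hnorm_tri x (u k) 0; rewrite !subr0 in t4.
have t5 := hnorm_tri (u k) x 0; rewrite !subr0 (hnormC x) in t5.
have t6 : C * (hnorm (u k) - hnorm x) <= `|C| * hnorm (u k - x).
  rewrite (le_trans (ler_norm _))// normrM ler_wpM2l// ler_norml.
  by apply/andP; split; lra.
have := h k; have := hnorm_ge0 (u k - x).
move: t1 t2 t3 t6; rewrite mulrDr mulr1 mulrBr (mulrC _ `|C|).
move: (`|C| * _) (C * _) (C * _) => *; lra.
Qed.

Lemma bounded_dense_le D S C x : dense_in D -> bounded_op S ->
  (forall x, D x -> hnorm (S x) <= C * hnorm x) -> hnorm (S x) <= C * hnorm x.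
Proof.
move=> dD bS h; have [u Du ux] := dense_seq x dD.
by apply: (hlim_norm_le ux (hlim_bounded bS ux)) => k; exact: h.
Qed.

Lemma bounded_extension D T C : hsub D -> dense_in D -> linear_on D T ->
  (forall x, D x -> hnorm (T x) <= C * hnorm x) ->
  exists2 S, extends_to D T S & forall x, hnorm (S x) <= C * hnorm x.
Proof.
move=> hD dD lT bT.
have ex x : exists y, exists2 u, (forall k, D (u k)) & hlim u x /\ hlim (T \o u) y.
  have [u Du ux] := dense_seq x dD.
  have [|y uy] := @hcauchy_lim _ _ (T \o u); last by exists y, u.
  move=> e e0; have C0 : 0 < `|C| + 1 by rewrite ltr_wpDl.
  have [N hN] := hlim_cauchy ux (divr_gt0 e0 C0).
  exists N => k l hk hl; have := hN k l hk hl; rewrite ltr_pdivlMr//=.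
  rewrite -(linear_onB hD lT)//; apply: le_lt_trans.
  rewrite (le_trans (bT _ _))//; first exact: hsubB.
  rewrite mulrC ler_wpM2l ?hnorm_ge0//.
  by rewrite (le_trans (ler_norm _))// lerDl.
have [S hS] := choice ex.
(* [S x] was chosen through one approximating sequence; that any other sequence gives the same limit
   is what makes [S] linear and an extension of [T]. *)
have Sl u x : (forall k, D (u k)) -> hlim u x -> hlim (T \o u) (S x).
  move=> Du ux; have [v Dv [vx vy]] := hS x.
  have h0 : hlim (fun k => T (u k) - T (v k)) 0.
    apply: (@hlim_lip _ _ (fun k => u k - v k) _ 0 _ C).
      by move=> k; rewrite !subr0 -(linear_onB hD lT)// bT//; exact: hsubB.
    rewrite -(subrr x); apply: hlimD => //.
    have := hlimZ (-1) vx.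
    by under eq_fun do rewrite scaleN1r; rewrite scaleN1r.
  have := hlimD h0 vy; rewrite add0r.
  by rewrite (_ : (fun k => _) = T \o u)//; apply/funext => k /=; rewrite subrK.
have linS : forall (k : R[i]) x y, S (k *: x + y) = k *: S x + S y.
  move=> k x y; have [u Du [ux _]] := hS x; have [v Dv [vy _]] := hS y.
  have h1 := hlimD (hlimZ k ux) vy.
  have h2 := Sl _ _ (fun n => hD.2 k _ _ (Du n) (Dv n)) h1.
  apply: (hlim_uniq h2).
  have := hlimD (hlimZ k (Sl _ _ Du ux)) (Sl _ _ Dv vy).
  by congr hlim; apply/funext => n /=; rewrite lT.
have bS x : hnorm (S x) <= C * hnorm x.
  have [u Du [ux uy]] := hS x.
  by apply: (hlim_norm_le ux uy) => k; exact: bT.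
exists S => //; split; first by split=> //; exists C.
move=> x Dx; have := Sl (fun=> x) x (fun=> Dx).
move=> /(_ _)/hlim_uniq; apply.
  by move=> e e0; exists 0%N => k _; rewrite subrr hnorm0.
by move=> e e0; exists 0%N => k _; rewrite subrr hnorm0.
Qed.

(** [sup] takes a default value on unbounded sets, so [opnorm] is meaningful only once the operator
    is known to be bounded. *)
Lemma opnorm_has_sup T : bounded_op T ->
  has_sup [set hnorm (T x) | x in [set x | hnorm x <= 1]].
Proof.
move=> bT; split.
  by exists (hnorm (T 0)); exists 0 => //=; rewrite hnorm0.
case: bT => _ [C hC]; exists `|C| => _ [x /= x1 <-].
rewrite (le_trans (hC x))// (le_trans (ler_wpM2r (hnorm_ge0 _) (ler_norm C)))//.
by rewrite ler_piMr.
Qed.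

Lemma opnorm_ge0 T : bounded_op T -> 0 <= opnorm T.
Proof.
move=> bT; apply: (le_trans (hnorm_ge0 (T 0))).
by apply: (sup_upper_bound (opnorm_has_sup bT)); exists 0 => //=; rewrite hnorm0.
Qed.

Lemma opnorm_le T x : bounded_op T -> hnorm (T x) <= opnorm T * hnorm x.
Proof.
move=> bT; have lT := bounded_lin bT.
have [->|x0] := eqVneq x 0.
  by rewrite (linear_on0 hsubT lT) hnorm0 mulr0.
have n0 : 0 < hnorm x.
  by rewrite lt_neqAle hnorm_ge0 andbT eq_sym; apply: contra_neq x0; exact: hnorm_eq0.
have := sup_upper_bound (opnorm_has_sup bT).
move=> /(_ (hnorm (T ((hnorm x)^-1%:C%C *: x)))) h.
rewrite -ler_pdivrMr// mulrC.
have /h : [set hnorm (T x) | x in [set x | hnorm x <= 1]]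
    (hnorm (T ((hnorm x)^-1%:C%C *: x))).
  exists ((hnorm x)^-1%:C%C *: x) => //=.
  by rewrite hnormZ cabs_real gtr0_norm ?invr_gt0// mulVf// gt_eqF.
rewrite (linear_onZ _ hsubT lT)// hnormZ cabs_real gtr0_norm ?invr_gt0//.
Qed.

Lemma opnorm_ub T C : 0 <= C -> bounded_op T ->
  (forall x, hnorm (T x) <= C * hnorm x) -> opnorm T <= C.
Proof.
move=> C0 bT h; apply: ge_sup; first by case: (opnorm_has_sup bT).
by move=> _ [x /= x1 <-]; rewrite (le_trans (h x))// ler_piMr.
Qed.

End BoundedOperators.

(** * Smooth functions and their compositions *)

Section SmoothCalculus.
Variables (R : realType) (N : nat).
Implicit Types (f g u : 'rV[R]_N -> R) (O : set 'rV[R]_N) (j : 'I_N) (s : seq 'I_N).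

Local Notation dir j := (delta_mx ord0 j : 'rV[R]_N).

(** Restriction to a line turns a directional derivative into one of a function of one real
    variable, to which the one-dimensional chain rule applies. *)
Lemma is_derive_line f x v d :
  is_derive x v f d <-> is_derive (0 : R) 1 (fun h => f (h *: v + x)) d.
Proof.
have E : 'D_v f x = 'D_1 (fun h : R => f (h *: v + x)) 0.
  rewrite /derive; set g1 := fun h => h^-1 *: _; set g2 := fun h => h^-1 *: _.
  suff -> : g1 = g2 by [].
  by rewrite funeqE /g1 /g2 => h /=; rewrite addr0 scale0r add0r [_%:A]mulr1.
split=> -[h1 h2].
  by apply: DeriveDef; [exact: (derivable1P f x v).1 h1|rewrite -E].
by apply: DeriveDef; [exact: (derivable1P f x v).2 h1|rewrite E].
Qed.

Lemma is_derive_comp1 (F : R -> R) u x v d e :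
  is_derive x v u d -> is_derive (u x) 1 F e -> is_derive x v (F \o u) (e * d).
Proof.
move=> /is_derive_line du dF; apply/is_derive_line.
apply: (is_derive1_comp (f := F) (g := fun h => u (h *: v + x))).
by rewrite scale0r add0r.
Qed.

Lemma partial_eq_on O f g j x : open O -> (forall y, O y -> f y = g y) -> O x ->
  partial j f x = partial j g x.
Proof.
move=> oO fg Ox; apply: near_eq_derive.
by near=> y; apply: fg; near: y; exact: open_nbhs_nbhs.
Unshelve. all: by end_near. Qed.

Lemma pder_eq_on O f g s x : open O -> (forall y, O y -> f y = g y) -> O x ->
  pder s f x = pder s g x.
Proof.
move=> oO fg; elim: s x => [|j s IH] x Ox; first exact: fg.
by apply: (partial_eq_on _ oO) => // y Oy; exact: IH.
Qed.

Lemma derivable_eq_on O f g v x : open O -> (forall y, O y -> f y = g y) -> O x ->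
  derivable f x v -> derivable g x v.
Proof.
move=> oO fg Ox; apply: near_eq_derivable.
by near=> y; apply: fg; near: y; exact: open_nbhs_nbhs.
Unshelve. all: by end_near. Qed.

Lemma continuous_eq_on O f g x : open O -> (forall y, O y -> f y = g y) -> O x ->
  {for x, continuous f} -> {for x, continuous g}.
Proof.
move=> oO fg Ox; rewrite /prop_for /continuous_at fg// => cf.
have fgn : {near x, f =1 g} by apply: filterS (open_nbhs_nbhs (conj oO Ox)) => y /fg.
exact: cvg_trans (near_eq_cvg fgn) cf.
Qed.

(** [smooth_open] speaks of all words of derivatives at once, which is awkward for products and
    compositions. Recursion on the order of differentiability peels off one derivative and gives a
    usable induction. *)
Fixpoint class_Cn O (k : nat) f : Prop :=
  (forall x, O x -> {for x, continuous f}) /\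
  if k is k'.+1 then
    (forall x j, O x -> derivable f x (dir j)) /\
    (forall j, class_Cn O k' (partial j f))
  else True.

Lemma class_Cn_cont O k f x : class_Cn O k f -> O x -> {for x, continuous f}.
Proof. by case: k => [|k] [h _]; exact: h. Qed.

Lemma pder_rcons s j f : pder (rcons s j) f = pder s (partial j f).
Proof. by rewrite /pder foldr_rcons. Qed.

(** [pder] applies the last letter of its word first, so the induction on words runs from the right,
    matching the derivative peeled off by [class_Cn]. *)
Lemma smooth_openP O f : smooth_open O f <-> forall k, class_Cn O k f.
Proof.
split=> [sf k|].
  elim: k f sf => [|k IH] f sf; first by split=> // x Ox; case: (sf [::] x Ox).
  split; first by move=> x Ox; case: (sf [::] x Ox).
  split; first by move=> x j Ox; have [_] := sf [::] x Ox.
  move=> j; apply: IH => s x Ox; rewrite -pder_rcons; exact: sf.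
move=> h s; elim/last_ind: s f h => [|s j IH] f h x Ox.
  have [c [d _]] := h 1%N; split; first exact: c.
  by move=> j; apply: d.
by rewrite pder_rcons; apply: IH => // k; have [_ [_ p]] := h k.+1; exact: p.
Qed.

Section OpenSet.
Variable O : set 'rV[R]_N.
Hypothesis oO : open O.

Lemma class_Cn_eq k f g : (forall x, O x -> f x = g x) ->
  class_Cn O k f -> class_Cn O k g.
Proof.
elim: k f g => [|k IH] f g fg.
  by move=> [c _]; split=> // x Ox; apply: (continuous_eq_on oO fg Ox); exact: c.
move=> [c [d p]]; split.
  by move=> x Ox; apply: (continuous_eq_on oO fg Ox); exact: c.
split; first by move=> x j Ox; apply: (derivable_eq_on oO fg Ox); exact: d.
by move=> j; apply: IH (p j) => x Ox; exact: (partial_eq_on j oO fg Ox).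
Qed.

Lemma class_CnW k f : class_Cn O k.+1 f -> class_Cn O k f.
Proof.
elim: k f => [|k IH] f; first by move=> [c _]; split.
by move=> [c [d p]]; split=> //; split=> // j; apply: IH; exact: p.
Qed.

Lemma class_Cn_cst k (c : R) : class_Cn O k (fun=> c).
Proof.
elim: k c => [|k IH] c; first by split=> // x _; exact: cst_continuous.
split; first by move=> x _; exact: cst_continuous.
split; first by move=> x j _; exact: derivable_cst.
by move=> j; apply: (class_Cn_eq _ (IH 0)) => x _; rewrite /partial (derive_cst c).
Qed.

Lemma class_CnD k f g : class_Cn O k f -> class_Cn O k g ->
  class_Cn O k (fun x => f x + g x).
Proof.
elim: k f g => [|k IH] f g.
  by move=> [cf _] [cg _]; split=> // x Ox; apply: continuousD; [exact: cf|exact: cg].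
move=> [cf [df pf]] [cg [dg pg]]; split.
  by move=> x Ox; apply: continuousD; [exact: cf|exact: cg].
split; first by move=> x j Ox; apply: derivableD; [exact: df|exact: dg].
move=> j; apply: (class_Cn_eq _ (IH _ _ (pf j) (pg j))) => x Ox.
by rewrite /partial deriveD//; [exact: df|exact: dg].
Qed.

Lemma class_CnM k f g : class_Cn O k f -> class_Cn O k g ->
  class_Cn O k (fun x => f x * g x).
Proof.
elim: k f g => [|k IH] f g.
  by move=> [cf _] [cg _]; split=> // x Ox; apply: continuousM; [exact: cf|exact: cg].
move=> Cf Cg; have Cf' := class_CnW Cf; have Cg' := class_CnW Cg.
move: Cf Cg => [cf [df pf]] [cg [dg pg]]; split.
  by move=> x Ox; apply: continuousM; [exact: cf|exact: cg].
split; first by move=> x j Ox; apply: derivableM; [exact: df|exact: dg].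
move=> j; apply: (class_Cn_eq _ (class_CnD (IH _ _ Cf' (pg j)) (IH _ _ Cg' (pf j)))).
by move=> x Ox; rewrite /partial deriveM//; [exact: df|exact: dg].
Qed.

(** A function is supplied together with all its derivatives, so that polynomials and the square
    root can be given in closed form. *)
Definition derivs_on (I : set R) (F : nat -> R -> R) :=
  forall k t, I t -> is_derive t 1 (F k) (F k.+1 t).

(** The chain rule replaces [F i] by [F i.+1], which is why the statement is proved for every [i]
    and not only for [F 0]. *)
Lemma class_Cn_comp (I : set R) F k u i : derivs_on I F ->
  (forall x, O x -> I (u x)) -> class_Cn O k u ->
  class_Cn O k (fun x => F i (u x)).
Proof.
move=> dF Iu; have cF x : O x -> class_Cn O k u ->
    {for x, continuous (fun x => F i (u x))}.
  move=> Ox Cu; apply: continuous_comp; first exact: class_Cn_cont Cu Ox.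
  apply/differentiable_continuous/derivable1_diffP.
  by have [] := dF i _ (Iu _ Ox).
elim: k i cF => [|k IH] i cF Cu.
  by split=> // x Ox; apply: cF.
split; first by move=> x Ox; apply: cF.
have Cu' := class_CnW Cu; have [_ [du pu]] := Cu.
have key x j : O x -> is_derive x (dir j) (fun x => F i (u x))
    (F i.+1 (u x) * partial j u x).
  move=> Ox; apply: is_derive_comp1; last exact/dF/Iu.
  exact/derivableP/du.
split; first by move=> x j Ox; have [] := key x j Ox.
move=> j; have Cu1 : class_Cn O k (fun x => F i.+1 (u x)).
  apply: IH => // x Ox _; apply: continuous_comp; first exact: class_Cn_cont Cu Ox.
  apply/differentiable_continuous/derivable1_diffP.
  by have [] := dF i.+1 _ (Iu _ Ox).
apply: (class_Cn_eq _ (class_CnM Cu1 (pu j))) => x Ox.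
by have [_ <-] := key x j Ox.
Qed.

Lemma smooth_open_eq f g : (forall x, O x -> f x = g x) ->
  smooth_open O f -> smooth_open O g.
Proof.
by move=> fg /smooth_openP sf; apply/smooth_openP => k; apply: class_Cn_eq fg (sf k).
Qed.

Lemma smooth_open_cst (c : R) : smooth_open O (fun=> c).
Proof. by apply/smooth_openP => k; exact: class_Cn_cst. Qed.

Lemma smooth_openD f g : smooth_open O f -> smooth_open O g ->
  smooth_open O (fun x => f x + g x).
Proof.
by move=> /smooth_openP sf /smooth_openP sg; apply/smooth_openP => k; apply: class_CnD.
Qed.

Lemma smooth_openM f g : smooth_open O f -> smooth_open O g ->
  smooth_open O (fun x => f x * g x).
Proof.
by move=> /smooth_openP sf /smooth_openP sg; apply/smooth_openP => k; apply: class_CnM.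
Qed.

Lemma smooth_open_comp (I : set R) F u i : derivs_on I F ->
  (forall x, O x -> I (u x)) -> smooth_open O u ->
  smooth_open O (fun x => F i (u x)).
Proof.
by move=> dF Iu /smooth_openP su; apply/smooth_openP => k; apply: class_Cn_comp dF Iu _.
Qed.

Lemma smooth_openZ c f : smooth_open O f -> smooth_open O (fun x => c * f x).
Proof. by apply: smooth_openM; exact: smooth_open_cst. Qed.

Lemma smooth_openX f i : smooth_open O f -> smooth_open O (fun x => f x ^+ i).
Proof.
move=> sf; elim: i => [|i IH].
  by apply: smooth_open_eq (smooth_open_cst 1) => x _; rewrite expr0.
by apply: smooth_open_eq (smooth_openM sf IH) => x _; rewrite exprS.
Qed.

Lemma smooth_open_sum (T : Type) (r : seq T) (F : T -> 'rV[R]_N -> R) :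
  (forall i, smooth_open O (F i)) ->
  smooth_open O (fun x => \sum_(i <- r) F i x).
Proof.
move=> sF; elim: r => [|i r IH].
  by apply: smooth_open_eq (smooth_open_cst 0) => x _; rewrite big_nil.
by apply: smooth_open_eq (smooth_openD (sF i) IH) => x _; rewrite big_cons.
Qed.

Lemma smooth_open_partial f j : smooth_open O f -> smooth_open O (partial j f).
Proof. by move=> sf s x Ox; rewrite -pder_rcons; exact: sf. Qed.

Lemma smooth_open_derivable f x j : smooth_open O f -> O x -> derivable f x (dir j).
Proof. by move=> sf Ox; have [_] := sf [::] x Ox. Qed.

Lemma pder_smooth_derivable s f x j : smooth_open O f -> O x ->
  derivable (pder s f) x (dir j).
Proof. by move=> sf Ox; have [_] := sf s x Ox. Qed.

Lemma partialM_on f g j x : smooth_open O f -> smooth_open O g -> O x ->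
  partial j (fun y => f y * g y) x = f x * partial j g x + g x * partial j f x.
Proof. by move=> sf sg Ox; rewrite /partial deriveM//; exact: smooth_open_derivable. Qed.

Lemma pderD_on s f g x : smooth_open O f -> smooth_open O g -> O x ->
  pder s (fun y => f y + g y) x = pder s f x + pder s g x.
Proof.
move=> sf sg; elim: s x => [|j s IH] x Ox //=.
rewrite (partial_eq_on _ oO IH)// /partial deriveD//; exact: pder_smooth_derivable.
Qed.

Lemma pderZ_on s c f x : smooth_open O f -> O x ->
  pder s (fun y => c * f y) x = c * pder s f x.
Proof.
move=> sf; elim: s x => [|j s IH] x Ox //=.
rewrite (partial_eq_on _ oO IH)//.
by rewrite {1}/partial (deriveZ c (f := pder s f))//; exact: pder_smooth_derivable.
Qed.

Lemma pder_cst0 s x : pder s (fun=> 0 : R) x = 0.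
Proof.
elim: s x => [//|j s IH] x /=.
by rewrite (_ : pder s _ = cst 0) /partial ?derive_cst//; exact/funext.
Qed.

Lemma pder_sum_on (T : Type) (r : seq T) (F : T -> 'rV[R]_N -> R) s x :
  (forall i, smooth_open O (F i)) -> O x ->
  pder s (fun y => \sum_(i <- r) F i y) x = \sum_(i <- r) pder s (F i) x.
Proof.
move=> sF Ox; elim: r => [|i r IH].
  rewrite big_nil (_ : (fun y => _) = fun=> 0) ?pder_cst0//.
  by apply/funext => y; rewrite big_nil.
rewrite big_cons -IH -pderD_on//; last exact: smooth_open_sum.
by congr pder; apply/funext => y; rewrite big_cons.
Qed.

End OpenSet.

Lemma smooth_open_sub O O' f : O' `<=` O -> smooth_open O f -> smooth_open O' f.
Proof. by move=> s sf t x /s; exact: sf. Qed.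

End SmoothCalculus.

(** * Iterated derivatives of a composition *)

Section Composition.
Variables (R : realType) (N : nat).
Implicit Types (f g u : 'rV[R]_N -> R) (O : set 'rV[R]_N) (j : 'I_N) (s : seq 'I_N).

(** A Faa di Bruno formula with unnamed coefficients. The order of the quantifiers is essential: [G]
    is fixed before [F], so it may be computed from convenient choices of [F]. The factor [phi] will
    be a cutoff. *)
Lemma pder_comp_expansion O phi u s : open O -> smooth_open O phi -> smooth_open O u ->
  exists2 G : nat -> 'rV[R]_N -> R, forall k, smooth_open O (G k) &
  forall (I : set R) F, derivs_on I F -> (forall x, O x -> I (u x)) ->
  forall i x, O x -> pder s (fun y => phi y * F i (u y)) x =
    \sum_(k < (size s).+1) F (i + k)%N (u x) * G k x.
Proof.
move=> oO sphi su; elim: s => [|j s [G sG hG]].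
  exists (fun=> phi) => // I F dF Iu i x Ox.
  by rewrite big_ord_recl big_ord0 addr0 addn0 mulrC.
pose S := (size s).+1.
(* The derivative of [F (i + k) (u) * G k] contributes to the coefficients of index [k] and [k + 1].
   The test [k < S] discards the values of [G] beyond the range of the sum, which are arbitrary. *)
pose G' k x := (if (k < S)%N then partial j (G k) x else 0) +
  (if k is k'.+1 then G k' x * partial j u x else 0).
exists G'.
  move=> k; apply: (smooth_openD oO).
    by case: (k < S)%N; [exact: smooth_open_partial (sG k)|exact: (smooth_open_cst oO 0)].
  case: k => [|k]; first exact: (smooth_open_cst oO 0).
  exact: (smooth_openM oO (sG k) (smooth_open_partial j su)).
move=> I F dF Iu i x Ox /=.
rewrite (partial_eq_on _ oO (hG _ _ dF Iu i))//.
have sF k : smooth_open O (fun y => F k (u y)) by exact: (smooth_open_comp oO _ dF Iu).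
have := @pder_sum_on _ _ _ oO _ (index_enum 'I_(size s).+1)
  (fun (k : 'I_(size s).+1) y => F (i + k)%N (u y) * G k y) [:: j] x
  (fun k => smooth_openM oO (sF (i + k)%N) (sG k)) Ox.
rewrite /= => ->.
have dFu k : partial j (fun y => F k (u y)) x = F k.+1 (u x) * partial j u x.
  have [] // : is_derive x (delta_mx ord0 j : 'rV[R]_N) (F k \o u)
    (F k.+1 (u x) * partial j u x).
  apply: is_derive_comp1; last exact/dF/Iu.
  by apply: derivableP; exact: smooth_open_derivable su Ox.
under eq_bigr => k _ do rewrite (partialM_on _ (sF _) (sG _) Ox) dFu.
rewrite big_split /= /G'.
under [RHS]eq_bigr do rewrite mulrDr.
rewrite big_split /=; congr (_ + _).
  rewrite [RHS]big_ord_recr /= ltnn mulr0 addr0.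
  by apply: eq_bigr => k _; rewrite ltn_ord.
rewrite [RHS]big_ord_recl /= mulr0 add0r.
by apply: eq_bigr => k _; rewrite /= addnS mulrCA.
Qed.

Lemma derivn_XsubC_exp (c : R) l k :
  (('X - c%:P) ^+ l)^`(k) = ('X - c%:P) ^+ (l - k) *+ (l ^_ k) :> {poly R}.
Proof.
elim: k => [|k IH]; first by rewrite subn0 derivn0 ffactn0.
rewrite derivnS IH derivMn deriv_exp derivXsubC mul1r -mulrnA subnS.
by rewrite ffactnSr mulnC.
Qed.

Definition taylor_poly (l : nat) (c : R) : {poly R} :=
  (l`!%:R)^-1 *: ('X - c%:P) ^+ l.

Lemma taylor_poly_derivs l c :
  derivs_on setT (fun k t => (taylor_poly l c)^`(k).[t]).
Proof. by move=> k t _; rewrite derivnS; exact: is_derive_poly. Qed.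

Lemma taylor_poly_derivn l c k : (taylor_poly l c)^`(k).[c] = (k == l)%:R.
Proof.
rewrite /taylor_poly derivnZ hornerZ derivn_XsubC_exp hornerMn !hornerE subrr.
rewrite expr0n subn_eq0.
have [kl|lk|->] := ltngtP k l.
- by rewrite mul0rn mulr0.
- by rewrite ffact_small// mulr0n mulr0.
- by rewrite ffactnn mulVf// pnatr_eq0 -lt0n fact_gt0.
Qed.

Lemma taylor_polyE l c t : (taylor_poly l c).[t] =
  \sum_(i < l.+1) ((l`!%:R)^-1 * ((- c) ^+ (l - i) *+ 'C(l, i))) * t ^+ i.
Proof.
rewrite /taylor_poly hornerZ horner_exp hornerXsubC addrC exprDn mulr_sumr.
by apply: eq_bigr => i _; rewrite -mulrA mulrnAl.
Qed.

(* The coefficients in [pder_comp_expansion] do not depend on [F]; the l-th one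
   at the point [x] is found by taking [F(t) = (t - u x)^l / l!], which expresses
   it through the derivatives of the [phi * u^i], [i <= l]. *)
Lemma pder_comp_bound O phi u s x A B : open O -> smooth_open O phi ->
  smooth_open O u -> O x -> `|u x| <= 1 ->
  (forall i, (i <= size s)%N -> `|pder s (fun y => phi y * u y ^+ i) x| <= B) ->
  forall (I : set R) F, derivs_on I F -> (forall x, O x -> I (u x)) ->
  (forall k, (k <= size s)%N -> `|F k (u x)| <= A) ->
  `|pder s (fun y => phi y * F 0%N (u y)) x| <=
    A * B * \sum_(k < (size s).+1) \sum_(i < k.+1) 'C(k, i)%:R.
Proof.
move=> oO sphi su Ox ux hB I F dF Iu hA.
have [G sG hG] := pder_comp_expansion s oO sphi su.
have sX i := smooth_openM oO sphi (smooth_openX oO i su).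
have B0 : 0 <= B by apply: le_trans (hB 0%N _).
have GB l : (l <= size s)%N -> `|G l x| <= B * \sum_(i < l.+1) 'C(l, i)%:R.
  move=> ls.
  have := hG _ _ (@taylor_poly_derivs l (u x)) (fun _ _ => Logic.I) 0%N x Ox.
  rewrite (bigD1 (Ordinal (ls : (l < (size s).+1)%N)))//= big1 ?addr0 => [|k kl].
    rewrite add0n taylor_poly_derivn eqxx mul1r => <-.
    rewrite (_ : (fun y => _) = (fun y => \sum_(i < l.+1)
      ((l`!%:R)^-1 * ((- u x) ^+ (l - i) *+ 'C(l, i))) * (phi y * u y ^+ i)));
      last first.
      apply/funext => y.
      rewrite -[X in phi y * X]/((taylor_poly l (u x)).[u y]) taylor_polyE mulr_sumr.
      by apply: eq_bigr => i _; rewrite mulrCA.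
    rewrite (pder_sum_on oO _ s (fun i : 'I_l.+1 => smooth_openZ oO _ (sX i)) Ox).
    rewrite (le_trans (ler_norm_sum _ _ _))// mulr_sumr ler_sum// => i _.
    rewrite (pderZ_on oO s _ (sX i) Ox).
    have il : (i <= size s)%N by rewrite (leq_trans _ ls)// -ltnS.
    rewrite normrM mulrC ler_pM// ?hB//.
    (* As [|u x| <= 1] and [1 / l! <= 1], only the binomial coefficient of the expansion of
       [(t - u x)^l] remains. *)
    rewrite normrM normrMn normrX normrN ger0_norm ?invr_ge0//.
    rewrite -[leRHS]mul1r ler_pM//.
      by rewrite invf_le1 ?ltr0n ?fact_gt0// ler1n fact_gt0.
    by rewrite lerMn2r exprn_ile1 ?orbT.
  rewrite add0n taylor_poly_derivn.
  have -> : (k == l :> nat) = false by apply: negbTE; exact: kl.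
  by rewrite mul0r.
rewrite (hG I F dF Iu 0%N x Ox) (le_trans (ler_norm_sum _ _ _))//.
rewrite -mulrA !mulr_sumr ler_sum// => k _.
have ks : (k <= size s)%N by rewrite -ltnS.
by rewrite normrM ler_pM// ?hA ?GB.
Qed.

End Composition.

Section SqrtDerivs.
Variable R : realType.

(** The falling factorial of 1/2, the coefficient in the k-th derivative of the square root. *)
Fixpoint sqrt_coef (k : nat) : R :=
  if k is k'.+1 then sqrt_coef k' * (2^-1 - k'%:R) else 1.

Definition sqrt_der (k : nat) (t : R) : R := sqrt_coef k * t `^ (2^-1 - k%:R).

Lemma sqrt_der_derivs : derivs_on [set t | 0 < t] sqrt_der.
Proof.
move=> k t /= t0.
have h := @is_derive1_powR R (2^-1 - k%:R) t t0.
have -> : sqrt_der k.+1 t = sqrt_coef k * ((2^-1 - k%:R) * t `^ (2^-1 - k%:R - 1)).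
  rewrite /sqrt_der /= -mulrA; congr (_ * (_ * _ `^ _)).
  by rewrite -[k.+1%:R]natr1 opprD addrA.
have hZ := is_deriveZ (sqrt_coef k) h.
exact hZ.
Qed.

Lemma sqrt_der0 t : 0 <= t -> sqrt_der 0 t = Num.sqrt t.
Proof. by move=> t0; rewrite /sqrt_der /= mul1r subr0 powR12_sqrt. Qed.

(** The exponent [1/2 - k] is negative for [k >= 1], so the power is largest at the left end [c];
    for [k = 0] it is largest at 1. *)
Lemma sqrt_der_bounded (c : R) n : 0 < c -> exists A, forall k t,
  (k <= n)%N -> c <= t <= 1 -> `|sqrt_der k t| <= A.
Proof.
move=> c0; elim: n => [|n [A hA]].
  exists 1 => k t; rewrite leqn0 => /eqP -> /andP[ct t1].
  have t0 : 0 <= t by rewrite (le_trans (ltW c0)).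
  rewrite sqrt_der0// ger0_norm ?sqrtr_ge0// -[leRHS]sqrtr1.
  by rewrite ler_wsqrtr.
exists (Num.max A (`|sqrt_coef n.+1| * c `^ (2^-1 - n.+1%:R))) => k t.
rewrite leq_eqVlt => /orP[/eqP ->|kn] /andP[ct t1]; last first.
  by rewrite le_max hA// ?ct.
rewrite le_max; apply/orP; right.
rewrite /sqrt_der normrM ler_wpM2l// ger0_norm ?powR_ge0//.
have t0 : 0 < t by exact: lt_le_trans ct.
rewrite -(opprB _ 2^-1) !powRN.
rewrite lef_pV2 ?posrE ?powR_gt0// ge0_ler_powR ?nnegrE ?(ltW c0) ?(ltW t0)//.
rewrite subr_ge0 ltW// (lt_le_trans (_ : _ < 1))// ?ler1n//.
by rewrite invf_lt1// ltr1n.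
Qed.

End SqrtDerivs.

(** * Functions of the base variable alone *)

Section Projection.
Variables (R : realType) (n r : nat).
Implicit Types (f : 'rV[R]_n -> R) (z : 'rV[R]_(n + r)).

Lemma lsubmx_line h (v z : 'rV[R]_(n + r)) :
  lsubmx (h *: v + z) = h *: lsubmx v + lsubmx z.
Proof. by rewrite linearP. Qed.

Lemma lsubmx_delta_l (i : 'I_n) :
  lsubmx (delta_mx ord0 (lshift r i) : 'rV[R]_(n + r)) = delta_mx ord0 i.
Proof. by apply/rowP => k; rewrite !mxE eq_lshift. Qed.

Lemma lsubmx_delta_r (b : 'I_r) :
  lsubmx (delta_mx ord0 (rshift n b) : 'rV[R]_(n + r)) = 0.
Proof. by apply/rowP => k; rewrite !mxE eq_lrshift andbF. Qed.

Lemma partial_lsubmx_l f (i : 'I_n) :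
  partial (lshift r i) (fun z => f (lsubmx z)) = fun z => partial i f (lsubmx z).
Proof.
apply/funext => z; rewrite /partial /derive.
set g1 := fun h => h^-1 *: _; set g2 := fun h => h^-1 *: _.
suff -> : g1 = g2 by [].
by apply/funext => h; rewrite /g1 /g2 /= lsubmx_line lsubmx_delta_l.
Qed.

Lemma derivable_lsubmx_l f (i : 'I_n) z :
  derivable f (lsubmx z) (delta_mx ord0 i) ->
  derivable (fun z => f (lsubmx z)) z (delta_mx ord0 (lshift r i)).
Proof.
rewrite /derivable; set g1 := fun h => h^-1 *: _; set g2 := fun h => h^-1 *: _.
suff -> : g1 = g2 by [].
by apply/funext => h; rewrite /g1 /g2 /= lsubmx_line lsubmx_delta_l.
Qed.

Lemma is_derive_lsubmx_r f (b : 'I_r) z :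
  is_derive z (delta_mx ord0 (rshift n b)) (fun z => f (lsubmx z)) 0.
Proof.
apply/is_derive_line.
rewrite (_ : (fun h => _) = cst (f (lsubmx z))); first exact: is_derive_cst.
by apply/funext => h /=; rewrite lsubmx_line lsubmx_delta_r scaler0 add0r.
Qed.

Lemma partial_lsubmx_r f (b : 'I_r) :
  partial (rshift n b) (fun z => f (lsubmx z)) = fun=> 0.
Proof.
by apply/funext => z; have [_ h] := is_derive_lsubmx_r f b z.
Qed.

(** Fibre derivatives stand last in the word and are applied first, so a single one annihilates a
    function of the base point. *)
Lemma pder_lsubmx (s : seq 'I_n) (t : seq 'I_r) f z :
  pder ([seq lshift r i | i <- s] ++ [seq rshift n i | i <- t])
    (fun z => f (lsubmx z)) z =
  if t is [::] then pder s f (lsubmx z) else 0.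
Proof.
rewrite /pder foldr_cat -/(pder _ _) -/(pder _ _).
case: (lastP t) => [|t' b].
  rewrite (_ : pder [seq lshift r i | i <- s] _ = fun z => pder s f (lsubmx z))//.
  by elim: s => [//|i s IH]; rewrite /= IH partial_lsubmx_l.
rewrite map_rcons pder_rcons partial_lsubmx_r.
rewrite (_ : pder _ (fun=> 0) = fun=> 0).
  by rewrite pder_cst0; case: t'.
by apply/funext => y; rewrite pder_cst0.
Qed.

Lemma class_Cn_lsubmx (O : set 'rV[R]_n) k f : class_Cn O k f ->
  class_Cn [set z : 'rV[R]_(n + r) | O (lsubmx z)] k (fun z => f (lsubmx z)).
Proof.
elim: k f => [|k IH] f.
  move=> [c _]; split=> // z Oz; apply: continuous_comp; last exact: (c _ Oz).
  exact/differentiable_continuous/differentiable_lsubmx.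
move=> [c [d p]]; split.
  move=> z Oz; apply: continuous_comp; last exact: (c _ Oz).
  exact/differentiable_continuous/differentiable_lsubmx.
split=> [z j Oz|j]; case: (split_ordP j) => i ->.
- exact/derivable_lsubmx_l/d.
- by have [] := is_derive_lsubmx_r f i z.
- by rewrite partial_lsubmx_l; exact: (IH _ (p i)).
- rewrite partial_lsubmx_r; elim: k {IH p} => [|k IH].
    by split=> // z _; exact: cst_continuous.
  split; first by move=> z _; exact: cst_continuous.
  split; first by move=> z j' _; exact: derivable_cst.
  by move=> j'; rewrite (_ : partial j' _ = fun=> 0)//; apply/funext => z;
    rewrite /partial (derive_cst 0).
Qed.

Lemma smooth_open_lsubmx (O : set 'rV[R]_n) f : smooth_open O f ->
  smooth_open [set z : 'rV[R]_(n + r) | O (lsubmx z)] (fun z => f (lsubmx z)).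
Proof.
by move=> /smooth_openP sf; apply/smooth_openP => k; exact: class_Cn_lsubmx.
Qed.

Lemma open_lsubmx (O : set 'rV[R]_n) : open O ->
  open [set z : 'rV[R]_(n + r) | O (lsubmx z)].
Proof.
move=> oO; apply: (@open_comp _ _ (fun z : 'rV[R]_(n + r) => lsubmx z)) => // z _.
exact/differentiable_continuous/differentiable_lsubmx.
Qed.

End Projection.

Section SmoothOn.
Variables (R : realType) (N : nat).
Implicit Types (A O : set 'rV[R]_N) (f g : 'rV[R]_N -> R).

Lemma smooth_on_open A O f : open O -> O `<=` A -> smooth_on A f -> smooth_open O f.
Proof.
move=> oO OA sf s x Ox; have [U' [F [oO' U'x sF Ff]]] := sf x (OA _ Ox).
have oI := openI oO oO'.
suff : smooth_open (O `&` U') f by apply.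
apply: (smooth_open_eq oI (f := F)); first by move=> y [/OA Ay U'y]; exact: Ff.
by apply: smooth_open_sub sF => y [].
Qed.

Lemma smooth_on_cst A (c : R) : smooth_on A (fun=> c).
Proof.
move=> x _; exists setT, (fun=> c); split=> //; first exact: openT.
exact: smooth_open_cst openT c.
Qed.

Lemma smooth_on_eq A f g : (forall x, A x -> f x = g x) -> smooth_on A f ->
  smooth_on A g.
Proof.
move=> fg sf x Ax; have [U [F [oO Ox sF Ff]]] := sf x Ax.
by exists U, F; split=> // y Oy Ay; rewrite Ff ?fg.
Qed.

Lemma smooth_on2 A f g (op : R -> R -> R) :
  (forall O F G, open O -> smooth_open O F -> smooth_open O G ->
     smooth_open O (fun x : 'rV[R]_N => op (F x) (G x))) ->
  smooth_on A f -> smooth_on A g -> smooth_on A (fun x => op (f x) (g x)).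
Proof.
move=> hop sf sg x Ax.
have [U [F [oO Ox sF Ff]]] := sf x Ax; have [U' [G [oO' U'x sG Gg]]] := sg x Ax.
exists (U `&` U'), (fun x => op (F x) (G x)); split=> //; first exact: openI.
  apply: hop; first exact: openI.
    by apply: smooth_open_sub sF => y [].
  by apply: smooth_open_sub sG => y [].
by move=> y [Oy U'y] Ay; rewrite Ff ?Gg.
Qed.

Lemma smooth_onD A f g : smooth_on A f -> smooth_on A g ->
  smooth_on A (fun x => f x + g x).
Proof. by apply: (smooth_on2 (op := fun a b => a + b)) => O F G oO; exact: smooth_openD. Qed.

Lemma smooth_onM A f g : smooth_on A f -> smooth_on A g ->
  smooth_on A (fun x => f x * g x).
Proof. by apply: (smooth_on2 (op := fun a b => a * b)) => O F G oO; exact: smooth_openM. Qed.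

(** The local extension [G] of [f] may take values outside [I] off the set [A]; since [I] is open,
    shrinking the neighbourhood to the preimage of [I] repairs this. *)
Lemma smooth_on_comp A (I : set R) (F : nat -> R -> R) f : open I -> derivs_on I F ->
  (forall x, A x -> I (f x)) -> smooth_on A f -> smooth_on A (fun x => F 0%N (f x)).
Proof.
move=> oI dF If sf x Ax; have [U [G [oO Ox sG Gf]]] := sf x Ax.
have oO' : open (U `&` G @^-1` I).
  rewrite openE => y [Oy Iy]; have [c _] := sG [::] y Oy.
  by apply: filterI; [exact: open_nbhs_nbhs|apply: c; exact: open_nbhs_nbhs].
exists (U `&` G @^-1` I), (fun x => F 0%N (G x)); split=> //.
- by split=> //=; rewrite Gf//; exact: If.
- apply: (smooth_open_comp oO' 0%N dF) => [y []//|].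
  by apply: smooth_open_sub sG => y [].
- by move=> y [Oy _] Ay; rewrite Gf.
Qed.

End SmoothOn.

(** * Symbol classes *)

Section SymbolClasses.
Variables (R : realType) (n r : nat) (V : orth_bundle R n r) (pu : pou V).
Local Notation chart := (bchart (@fib R n r V) n r).
Implicit Types (a b : symb V) (c : chart) (m : R) (st : seq 'I_n * seq 'I_r).

Definition dseq st : seq 'I_(n + r) :=
  [seq lshift r i | i <- st.1] ++ [seq rshift n i | i <- st.2].

Definition lfun (j : pidx pu) a : 'rV[R]_(n + r) -> R[i] :=
  loc (pch j) (fun v => (pfun j (projT1 v))%:C%C * a v).

Definition cut (j : pidx pu) (z : 'rV[R]_(n + r)) : R := pfun j (par (pch j) (lsubmx z)).

Definition rloc c a z : R := complex.Re (loc c a z).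
Definition iloc c a z : R := complex.Im (loc c a z).

Lemma Re_lfun j a : (fun z => complex.Re (lfun j a z)) =
  fun z => cut j z * rloc (pch j) a z.
Proof.
apply/funext => z; rewrite /lfun /cut /rloc /loc /=.
by case: (a _) => x y /=; rewrite mul0r subr0.
Qed.

Lemma Im_lfun j a : (fun z => complex.Im (lfun j a z)) =
  fun z => cut j z * iloc (pch j) a z.
Proof.
apply/funext => z; rewrite /lfun /cut /iloc /loc /=.
by case: (a _) => x y /=; rewrite mul0r addr0.
Qed.

(** The points at which [symb_quot] is evaluated. The set is open, so calculus on open sets applies
    even for manifolds with corners. *)
Definition cylinder j : set 'rV[R]_(n + r) := [set z | cint (pch (p := pu) j) (lsubmx z)].

(** The chart image is relatively open in a quadrant, and strict positivity of the finitely many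
    constrained coordinates keeps a neighbourhood inside that quadrant. *)
Lemma open_cint c : is_bchart c -> open (cint c).
Proof.
case=> _ [U oU Uc] _ _ _.
rewrite openE => y [Ay yp].
have [Uy _] : (U `&` quad (cor c)) y by rewrite -Uc.
have nU : \near y, U y by exact: open_nbhs_nbhs.
have nP := @filter_forall 'rV[R]_n 'I_n
  (fun j y' => (j < cor c)%N -> 0 < (y' : 'rV[R]_n) ord0 j) (nbhs (y : 'rV[R]_n))
  (nbhs_filter _).
have hj (j : 'I_n) : nbhs (y : 'rV[R]_n)
    [set y' : 'rV[R]_n | (j < cor c)%N -> 0 < y' ord0 j].
  have [jc|jc] := boolP (j < cor c)%N; last first.
    by apply: (filterS _ (@filterT _ (nbhs (y : 'rV[R]_n)) _)) => y'.
  have /(_ y) cj := @coord_continuous R 1 n ord0 j.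
  have : nbhs (y ord0 j) [set t : R | 0 < t].
    by apply: open_nbhs_nbhs; split; [exact: open_gt|exact: yp].
  move=> /cj h; refine (@filterS _ (nbhs (y : 'rV[R]_n)) _ _ _ _ h).
  move=> y' h1 h2; exact: h1.
have {}nP := nP hj.
refine (@filterS _ (nbhs (y : 'rV[R]_n)) _ _ _ _ (filterI nU nP)) => y' [Uy' py']; split=> //.
by rewrite Uc; split=> // j jc; exact/ltW/py'.
Qed.

Lemma open_cylinder j : open (cylinder j).
Proof. apply: open_lsubmx; apply: open_cint; exact: atlas_chart (pou_atlas j). Qed.

Lemma smooth_cut j : smooth_open (cylinder j) (cut j).
Proof.
apply: (@smooth_open_lsubmx R n r (cint (pch j)) (fun y => pfun j (par (pch j) y))).
have aj := pou_atlas j; apply: smooth_on_open (pou_smooth j aj).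
  exact: open_cint (atlas_chart aj).
by move=> y [].
Qed.

Lemma smooth_rloc j a : smooth_symb a -> smooth_open (cylinder j) (rloc (pch j) a).
Proof.
move=> sa; have [h _] := sa _ (pou_atlas j).
by apply: smooth_on_open h; [exact: open_cylinder|move=> z []].
Qed.

Lemma smooth_iloc j a : smooth_symb a -> smooth_open (cylinder j) (iloc (pch j) a).
Proof.
move=> sa; have [_ h] := sa _ (pou_atlas j).
by apply: smooth_on_open h; [exact: open_cylinder|move=> z []].
Qed.

Definition dlfun j st a z : R[i] := cpder (dseq st) (lfun j a) z.

Definition weight m st (xi : 'rV[R]_r) : R := jbr (enorm xi) `^ ((size st.2)%:R - m).

Lemma weight_ge0 m st xi : 0 <= weight m st xi.
Proof. exact: powR_ge0. Qed.

Lemma jbr_ge1 (t : R) : 1 <= jbr t.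
Proof. by rewrite -[leLHS]sqrtr1 ler_wsqrtr// lerDl sqr_ge0. Qed.

Definition symb_bound m st a (C : R) := forall j z, cylinder j z ->
  cabs (dlfun j st a z) * weight m st (rsubmx z) <= C.

Lemma symb_boundP m st a C :
  symb_bound m st a C <-> ubound (symb_quot pu m st a) C.
Proof.
split=> [h w [j [y [xi [yc ->]]]]|h j z zc].
  have := h j (row_mx y xi); rewrite /cylinder /= row_mxKl row_mxKr.
  by apply.
apply: h; exists j, (lsubmx z), (rsubmx z); split=> //.
by rewrite hsubmxK.
Qed.

Lemma symb_quot_ge0 m st a w : symb_quot pu m st a w -> 0 <= w.
Proof.
by move=> [j [y [xi [_ ->]]]]; rewrite mulr_ge0 ?cabs_ge0 ?powR_ge0.
Qed.

Lemma symb_sn_ge0 m st a : 0 <= symb_sn pu m st a.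
Proof.
rewrite /symb_sn; have [h|h] := pselect (has_sup (symb_quot pu m st a)); last first.
  by rewrite sup_out.
have [[w hw] _] := h; apply: le_trans (symb_quot_ge0 hw) _.
exact: sup_upper_bound hw.
Qed.

(** The assumption [0 <= C] covers an empty [symb_quot], whose supremum is 0 by convention. *)
Lemma symb_sn_le m st a C : 0 <= C -> symb_bound m st a C -> symb_sn pu m st a <= C.
Proof.
move=> C0 /symb_boundP h; rewrite /symb_sn.
have [->|/set0P h0] := eqVneq (symb_quot pu m st a) set0; first by rewrite sup0.
exact: ge_sup.
Qed.

Lemma symb_sn_bound m st a : has_ubound (symb_quot pu m st a) ->
  symb_bound m st a (symb_sn pu m st a).
Proof.
move=> h; apply/symb_boundP => w hw; apply: sup_upper_bound => //.
by split=> //; exists w.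
Qed.

(** A bounded subset of S^m, presented as a family: the constants depend on the multi-indices but
    not on [i]. One-element families recover membership in S^m. *)
Definition symb_bounded (I : Type) m (a : I -> symb V) :=
  (forall i, smooth_symb (a i)) /\
  forall st, exists C, forall i, symb_bound m st (a i) C.

Lemma symb_bounded_inS (I : Type) m (a : I -> symb V) i :
  symb_bounded m a -> inS pu m (a i).
Proof.
move=> [sa ba]; split=> // st; have [C hC] := ba st.
by exists C; apply/symb_boundP; exact: hC.
Qed.

Lemma inS_bounded m a : inS pu m a -> symb_bounded m (fun _ : unit => a).
Proof.
move=> [sa ba]; split=> // st.
by exists (symb_sn pu m st a) => _; exact: symb_sn_bound.
Qed.

Lemma symb_bounded_sn (I : Type) m st (a : I -> symb V) : symb_bounded m a ->
  exists2 C, 0 <= C & forall i, symb_sn pu m st (a i) <= C.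
Proof.
move=> [_ /(_ st)[C hC]]; exists `|C| => // i; apply: symb_sn_le => // j z jz.
exact: le_trans (hC i j z jz) (ler_norm _).
Qed.

Lemma symb_bounded_of_sn (I : Type) m (a : I -> symb V) :
  (forall i, inS pu m (a i)) ->
  (forall st, exists C, forall i, symb_sn pu m st (a i) <= C) -> symb_bounded m a.
Proof.
move=> ia h; split=> [i|st]; first by case: (ia i).
have [C hC] := h st; exists C => i j z jz.
apply: le_trans (hC i); apply: symb_sn_bound => //.
by case: (ia i).
Qed.

Lemma smooth_symb_lin (k : R[i]) a b : smooth_symb a -> smooth_symb b ->
  smooth_symb (fun v => k * a v + b v).
Proof.
move=> sa sb c ac; have [ra ia] := sa c ac; have [rb ib] := sb c ac.
have hZ t f : smooth_on [set z | img c (lsubmx z)] f ->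
    smooth_on [set z : 'rV[R]_(n + r) | img c (lsubmx z)] (fun z => t * f z).
  by apply: smooth_onM; exact: smooth_on_cst.
split.
  apply: smooth_on_eq (smooth_onD (smooth_onD (hZ (complex.Re k) _ ra)
    (hZ (- complex.Im k) _ ia)) rb) => z _.
  by rewrite /loc; case: (k) (a _) (b _) => k1 k2 [x y] [x' y'] /=; rewrite mulNr.
apply: smooth_on_eq (smooth_onD (smooth_onD (hZ (complex.Re k) _ ia)
  (hZ (complex.Im k) _ ra)) ib) => z _.
by rewrite /loc; case: (k) (a _) (b _) => k1 k2 [x y] [x' y'] /=.
Qed.

Lemma dlfun_lin (k : R[i]) a b j st z : smooth_symb a -> smooth_symb b ->
  cylinder j z -> dlfun j st (fun v => k * a v + b v) z =
    k * dlfun j st a z + dlfun j st b z.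
Proof.
move=> sa sb jz; have oj := @open_cylinder j.
rewrite /dlfun /cpder !Re_lfun !Im_lfun.
have sc := @smooth_cut j.
have ra := smooth_openM oj sc (smooth_rloc sa); have ia := smooth_openM oj sc (smooth_iloc sa).
have rb := smooth_openM oj sc (smooth_rloc sb); have ib := smooth_openM oj sc (smooth_iloc sb).
have key t u : pder (dseq st) (fun z => t * (cut j z * rloc (pch j) a z) +
    (u * (cut j z * iloc (pch j) a z) + cut j z * rloc (pch j) b z)) z =
  t * pder (dseq st) (fun z => cut j z * rloc (pch j) a z) z +
  (u * pder (dseq st) (fun z => cut j z * iloc (pch j) a z) z +
   pder (dseq st) (fun z => cut j z * rloc (pch j) b z) z).
  have sA := smooth_openZ oj t ra; have sB := smooth_openZ oj u ia.
  rewrite (pderD_on oj _ sA (smooth_openD oj sB rb) jz) (pderD_on oj _ sB rb jz).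
  by rewrite (pderZ_on oj _ _ ra jz) (pderZ_on oj _ _ ia jz).
have key' t u : pder (dseq st) (fun z => t * (cut j z * rloc (pch j) a z) +
    (u * (cut j z * iloc (pch j) a z) + cut j z * iloc (pch j) b z)) z =
  t * pder (dseq st) (fun z => cut j z * rloc (pch j) a z) z +
  (u * pder (dseq st) (fun z => cut j z * iloc (pch j) a z) z +
   pder (dseq st) (fun z => cut j z * iloc (pch j) b z) z).
  have sA := smooth_openZ oj t ra; have sB := smooth_openZ oj u ia.
  rewrite (pderD_on oj _ sA (smooth_openD oj sB ib) jz) (pderD_on oj _ sB ib jz).
  by rewrite (pderZ_on oj _ _ ra jz) (pderZ_on oj _ _ ia jz).
apply/eqP; rewrite eq_complex; apply/andP; split; apply/eqP => /=.
  transitivity (pder (dseq st) (fun z => complex.Re k * (cut j z * rloc (pch j) a z) +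
    (- complex.Im k * (cut j z * iloc (pch j) a z) + cut j z * rloc (pch j) b z)) z).
    congr pder; apply/funext => y; rewrite /rloc /iloc /loc /=.
    case: (k) (a _) (b _) => k1 k2 [x1 y1] [x2 y2] /=; ring.
  by rewrite key; case: (k) => k1 k2 /=; ring.
transitivity (pder (dseq st) (fun z => complex.Im k * (cut j z * rloc (pch j) a z) +
    (complex.Re k * (cut j z * iloc (pch j) a z) + cut j z * iloc (pch j) b z)) z).
  congr pder; apply/funext => y; rewrite /rloc /iloc /loc /=.
  case: (k) (a _) (b _) => k1 k2 [x1 y1] [x2 y2] /=; ring.
by rewrite key'; case: (k) => k1 k2 /=; ring.
Qed.

Lemma symb_bounded_lin (I : Type) m (k : R[i]) (a b : I -> symb V) :
  symb_bounded m a -> symb_bounded m b ->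
  symb_bounded m (fun i v => k * a i v + b i v).
Proof.
move=> [sa ba] [sb bb]; split=> [i|st]; first exact: smooth_symb_lin.
have [C hC] := ba st; have [C' hC'] := bb st.
exists (cabs k * C + C') => i j z jz.
rewrite dlfun_lin//.
rewrite (le_trans (ler_wpM2r (weight_ge0 _ _ _) (cabsD _ _)))// mulrDl lerD ?hC'//.
by rewrite cabsM -mulrA ler_wpM2l ?cabs_ge0// hC.
Qed.

Lemma smooth_symb_cst (k : R[i]) : smooth_symb (fun _ : tot V => k).
Proof. by move=> c _; split; exact: smooth_on_cst. Qed.

Lemma symb_bounded0 (I : Type) m : symb_bounded m (fun (_ : I) (_ : tot V) => 0).
Proof.
split=> [_|st]; first exact: smooth_symb_cst.
exists 0 => _ j z _; rewrite /dlfun /cpder Re_lfun Im_lfun.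
rewrite (_ : (fun z => _) = fun=> 0); last by apply/funext => y; rewrite mulr0.
by rewrite !pder_cst0 cabs0 mul0r.
Qed.

Lemma symb_boundedZ (I : Type) m (k : R[i]) (a : I -> symb V) :
  symb_bounded m a -> symb_bounded m (fun i v => k * a i v).
Proof.
move=> ba; have := symb_bounded_lin k ba (@symb_bounded0 I m).
by under eq_fun do under eq_fun do rewrite addr0.
Qed.

Lemma symb_boundedD (I : Type) m (a b : I -> symb V) :
  symb_bounded m a -> symb_bounded m b -> symb_bounded m (fun i v => a i v + b i v).
Proof.
move=> ba bb; have := symb_bounded_lin 1 ba bb.
by under eq_fun do under eq_fun do rewrite mul1r.
Qed.

Lemma symb_boundedB (I : Type) m (a b : I -> symb V) :
  symb_bounded m a -> symb_bounded m b -> symb_bounded m (fun i v => a i v - b i v).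
Proof.
move=> ba bb; have := symb_boundedD ba (symb_boundedZ (-1) bb).
by under eq_fun do under eq_fun do rewrite mulN1r.
Qed.

Lemma smooth_symb_conj a : smooth_symb a -> smooth_symb (fun v => (a v)^*%C).
Proof.
move=> sa c ac; have [ra ia] := sa c ac; split.
  by apply: smooth_on_eq ra => z _; rewrite /loc; case: (a _).
apply: (@smooth_on_eq _ _ _ (fun z => (-1) * complex.Im (loc c a z))).
  by move=> z _; rewrite /loc mulN1r; case: (a _).
by apply: smooth_onM ia; exact: smooth_on_cst.
Qed.

Lemma symb_bounded_conj (I : Type) m (a : I -> symb V) : symb_bounded m a ->
  symb_bounded m (fun i v => (a i v)^*%C).
Proof.
move=> [sa ba]; split=> [i|st]; first exact: smooth_symb_conj.
have [C hC] := ba st; exists C => i j z jz; have oj := @open_cylinder j.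
have -> : dlfun j st (fun v => (a i v)^*%C) z = (dlfun j st (a i) z)^*%C.
  rewrite /dlfun /cpder !Re_lfun !Im_lfun /=; apply/eqP; rewrite eq_complex /=.
  apply/andP; split; apply/eqP.
    by congr pder; apply/funext => y; rewrite /rloc /loc; case: (a i _).
  rewrite -mulN1r -(pderZ_on oj)//.
    congr pder; apply/funext => y; rewrite /iloc /loc; case: (a i _) => x1 y1 /=; ring.
  apply: smooth_openM => //; [exact: smooth_cut|exact: smooth_iloc].
by rewrite cabs_conj; exact: hC.
Qed.

Lemma symb_bounded_le (I : Type) m m' (a : I -> symb V) : m <= m' ->
  symb_bounded m a -> symb_bounded m' a.
Proof.
move=> mm [sa ba]; split=> // st; have [C hC] := ba st; exists C => i j z jz.
apply: le_trans (hC i j z jz); rewrite ler_wpM2l ?cabs_ge0//.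
by rewrite ler_powR ?jbr_ge1// lerD2l lerN2.
Qed.

Lemma inS_le m m' a : m <= m' -> inS pu m a -> inS pu m' a.
Proof.
by move=> mm /inS_bounded /(symb_bounded_le mm) h; exact: symb_bounded_inS tt h.
Qed.

Lemma inS_lin m (k : R[i]) a b : inS pu m a -> inS pu m b ->
  inS pu m (fun v => k * a v + b v).
Proof.
move=> /inS_bounded ha /inS_bounded hb.
exact: symb_bounded_inS tt (symb_bounded_lin k ha hb).
Qed.

Lemma inS0 m : inS pu m (fun=> 0).
Proof. exact: symb_bounded_inS tt (@symb_bounded0 unit m). Qed.

Lemma inSZ m (k : R[i]) a : inS pu m a -> inS pu m (fun v => k * a v).
Proof.
by move=> /inS_bounded ha; exact: symb_bounded_inS tt (symb_boundedZ k ha).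
Qed.

Lemma inSD m a b : inS pu m a -> inS pu m b -> inS pu m (fun v => a v + b v).
Proof.
move=> /inS_bounded ha /inS_bounded hb.
exact: symb_bounded_inS tt (symb_boundedD ha hb).
Qed.

Lemma inSB m a b : inS pu m a -> inS pu m b -> inS pu m (fun v => a v - b v).
Proof.
move=> /inS_bounded ha /inS_bounded hb.
exact: symb_bounded_inS tt (symb_boundedB ha hb).
Qed.

Lemma inS_conj m a : inS pu m a -> inS pu m (fun v => (a v)^*%C).
Proof.
by move=> /inS_bounded ha; exact: symb_bounded_inS tt (symb_bounded_conj ha).
Qed.

Lemma symb_snZ m st (t : R) a : 0 <= t -> inS pu m a ->
  symb_sn pu m st (fun v => t%:C%C * a v) <= t * symb_sn pu m st a.
Proof.
move=> t0 [sa ba]; apply: symb_sn_le; first by rewrite mulr_ge0// symb_sn_ge0.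
move=> j z jz; have s0 := @smooth_symb_cst 0.
have := dlfun_lin t%:C%C st sa s0 jz; under eq_fun do rewrite addr0.
move=> ->; rewrite (_ : dlfun j st (fun=> 0) z = 0) ?addr0; last first.
  rewrite /dlfun /cpder Re_lfun Im_lfun.
  rewrite (_ : (fun z => _) = fun=> 0); last by apply/funext => y; rewrite mulr0.
  by rewrite !pder_cst0.
rewrite cabsM cabs_real ger0_norm// -mulrA ler_wpM2l//.
exact: symb_sn_bound.
Qed.

End SymbolClasses.

(** * Uniformity of the partition of unity *)

Section Geometry.

(** Compactness is used as a near-covering property along the filter of large [N]; monotonicity
    upgrades a local bound [N] to all larger ones. *)
Lemma compact_uniform_bound (T : topologicalType) (Q : T -> nat -> Prop) :
  compact [set: T] -> (forall (x : T) N N', (N <= N')%N -> Q x N -> Q x N') ->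
  (forall x : T, exists N, \forall x' \near x, Q x' N) -> exists N, forall x, Q x N.
Proof.
move=> cT mono loc.
have /(_ nat \oo (fun N x => Q x N)) := (@compact_near_coveringP T [set: T]).1 cT.
case.
  move=> x _; have [N hN] := loc x.
  exists ([set x' | Q x' N], [set k | (N <= k)%N]); first by split=> //; exists N.
  by move=> [x' k] [/= h1 h2]; exact: mono h2 h1.
by move=> N _ hN; exists N => x; exact: hN (leqnn N) _ _.
Qed.

Variables (R : realType) (n r : nat) (V : orth_bundle R n r) (pu : pou V).

Definition cut_par (j : pidx pu) (y : 'rV[R]_n) : R := pfun j (par (pch j) y).

(** This and [uniform_multiplicity] form the interface between the two geometric settings and the
    symbol estimates. *)
Definition uniform_cutoffs := forall s, exists C, forall (j : pidx pu) y,
  cint (pch j) y -> `|pder s (cut_par j) y| <= C.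

Definition uniform_multiplicity := exists N : nat, forall x (s : seq (pidx pu)),
  uniq s -> (forall j, j \in s -> dom (pch j) x) -> (size s <= N)%N.

Lemma compact_multiplicity : compact [set: base V] -> uniform_multiplicity.
Proof.
move=> cV; have := @compact_uniform_bound (base V) (fun x N => forall s : seq (pidx pu),
  uniq s -> (forall j, j \in s -> dom (pch j) x) -> (size s <= N)%N) cV.
case=> [x N N' NN h s us sx|x|N hN]; last by exists N.
  exact: leq_trans (h s us sx) NN.
have [U Ux /finite_seqP[J hJ]] := pou_locfin pu x.
exists (size J); apply: filterS Ux => x' Ux' s us sx.
apply: uniq_leq_size => // j /sx jx.
suff : [set` J] j by [].
by rewrite -hJ; exists x'.
Qed.

Lemma img_par (c : bchart (@fib R n r V) n r) y : atlas c -> img c y ->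
  dom c (par c y) /\ co c (par c y) = y.
Proof.
by move=> ac [x dx <-]; have [_ _ cK _ _] := atlas_chart ac; rewrite cK.
Qed.

(** Over the chart domain, a local smooth extension of the cutoff has a continuous, hence locally
    bounded, derivative. A point outside the domain is also outside the closed support, so the
    cutoff vanishes nearby; this excludes blow-up at the edge of the chart. *)
Lemma cutoff_local_bound s (j : pidx pu) (x : base V) : exists N : nat, \forall x' \near x,
  forall y, cint (pch j) y -> par (pch j) y = x' ->
  `|pder s (cut_par j) y| <= N%:R.
Proof.
have aj := pou_atlas j; set c := pch j in aj *.
have [odom _ cK [cco cpar] _] := atlas_chart aj.
have ocint := open_cint (atlas_chart aj).
have [dx|ndx] := pselect (dom c x).
  have Ax : img c (co c x) by exists x.
  have [U [F [oU Ux sF Ff]]] := pou_smooth j aj Ax.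
  have [cF _] := sF s _ Ux.
  pose B := [set y | `|pder s F y| < `|pder s F (co c x)| + 1].
  have nB : nbhs (co c x) B.
    have : nbhs (pder s F (co c x)) [set t | `|t| < `|pder s F (co c x)| + 1].
      apply: open_nbhs_nbhs; split=> /=; last by rewrite ltrDl.
      apply: (@open_comp _ _ (fun t : R => `|t|) [set t | t < _]); last exact: open_lt.
      by move=> t _; exact: norm_continuous.
    by move/cF.
  have nU : nbhs (co c x) U by exact: open_nbhs_nbhs.
  have cx : co c @ within (dom c) (nbhs x) --> co c x.
    by have := (subspace_continuousP _ _).1 cco x dx.
  have nBU : nbhs (co c x) (B `&` U) by exact: filterI.
  have h1 : nbhs x [set x' | dom c x' -> (B `&` U) (co c x')] := cx _ nBU.
  have [N hN] : exists N : nat, `|pder s F (co c x)| + 1 <= N%:R.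
    by exists (Num.bound (`|pder s F (co c x)| + 1)); rewrite ltW// archi_boundP.
  exists N; have ndom : nbhs x (dom c) by exact: open_nbhs_nbhs.
  have fx : Filter (nbhs x) := nbhs_filter x.
  have nI := @filterI _ (nbhs x) fx _ _ h1 ndom.
  apply: (@filterS _ (nbhs x) fx _ _ _ nI) => x' [] /= h2 dx' y cy yx'.
  have [_ yE] := img_par aj cy.1; rewrite yx' in yE.
  have := h2 dx'; rewrite yE => -[/= By Uy].
  rewrite (_ : pder s (cut_par j) y = pder s F y).
    exact: le_trans (ltW By) hN.
  apply: (@pder_eq_on _ _ (U `&` cint c)) => //; first exact: openI.
  by move=> z [Uz [Az _]]; rewrite Ff.
exists 0%N; pose A : set (base V) := ~` closure [set x | pfun j x != 0].
have oA : open A by apply: closed_openC; exact: closed_closure.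
have : nbhs x A.
  by apply: open_nbhs_nbhs; split=> // h; apply: ndx; exact: pou_supp h.
apply: filterS => x' Ax' y cy yx'; rewrite -yx' in Ax'.
have cy' : par c @ within (img c) (nbhs y) --> par c y.
  by have := (subspace_continuousP _ _).1 cpar y cy.1.
have nA : nbhs (par c y) A by exact: open_nbhs_nbhs.
have nc : nbhs y (cint c) by exact: open_nbhs_nbhs.
have hA : nbhs y [set y' | img c y' -> A (par c y')] := cy' _ nA.
have fy : Filter (nbhs y) := nbhs_filter y.
have := @filterI _ (nbhs y) fy _ _ hA nc; rewrite nbhsE => -[U [oU Uy] UA].
suff -> : pder s (cut_par j) y = pder s (fun=> 0) y by rewrite pder_cst0 normr0.
apply: (@pder_eq_on R n U (cut_par j) (fun=> 0)) => // z /UA[/= h [Az _]].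
have := h Az; rewrite /A /= => nz; apply/eqP; apply/negPn/negP => z0.
by apply: nz; apply: subset_closure.
Qed.

Lemma compact_cutoffs : compact [set: base V] -> uniform_cutoffs.
Proof.
move=> cV s; have := @compact_uniform_bound (base V) (fun x N => forall j y,
  cint (pch j) y -> par (pch j) y = x -> `|pder s (cut_par j) y| <= N%:R) cV.
case=> [x N N' NN h j y cy yx|x|N hN].
- by apply: le_trans (h j y cy yx) _; rewrite ler_nat.
- have [U Ux /finite_seqP[J hJ]] := pou_locfin pu x.
  have [N hN] : exists N : nat, \forall x' \near x, forall j y, j \in J ->
      cint (pch j) y -> par (pch j) y = x' -> `|pder s (cut_par j) y| <= N%:R.
    elim: J {hJ} => [|j l [N hN]]; first by exists 0%N; apply: nearW.
    have [N' hN'] := cutoff_local_bound s j x.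
    exists (maxn N N'); apply: filterS (filterI hN hN') => x' [h h'] i y.
    rewrite in_cons => /orP[/eqP -> cy yx|il cy yx].
      by rewrite (le_trans (h' y cy yx))// ler_nat leq_maxr.
    by rewrite (le_trans (h i y il cy yx))// ler_nat leq_maxl.
  exists N; have fx : Filter (nbhs x) := nbhs_filter x.
  apply: (@filterS _ (nbhs x) fx _ _ _ (@filterI _ (nbhs x) fx _ _ Ux hN)) => x' [Ux' h] j y cy yx'.
  apply: h => //; suff : [set` J] j by [].
  rewrite -hJ; exists x'; split=> //; rewrite -yx'.
  by have [] := img_par (pou_atlas j) cy.1.
- by exists N%:R => j y cy; exact: hN.
Qed.

End Geometry.

Lemma setting_uniform (R : realType) (n r : nat) (V : orth_bundle R n r)
    (g : rmetric V) (nab : oconnection V) (pu : pou V) :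
  setting g nab pu -> uniform_cutoffs pu /\ uniform_multiplicity pu.
Proof.
elim=> {n r V g nab pu} [n r V g nab pu cV|].
  by split; [exact: compact_cutoffs|exact: compact_multiplicity].
by move=> n V g nab pu cf rinj rho _ _ _ _ _ [_ mult cuts]; split.
Qed.

(** * Order zero: constants, sup bounds and square roots *)

Section SymbolEstimates.
Variables (R : realType) (n r : nat) (V : orth_bundle R n r) (pu : pou V).
Local Notation chart := (bchart (@fib R n r V) n r).
Implicit Types (a b : symb V) (c : chart) (m : R) (st : seq 'I_n * seq 'I_r).

(** Localized, the constant 1 is the cutoff itself: fibre derivatives kill it, and without them the
    weight in order 0 is 1. *)
Lemma symb_bounded1 (I : Type) : uniform_cutoffs pu ->
  symb_bounded pu 0 (fun (_ : I) (_ : tot V) => 1).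
Proof.
move=> hcut; split=> [_|st]; first exact: smooth_symb_cst.
have [C hC] := hcut st.1; exists (Num.max C 0) => _ j z jz.
rewrite /dlfun /cpder Re_lfun Im_lfun.
rewrite (_ : (fun z => _) = fun z => cut_par j (lsubmx z)); last first.
  by apply/funext => y; rewrite /rloc /loc /= mulr1.
rewrite [X in (_ +i* X)%C](_ : _ = 0); last first.
  rewrite (_ : (fun z => _) = fun=> 0) ?pder_cst0//.
  by apply/funext => y; rewrite /iloc /loc /= mulr0.
rewrite cabs_real /dseq pder_lsubmx /weight.
case: st.2 => [|b t]; last by rewrite normr0 mul0r le_max lexx orbT.
by rewrite subr0 powRr0 mulr1 le_max hC.
Qed.

(** Moving by a small [t > 0] along the base direction (1, ..., 1) makes every constrained
    coordinate strictly positive. *)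
Lemma cint_adherent c (z : 'rV[R]_(n + r)) B : atlas c -> img c (lsubmx z) -> nbhs z B ->
  exists2 z', B z' & cint c (lsubmx z').
Proof.
move=> ac zc nB; have [_ [U oU Uc] _ _ _] := atlas_chart ac.
have [Uz qz] : (U `&` quad (cor c)) (lsubmx z) by rewrite -Uc.
pose w : 'rV[R]_(n + r) := row_mx (const_mx 1) 0.
pose p (t : R) := t *: w + z.
have cp : p t @[t --> 0^'+] --> z.
  have h : p t @[t --> (0 : R)] --> 0 *: w + z.
    apply: cvgD; last exact: cvg_cst.
    by apply: cvgZr_tmp; exact: cvg_id.
  by have := cvg_at_right_filter h; rewrite scale0r add0r.
have nU : nbhs z [set z : 'rV[R]_(n + r) | U (lsubmx z)].
  by apply: open_nbhs_nbhs; split=> //; exact: open_lsubmx.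
have h0 : \forall t \near 0^'+, 0 < t :> R by exact: nbhs_right_gt.
have h1 : \forall t \near 0^'+, B (p t) := cp _ nB.
have h2 : \forall t \near 0^'+, U (lsubmx (p t)) := cp _ nU.
have [t [[Bt Ut] t0]] : exists t : R, (B (p t) /\ U (lsubmx (p t))) /\ 0 < t.
  apply: (@filter_ex _ (0 : R)^'+).
  by near=> t; split; [split|]; near: t.
exists (p t) => //.
have pE j : (lsubmx (p t)) ord0 j = t + (lsubmx z) ord0 j.
  by rewrite !mxE (unsplitK (inl _)) !mxE mulr1.
split; last by move=> j jc; rewrite pE ltr_wpDr// qz.
by rewrite Uc; split=> // j jc; rewrite pE addr_ge0 ?qz// ltW.
Unshelve. all: by end_near. Qed.

Lemma smooth_on_lsubmx (A : set 'rV[R]_n) f : smooth_on A f ->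
  smooth_on [set z : 'rV[R]_(n + r) | A (lsubmx z)] (fun z => f (lsubmx z)).
Proof.
move=> sf z Az; have [U [F [oU Uz sF Ff]]] := sf _ Az.
exists [set z | U (lsubmx z)], (fun z => F (lsubmx z)); split=> //.
- exact: open_lsubmx.
- exact: smooth_open_lsubmx.
- by move=> y; exact: Ff.
Qed.

(** The seminorms test only the interior of the chart image; continuity carries the bound to
    boundary and corner points. Squares are compared because real and imaginary parts have separate
    smooth extensions. *)
Lemma lfun_bound_img j a C : smooth_symb a ->
  (forall z, cylinder j z -> cabs (lfun (pu := pu) j a z) <= C) ->
  forall z, img (pch j) (lsubmx z) -> cabs (lfun j a z) <= C.
Proof.
move=> sa h z Az; have aj := pou_atlas j; have [ra ia] := sa _ aj.
have sc := smooth_on_lsubmx (pou_smooth j aj).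
have [U1 [F [oU1 U1z sF Ff]]] := smooth_onM sc ra Az.
have [U2 [G [oU2 U2z sG Gf]]] := smooth_onM sc ia Az.
have E y : U1 y -> U2 y -> img (pch j) (lsubmx y) ->
    cabs (lfun j a y) ^+ 2 = F y ^+ 2 + G y ^+ 2.
  move=> U1y U2y Ay; rewrite cabs_sqr Ff// Gf//.
  have /funeqP/(_ y) := Re_lfun j a; rewrite /= => ->.
  by have /funeqP/(_ y) := Im_lfun j a; rewrite /= => ->.
rewrite leNgt; apply/negP => Clt.
have C0 : 0 <= C.
  have [z' _ cz'] := cint_adherent aj Az (@filterT _ _ (nbhs_filter z)).
  exact: le_trans (cabs_ge0 _) (h _ cz').
have [cF _] := sF [::] z U1z; have [cG _] := sG [::] z U2z.
have cQ : {for z, continuous (fun y => F y ^+ 2 + G y ^+ 2)}.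
  by apply: continuousD; apply: continuousM.
have nQ : nbhs z [set y | C ^+ 2 < F y ^+ 2 + G y ^+ 2].
  apply: (cQ [set t | C ^+ 2 < t]); apply: open_nbhs_nbhs; split; first exact: open_gt.
  by rewrite /= -E// ltrXn2r// ltW.
have n1 : nbhs z U1 by exact: open_nbhs_nbhs.
have n2 : nbhs z U2 by exact: open_nbhs_nbhs.
have [z' [Qz' [U1z' U2z']] cz'] := cint_adherent aj Az (filterI nQ (filterI n1 n2)).
have := h _ cz'; rewrite -(@ler_pXn2r _ 2)// ?nnegrE ?cabs_ge0// E//; last by case: cz'.
by rewrite leNgt Qz'.
Qed.

(** The seminorm without derivatives bounds each [pfun j] times [|a|]. These products sum to [|a|],
    and at most [N] of them are nonzero at a given point. *)
Lemma symb_bounded_sup (I : Type) (a : I -> symb V) : uniform_multiplicity pu ->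
  symb_bounded pu 0 a -> exists C, forall i v, cabs (a i v) <= C.
Proof.
move=> [N hN] [sa /(_ ([::], [::]))[C hC]].
exists (N%:R * C) => i [x w].
have hj (j : pidx pu) : dom (pch j) x -> pfun j x * cabs (a i (existT _ x w)) <= C.
  move=> dx; have aj := pou_atlas j; have [_ _ cK _ tr] := atlas_chart aj.
  pose z := row_mx (co (pch j) x) (triv (pch j) w).
  have Az : img (pch j) (lsubmx z) by rewrite row_mxKl; exists x.
  have hz : forall z, cylinder j z -> cabs (lfun j (a i) z) <= C.
    move=> y cy; have := hC i j y cy; rewrite /weight subr0 powRr0 mulr1.
    by rewrite /dlfun /cpder /dseq /=; case: (lfun _ _ _).
  have := lfun_bound_img (sa i) hz Az.
  rewrite /lfun /loc row_mxKl row_mxKr cabsM cabs_real /= ger0_norm ?pou_ge0//.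
  by rewrite (cK _ dx); have [_ -> _] := tr _ dx.
have := pou_sum1 pu x.
set s := finite_support _ _ _ => s1.
have sdom j : j \in s -> dom (pch j) x.
  (* By convention a sum with infinite support is taken over the empty list, so that case is
     harmless. *)
  have [fs|ifs] := pselect (finite_set ([set: pidx pu] `&`
      (fun j => pfun j x) @^-1` [set~ 0])).
    rewrite in_finite_support// inE => -[_ /= jx].
    by apply: pou_supp; apply: subset_closure => /=; apply/eqP.
  by rewrite /s no_finite_support.
have us : uniq s by exact: finite_support_uniq.
have sz := hN x s us sdom.
have C0 : 0 <= C.
  have [j jx] := pou_cover pu x.
  by apply: le_trans (hj j jx); rewrite mulr_ge0 ?cabs_ge0 ?pou_ge0.
rewrite -[leLHS]mul1r -[X in X * cabs _]s1 mulr_suml.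
rewrite (le_trans (_ : _ <= \sum_(j <- s) C))//.
  by rewrite big_seq_cond [leRHS]big_seq_cond ler_sum// => j /andP[/sdom js _]; exact: hj.
by rewrite big_const_seq count_predT iter_addr_0 -[leLHS]mulr_natl ler_wpM2r// ler_nat.
Qed.

(** The lower bound [d] keeps the values of [u] away from the singularity of the square root.
    [pder_comp_bound] asks only for derivatives of the cutoff times powers of [u], hence the
    assumption on all powers. *)
Lemma symb_bounded_sqrt (I : Type) (u : I -> symb V) (d : R) : 0 < d ->
  (forall i v, complex.Im (u i v) = 0 /\ d <= complex.Re (u i v) <= 1) ->
  (forall k, symb_bounded pu 0 (fun i v => u i v ^+ k)) ->
  symb_bounded pu 0 (fun i v => (Num.sqrt (complex.Re (u i v)))%:C%C).
Proof.
move=> d0 hu bu.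
have su i : smooth_symb (u i).
  by have [/(_ i) h _] := bu 1%N; move: h; under eq_fun do rewrite expr1.
have up i v : 0 < complex.Re (u i v).
  by have [_ /andP[h _]] := hu i v; exact: lt_le_trans h.
have dS := @sqrt_der_derivs R.
have E i c z : rloc c (fun v => (Num.sqrt (complex.Re (u i v)))%:C%C) z =
    sqrt_der 0 (rloc c (u i) z).
  by rewrite sqrt_der0 ?ltW//; exact: up.
split=> [i c ac|st].
  split; last exact: smooth_on_cst.
  have [ru _] := su i c ac.
  have hp z : [set z | img c (lsubmx z)] z -> [set t | 0 < t] (rloc c (u i) z).
    by move=> _; exact: up.
  have hs := smooth_on_comp (@open_gt R 0) dS hp ru.
  by apply: (smooth_on_eq _ hs) => z _; exact/esym/E.
pose S := size (dseq st).
have [A hA] := sqrt_der_bounded S d0.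
have [B hB] : exists B, forall k, (k <= S)%N -> forall i,
    symb_bound pu 0 st (fun v => u i v ^+ k) B.
  elim: S {hA} => [|S [B hB]].
    have [_ /(_ st)[B hB]] := bu 0%N; exists B => k; rewrite leqn0 => /eqP -> i.
    exact: hB.
  have [_ /(_ st)[B' hB']] := bu S.+1; exists (Num.max B B') => k.
  rewrite leq_eqVlt => /orP[/eqP ->|kS] i j z jz.
    by rewrite le_max hB' ?orbT.
  by rewrite le_max (hB k kS).
exists (A * B * \sum_(k < S.+1) \sum_(i < k.+1) 'C(k, i)%:R) => i j z jz.
set w := weight _ _ _.
have w0 : 0 < w by rewrite powR_gt0// (lt_le_trans ltr01)// jbr_ge1.
have ux : `|rloc (pch j) (u i) z| <= 1.
  have [_ /andP[h1 h2]] := hu i (existT _ (par (pch j) (lsubmx z))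
    (frm (pch j) (par (pch j) (lsubmx z)) (rsubmx z))).
  by rewrite ger0_norm// ltW// (lt_le_trans d0).
(* All powers have order 0 and are differentiated by the same [st], so one weight [w], that of the
   point [z], serves for every [k] and can be divided out. *)
have ub k : (k <= S)%N -> `|pder (dseq st) (fun y => cut j y * rloc (pch j) (u i) y ^+ k) z|
    <= B / w.
  move=> kS; rewrite ler_pdivlMr//.
  apply: le_trans (hB k kS i j z jz); rewrite ler_wpM2r ?(ltW w0)//.
  rewrite (_ : pder _ _ z = complex.Re (dlfun j st (fun v => u i v ^+ k) z)).
    exact: cabs_Re.
  rewrite /dlfun /cpder /= Re_lfun; congr pder.
  apply/funext => y; congr (_ * _); rewrite /rloc /loc.
  have [+ _] := hu i (existT _ (par (pch j) (lsubmx y))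
    (frm (pch j) (par (pch j) (lsubmx y)) (rsubmx y))).
  by case: (u i _) => x1 y1 /= ->; rewrite -[(x1 +i* 0)%C]/(x1%:C%C) -rmorphXn.
have h := @pder_comp_bound R (n + r) (cylinder j) (cut j) (rloc (pch j) (u i)) (dseq st) z
  A (B / w) (@open_cylinder _ _ _ _ _ j) (@smooth_cut _ _ _ _ _ j)
  (smooth_rloc (su i)) jz ux ub [set t | 0 < t] (@sqrt_der R) dS.
have {}h := h (fun y _ => up i _) (fun k kS => hA k _ kS (hu i _).2).
rewrite /dlfun /cpder Re_lfun Im_lfun [X in (_ +i* X)%C](_ : _ = 0); last first.
  rewrite (_ : (fun z => _) = fun=> 0) ?pder_cst0//.
  by apply/funext => y; rewrite /iloc /loc /= mulr0.
rewrite cabs_real; under eq_fun do rewrite E.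
rewrite -ler_pdivlMr//; apply: le_trans h _.
by rewrite le_eqVlt; apply/orP; left; apply/eqP; rewrite -/S; ring.
Qed.

End SymbolEstimates.

(** * Quantized operators *)

Section Bornology.
Variable R : realType.

(* [zt t] stands for a family dilated by the factor [t]. *)
Lemma sn_continuous_dilation (X Y : zmodType) (I J : eqType) (D : set X)
    (p : I -> X -> R) (q : J -> Y -> R) (f : X -> Y) (T : Type) (zt : R -> T -> X) :
  sn_continuous D p q f -> D 0 -> (forall t k, 0 < t -> D (zt t k)) ->
  (forall i, exists M, forall t k, 0 < t -> p i (zt t k) <= t * M) ->
  forall j e, 0 < e ->
    exists2 t, 0 < t & forall k, q j (f (zt t k) - f 0) < e.
Proof.
move=> cf D0 Dz hp j e e0; have [s [d [d0 hd]]] := cf 0 D0 j e e0.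
have [M M0 hM] : exists2 M, 0 <= M & forall i, i \in s -> forall t k, 0 < t ->
    p i (zt t k) <= t * M.
  elim: s {hd} => [|i s [M M0 hM]]; first by exists 0.
  have [M' hM'] := hp i; exists (Num.max M M'); first by rewrite le_max M0.
  move=> i'; rewrite in_cons => /orP[/eqP -> t k t0|i's t k t0].
    by rewrite (le_trans (hM' t k t0))// ler_pM2l// le_max lexx orbT.
  by rewrite (le_trans (hM i' i's t k t0))// ler_pM2l// le_max lexx.
have M1 : 0 < M + 1 by rewrite ltr_wpDl.
(* Continuity at 0 involves finitely many seminorms, all at most [t * M] on the dilated family; this
   [t] brings them below [d]. *)
have t0 : 0 < d / (M + 1) by rewrite divr_gt0.
exists (d / (M + 1)) => // k; apply: hd; first exact: Dz.
move=> i /hM/(_ _ k t0) h; rewrite subr0 (le_lt_trans h)//.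
by rewrite mulrAC ltr_pdivrMr// ltr_pM2l// ltrDl.
Qed.

Lemma sn_continuous_comp (X Y Z : zmodType) (I J L : eqType) (D : set X) (E : set Y)
    (p : I -> X -> R) (q : J -> Y -> R) (o : L -> Z -> R) (f : X -> Y) (g : Y -> Z) :
  sn_continuous D p q f -> (forall x, D x -> E (f x)) -> sn_continuous E q o g ->
  sn_continuous D p o (fun x => g (f x)).
Proof.
move=> cf DE cg x Dx l e e0; have [s [d [d0 hd]]] := cg _ (DE _ Dx) l e e0.
have [s' [d' [d'0 hd']]] : exists (s' : seq I) d', 0 < d' /\ forall y, D y ->
    (forall i, i \in s' -> p i (y - x) < d') ->
    forall j, j \in s -> q j (f y - f x) < d.
  elim: s {hd} => [|j s [s' [d' [d'0 h']]]]; first by exists [::], 1.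
  have [s2 [d2 [d20 h2]]] := cf x Dx j d d0.
  exists (s' ++ s2), (Num.min d' d2); split; first by rewrite lt_min d'0.
  move=> y Dy hy i; rewrite in_cons => /orP[/eqP ->|is'].
    apply: h2 => // k ks; have := hy k; rewrite mem_cat ks orbT => /(_ isT).
    by rewrite lt_min => /andP[].
  apply: h' is' => // k ks; have := hy k; rewrite mem_cat ks => /(_ isT).
  by rewrite lt_min => /andP[].
exists s', d'; split=> // y Dy hy; apply: hd; first exact: DE.
exact: hd'.
Qed.

Variables (n r : nat) (V : orth_bundle R n r) (pu : pou V).
Implicit Types (a b : symb V) (m : R).

Definition dil (t : R) a : symb V := fun v => t%:C%C * a v.

Lemma dil_inS m t a : inS pu m a -> inS pu m (dil t a).
Proof. exact: inSZ. Qed.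

Lemma symb_sn_undil m st t a C : 0 < t -> inS pu m a ->
  symb_sn pu m st (dil t a) <= C -> symb_sn pu m st a <= t^-1 * C.
Proof.
move=> t0 ma h; have tt : t^-1%:C%C * t%:C%C = 1 :> R[i].
  by rewrite -rmorphM /= mulVf ?gt_eqF.
have -> : a = dil t^-1 (dil t a).
  by apply/funext => v; rewrite /dil mulrA tt mul1r.
rewrite (le_trans (symb_snZ _ _ (dil_inS _ ma)))// ?invr_ge0 ?(ltW t0)//.
by rewrite ler_wpM2l ?invr_ge0 ?(ltW t0).
Qed.

Lemma dil_sn_le (I : Type) m st (a : I -> symb V) : symb_bounded pu m a ->
  exists M, forall (t : R) i, 0 < t -> symb_sn pu m st (dil t (a i)) <= t * M.
Proof.
move=> ba; have [M M0 hM] := symb_bounded_sn st ba; exists M => t i t0.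
rewrite (le_trans (symb_snZ st (ltW t0) (symb_bounded_inS i ba)))//.
by rewrite ler_pM2l.
Qed.

(** Dilate both arguments until continuity at 0 bounds the chosen seminorm of the value by 1, then
    undo the resulting factor [t ^+ 2]. *)
Lemma symb_bounded_bilinear (I : Type) m m' m'' (F : symb V -> symb V -> symb V)
    (a b : I -> symb V) :
  (forall a b, inS pu m a -> inS pu m' b -> inS pu m'' (F a b)) ->
  sn_continuous (inS pu m `*` inS pu m') (sn_prod (symb_sn pu m) (symb_sn pu m'))
    (symb_sn pu m'') (fun z => F z.1 z.2) ->
  F 0 0 = 0 ->
  (forall t a b, inS pu m a -> inS pu m' b ->
     F (dil t a) (dil t b) = dil (t ^+ 2) (F a b)) ->
  symb_bounded pu m a -> symb_bounded pu m' b ->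
  symb_bounded pu m'' (fun i => F (a i) (b i)).
Proof.
move=> inF cF F0 Fdil ba bb.
have ma i := symb_bounded_inS i ba; have mb i := symb_bounded_inS i bb.
apply: symb_bounded_of_sn => [i|st]; first exact: inF.
have [||i|t t0 ht] := @sn_continuous_dilation _ _ _ _ _ _ _ _ I
  (fun t i => (dil t (a i), dil t (b i))) cF _ _ _ st 1 ltr01.
- by split; exact: inS0.
- by move=> t i t0; split; exact: dil_inS.
- case: i => st'; first by have [M hM] := dil_sn_le st' ba; exists M.
  by have [M hM] := dil_sn_le st' bb; exists M.
exists ((t ^+ 2)^-1 * 1) => i; apply: symb_sn_undil; rewrite ?exprn_gt0//.
  exact: inF.
rewrite -Fdil// ltW//; have := ht i; rewrite /= F0 subr0; exact.
Qed.

End Bornology.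

(** * Consequences of the axioms *)

Section Quantization.
Variables (R : realType) (n r : nat) (V : orth_bundle R n r).
Variables (g : rmetric V) (nab : oconnection V) (pu : pou V).
Variables (H : hilbert R).
Variables (W : nat -> set (H -> H)) (wsn : nat -> nat -> (H -> H) -> R).
Variables (P : symb V -> symb V -> symb V) (q : symb V -> H -> H).
Hypothesis (hcut : uniform_cutoffs pu) (hmult : uniform_multiplicity pu).
Hypothesis hax : quantization_axioms g nab pu W wsn P q.
Implicit Types (a b : symb V) (m : R) (x y : H) (T S : H -> H).

Local Notation D := (WH W).
Local Notation Sinf := (inS_infty pu).

Lemma inS_inf m a : inS pu m a -> Sinf a.
Proof. by exists m. Qed.

Lemma inS_inf_lin (k : R[i]) a b : Sinf a -> Sinf b -> Sinf (fun v => k * a v + b v).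
Proof.
move=> [m ma] [m' mb]; exists (Num.max m m'); apply: inS_lin.
  by apply: inS_le ma; rewrite le_max lexx.
by apply: inS_le mb; rewrite le_max lexx orbT.
Qed.

Lemma inS1 : inS pu 0 (fun=> 1).
Proof. exact: symb_bounded_inS tt (symb_bounded1 unit hcut). Qed.

Lemma W_subspace k : (0 < k)%N -> is_subspace (W k).
Proof. by case: hax => -[[/(_ k) h _ _ _ _] _ _] _ /h[]. Qed.

Lemma W_bounded k T : (0 < k)%N -> W k T -> bounded_op T.
Proof. by case: hax => -[[_ _ _ /(_ k) h _] _ _] _ k0; have [h' _] := h k0; exact: h'. Qed.

Lemma W_le k l : (0 < k)%N -> (k <= l)%N -> W k `<=` W l.
Proof.
move=> k0; elim: l => [|l IH]; first by rewrite leqn0 => /eqP k00; rewrite k00 in k0.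
rewrite leq_eqVlt => /orP[/eqP ->//|kl] T /(IH kl) WT.
case: hax => -[[_ /(_ l) h _ _ _] _ _] _.
by have [] := h (leq_trans k0 kl) => h' _ _ _; exact: h'.
Qed.

Lemma W_comp k l T S : (0 < k)%N -> (0 < l)%N -> W k T -> W l S -> W (k + l)%N (T \o S).
Proof.
by case: hax => -[[_ _ /(_ k l) h _ _] _ _] _ k0 l0; have [h' _] := h k0 l0; exact: h'.
Qed.

Lemma W_star k T : (0 < k)%N -> W k T -> exists2 S, W k S & adjoint T S.
Proof.
case: hax => -[[_ _ _ _ [star hs]] _ _] _ k0 WT.
have [h1 h2 _] := hs k k0; exists (star T); last exact: h1.
by rewrite -h2; exists T.
Qed.

Lemma adjointC T S : adjoint T S -> adjoint S T.
Proof. by move=> h x y; rewrite hip_conj -h -hip_conj. Qed.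

Lemma WH_W k T x : (0 < k)%N -> W k T -> D (T x).
Proof.
move=> k0 WT; exists 1%N, (fun=> T), (fun=> x); split; first by move=> _; exists k.
by rewrite big_ord_recl big_ord0 addr0.
Qed.

Lemma WH_hsub : hsub D.
Proof.
split.
  exists 0%N, (fun=> id), (fun=> 0); split; first by case.
  by rewrite big_ord0.
move=> k _ _ [N [T [xi [WT ->]]]] [M [S [eta [WS ->]]]].
exists (N + M)%N, (fun i => match fintype.split i with inl i => T i | inr i => S i end),
  (fun i => match fintype.split i with inl i => k *: xi i | inr i => eta i end).
split; first by move=> i; case: fintype.split.
rewrite big_split_ord /= scaler_sumr; congr (_ + _); apply: eq_bigr => i _.
  rewrite (unsplitK (inl i)); have [l l0 Wl] := WT i.
  by rewrite (linear_onZ _ (@hsubT _ _) (bounded_lin (W_bounded l0 Wl))).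
by rewrite (unsplitK (inr i)).
Qed.

(** If [v] is orthogonal to the domain, the injective symmetric [T] of axiom (ii) satisfies
    [hip z (T v) = hip (T z) v = 0] for all [z], so [T v = 0] and [v = 0]. *)
Lemma WH_dense : dense_in D.
Proof.
apply: dense_orth WH_hsub _ => v hv.
case: hax => -[_ [T [WT adj injT]] _] _.
apply: injT; rewrite (linear_on0 (@hsubT _ _) (bounded_lin (W_bounded (isT : 0 < 1)%N WT))).
apply: hip_inj => z; rewrite -adj hip0r; apply: hv; exact: WH_W (isT : 0 < 1)%N WT.
Qed.

Lemma q_linear a : Sinf a -> linear_on D (q a).
Proof. by case: hax => -[_ _ [h _ _ _ _]] _; exact: h. Qed.

Lemma q_lin (k : R[i]) a b x : Sinf a -> Sinf b -> D x ->
  q (fun v => k * a v + b v) x = k *: q a x + q b x.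
Proof. by case: hax => -[_ _ [_ h _ _ _]] _ sa sb; exact: h. Qed.

Lemma q1 x : D x -> q (fun=> 1) x = x.
Proof. by case: hax => -[_ _ [_ _ h _ _]] _; exact: h. Qed.

Lemma Sinf0 : Sinf (fun=> 0).
Proof. exact: inS_inf (@inS0 _ _ _ _ _ 0). Qed.

Lemma q0 x : D x -> q (fun=> 0) x = 0.
Proof.
move=> Dx; have := q_lin (-1) Sinf0 Sinf0 Dx.
by under eq_fun do rewrite mulr0 addr0; rewrite scaleN1r addNr.
Qed.

Lemma qZ (k : R[i]) a x : Sinf a -> D x -> q (fun v => k * a v) x = k *: q a x.
Proof.
move=> sa Dx; have := q_lin k sa Sinf0 Dx.
by under eq_fun do rewrite addr0; rewrite q0// addr0.
Qed.

Lemma qD a b x : Sinf a -> Sinf b -> D x -> q (fun v => a v + b v) x = q a x + q b x.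
Proof.
move=> sa sb Dx; have := q_lin 1 sa sb Dx.
by under eq_fun do rewrite mul1r; rewrite scale1r.
Qed.

Lemma q_W m a k T : inS pu m a -> (0 < k)%N -> W k T -> W k.+1 (q a \o T).
Proof. by case: hax => _ [h _ _] ma k0; exact: (h m). Qed.

Lemma q_D a x : Sinf a -> D x -> D (q a x).
Proof.
move=> sa [N [T [xi [WT ->]]]].
rewrite (linear_on_sum _ WH_hsub (q_linear sa)); last first.
  by move=> i; have [k k0 Wk] := WT i; exact: WH_W Wk.
apply: hsub_sum WH_hsub _ => i; have [k k0 Wk] := WT i; have [m ma] := sa.
exact: (@WH_W k.+1 (q a \o T i)) (q_W ma k0 Wk).
Qed.

Lemma inS_inf_conj a : Sinf a -> Sinf (fun v => (a v)^*%C).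
Proof. by move=> [m ma]; exists m; exact: inS_conj. Qed.

(** Axiom (iii) gives symmetry for real symbols only; the general case splits [a] into real and
    imaginary parts, which are symbols as combinations of [a] and its conjugate. *)
Lemma q_adjoint a x y : Sinf a -> D x -> D y ->
  hip (q a x) y = hip x (q (fun v => (a v)^*%C) y).
Proof.
move=> sa Dx Dy.
case: hax => -[_ _ [_ _ _ hsym _]] _.
pose ar v := (complex.Re (a v))%:C%C; pose ai v := (complex.Im (a v))%:C%C.
have sc := inS_inf_conj sa.
have sar : Sinf ar.
  have := inS_inf_lin (2^-1) sc (inS_inf_lin (2^-1) sa Sinf0).
  rewrite (_ : (fun v => _) = ar)//; apply/funext => v; rewrite /ar addr0 -mulrDr.
  have E (z : R[i]) : 2^-1 * (z^*%C + z) = (complex.Re z)%:C%C.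
    case: z => t u; have h : (2 : R[i]) = (2 : R)%:C%C by rewrite rmorph_nat.
    rewrite h -fmorphV /=; apply/eqP; rewrite eq_complex /=; apply/andP.
    by split; apply/eqP; field.
  exact: E.
have sai : Sinf ai.
  have := inS_inf_lin (- 'i%C) sa (inS_inf_lin ('i%C) sar Sinf0).
  rewrite (_ : (fun v => _) = ai)//; apply/funext => v; rewrite /ai /ar addr0.
  by case: (a v) => t u; apply/eqP; rewrite eq_complex /=; apply/andP; split; apply/eqP; ring.
have rar : real_symb ar by [].
have rai : real_symb ai by [].
have ea : a = (fun v => 'i%C * ai v + ar v).
  by apply/funext => v; rewrite /ai /ar; case: (a v) => t u; apply/eqP;
    rewrite eq_complex /=; apply/andP; split; apply/eqP; ring.
have ec : (fun v => (a v)^*%C) = (fun v => (- 'i%C) * ai v + ar v).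
  by apply/funext => v; rewrite /ai /ar; case: (a v) => t u; apply/eqP;
    rewrite eq_complex /=; apply/andP; split; apply/eqP; ring.
rewrite ec {1}ea !q_lin// hipDl hipDr hipZl hipZr (hsym ar)// (hsym ai)//.
congr (_ * _ + _); apply/eqP; rewrite eq_complex /=; apply/andP; split; apply/eqP; ring.
Qed.

Lemma P_inf a b : Sinf a -> Sinf b -> Sinf (P a b).
Proof. by case: hax => _ [_ [[h _] _ _ _ _] _] sa; exact: h. Qed.

Lemma P_lin (k : R[i]) a a' b : Sinf a -> Sinf a' -> Sinf b ->
  P (fun v => k * a v + a' v) b = (fun v => k * P a b v + P a' b v) /\
  P b (fun v => k * a v + a' v) = (fun v => k * P b a v + P b a' v).
Proof. by case: hax => _ [_ [[_ h] _ _ _ _] _] sa sa' sb; exact: h. Qed.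

Lemma P0 b : Sinf b -> P 0 b = 0 /\ P b 0 = 0.
Proof.
move=> sb; have [h1 h2] := P_lin (-1) Sinf0 Sinf0 sb.
have e : (fun _ : tot V => -1 * 0 + 0 : R[i]) = 0 by apply/funext => v; rewrite mulr0 addr0.
split.
  by move: h1; rewrite e => ->; apply/funext => v; rewrite mulN1r addNr.
by move: h2; rewrite e => ->; apply/funext => v; rewrite mulN1r addNr.
Qed.

Lemma P_dil t a b : Sinf a -> Sinf b -> P (dil t a) (dil t b) = dil (t ^+ 2) (P a b).
Proof.
move=> sa sb.
have e c : dil t c = (fun v => t%:C%C * c v + (0 : symb V) v).
  by apply/funext => v; rewrite /dil addr0.
have sdb : Sinf (dil t b) by case: sb => m mb; exists m; exact: dil_inS.
rewrite {1}e (P_lin _ sa Sinf0 sdb).1 (P0 sdb).1 e (P_lin _ sb Sinf0 sa).2 (P0 sa).2.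
apply/funext => v; rewrite /dil expr2 rmorphM /=.
by rewrite !addr0 mulrA.
Qed.

Lemma P_bounded (I : Type) m m' (a b : I -> symb V) :
  symb_bounded pu m a -> symb_bounded pu m' b ->
  symb_bounded pu (m + m') (fun i => P (a i) (b i)).
Proof.
have [hP cP] : (forall a b, inS pu m a -> inS pu m' b -> inS pu (m + m') (P a b)) /\
    sn_continuous (inS pu m `*` inS pu m')
      (sn_prod (symb_sn pu m) (symb_sn pu m')) (symb_sn pu (m + m'))
      (fun z => P z.1 z.2) by case: hax => _ [_ [_ _ h _ _] _]; exact: h.
apply: symb_bounded_bilinear => //; first by have [] := P0 Sinf0.
by move=> t a' b' ma mb; apply: P_dil; [exact: inS_inf ma|exact: inS_inf mb].
Qed.

Lemma P_sub_bounded (I : Type) m m' (a b : I -> symb V) :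
  symb_bounded pu m a -> symb_bounded pu m' b ->
  symb_bounded pu (m + m' - 1) (fun i v => P (a i) (b i) v - a i v * b i v).
Proof.
have [hP cP] : (forall a b, inS pu m a -> inS pu m' b ->
      inS pu (m + m' - 1) (fun v => P a b v - a v * b v)) /\
    sn_continuous (inS pu m `*` inS pu m')
      (sn_prod (symb_sn pu m) (symb_sn pu m')) (symb_sn pu (m + m' - 1))
      (fun z => (fun v => P z.1 z.2 v - z.1 v * z.2 v))
  by case: hax => _ [_ [_ _ _ _ h] _]; exact: h.
apply: (symb_bounded_bilinear (F := fun a b v => P a b v - a v * b v)) => //.
  by apply/funext => v; rewrite (P0 Sinf0).1 mulr0 subr0.
move=> t a' b' ma mb; rewrite P_dil; [|exact: inS_inf ma|exact: inS_inf mb].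
by apply/funext => v; rewrite /dil expr2 rmorphM /=; ring.
Qed.

(* [a b] is the difference of [P(a, b)] and [P(a, b) - a b], so neither the
   Leibniz rule nor a change of charts is needed. *)
Lemma mul_bounded (I : Type) m m' (a b : I -> symb V) :
  symb_bounded pu m a -> symb_bounded pu m' b ->
  symb_bounded pu (m + m') (fun i v => a i v * b i v).
Proof.
move=> ba bb.
have h : symb_bounded pu (m + m') (fun i v => P (a i) (b i) v - a i v * b i v).
  by apply: symb_bounded_le (P_sub_bounded ba bb); rewrite gerBl.
have := symb_boundedB (P_bounded ba bb) h.
by under eq_fun do under eq_fun do rewrite opprB addrC subrK.
Qed.

Lemma exp_bounded (I : Type) (a : I -> symb V) k :
  symb_bounded pu 0 a -> symb_bounded pu 0 (fun i v => a i v ^+ k).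
Proof.
move=> ba; elim: k => [|k IH].
  by under eq_fun do under eq_fun do rewrite expr0; exact: symb_bounded1.
under eq_fun do under eq_fun do rewrite exprS.
by rewrite -(addr0 0); exact: mul_bounded.
Qed.

(** * Boundedness by order of the symbol *)

Definition q_bounded (I : Type) (a : I -> symb V) :=
  exists C, forall i x, D x -> hnorm (q (a i) x) <= C * hnorm x.

(** The index type is arbitrary: [unit] serves a single symbol, [nat] the sequence built in the
    proof of continuity. *)
Definition order_bounded m := forall (I : Type) (a : I -> symb V),
  symb_bounded pu m a -> q_bounded a.

Lemma order_bounded_le m m' : m' <= m -> order_bounded m -> order_bounded m'.
Proof. by move=> mm h I a /(symb_bounded_le mm); exact: h. Qed.

(** The remainder depends continuously on the symbols with values in [W 1], which embeds
    continuously into the bounded operators; dilation makes the bound uniform over the family. *)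
Lemma composition_remainder (I : Type) m m' (a b : I -> symb V) :
  symb_bounded pu m a -> symb_bounded pu m' b ->
  exists2 C, 0 <= C & forall i x, D x ->
    hnorm (q (a i) (q (b i) x) - q (P (a i) (b i)) x) <= C * hnorm x.
Proof.
move=> ba bb.
have [K [hK cK]] : exists K : symb V -> symb V -> H -> H,
    (forall a b, Sinf a -> Sinf b -> W 1 (K a b) /\
       forall x, D x -> K a b x = q a (q b x) - q (P a b) x) /\
    (forall m m' : R, sn_continuous (inS pu m `*` inS pu m')
         (sn_prod (symb_sn pu m) (symb_sn pu m')) (wsn 1) (fun z => K z.1 z.2)).
  by case: hax => _ [_ [_ h _ _ _] _]; exact: h.
have ma i := symb_bounded_inS i ba; have mb i := symb_bounded_inS i bb.
have [W0 _] := W_subspace (isT : (0 < 1)%N).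
have cop : sn_continuous (W 1) (wsn 1) (@opnorm_sn R H) id.
  by case: hax => -[[_ _ _ /(_ 1%N isT)[_ h] _] _ _] _; exact: h.
have cK' := sn_continuous_comp (cK m m') (fun z hz => (hK _ _ (inS_inf hz.1) (inS_inf hz.2)).1) cop.
have [||i|t t0 ht] := @sn_continuous_dilation _ _ _ _ _ _ _ _ _ I
  (fun t i => (dil t (a i), dil t (b i))) cK' _ _ _ tt 1 ltr01.
- by split; exact: inS0.
- by move=> t i t0; split; exact: dil_inS.
- case: i => st'; first by have [M hM] := dil_sn_le st' ba; exists M.
  by have [M hM] := dil_sn_le st' bb; exists M.
exists ((t ^+ 2)^-1); first by rewrite invr_ge0 sqr_ge0.
move=> i x Dx.
have sa := inS_inf (ma i); have sb := inS_inf (mb i).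
have sda : Sinf (dil t (a i)) := inS_inf (dil_inS t (ma i)).
have sdb : Sinf (dil t (b i)) := inS_inf (dil_inS t (mb i)).
have [WK KE] := hK _ _ sda sdb; have [W00 K0E] := hK _ _ Sinf0 Sinf0.
have bS : bounded_op (K (dil t (a i)) (dil t (b i)) - K 0 0).
  apply: (@W_bounded 1) => //; have [_ hW] := W_subspace (isT : (0 < 1)%N).
  by have := hW (-1) _ _ W00 WK; rewrite scaleN1r addrC.
have := ht i; rewrite /opnorm_sn /= => /ltW h.
have := le_trans (opnorm_le x bS) (ler_wpM2r (hnorm_ge0 x) h).
have -> : (K (dil t (a i)) (dil t (b i)) - K 0 0) x =
    (t ^+ 2)%:C%C *: (q (a i) (q (b i) x) - q (P (a i) (b i)) x).
  rewrite -[LHS]/(K (dil t (a i)) (dil t (b i)) x - K 0 0 x) KE// K0E//.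
  rewrite !q0//; last exact: WH_hsub.1.
  rewrite (P0 Sinf0).1 q0// subrr subr0 (P_dil _ sa sb).
  rewrite (qZ _ sb Dx) (qZ _ (P_inf sa sb) Dx).
  rewrite (linear_onZ _ WH_hsub (q_linear sda))//; last exact: q_D.
  rewrite (qZ _ sa (q_D sb Dx)) scalerA scalerBr; congr (_ *: _ - _).
  by rewrite expr2 rmorphM.
rewrite hnormZ cabs_real ger0_norm ?sqr_ge0// mul1r.
by rewrite -ler_pdivlMl ?exprn_gt0.
Qed.

(** A continuous seminorm is bounded on bounded families: if [p] is below 1 on the family dilated by
    [t], it is at most [t^-1] on the family itself. *)
Lemma order_bounded_base : exists2 d : R, 0 < d & order_bounded (- d - 1).
Proof.
case: hax => _ [_ _ [d [p [d0 [[p0 pZ pD] cp] hp]]]]; exists d => // I a ba.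
have ma i := symb_bounded_inS i ba.
have p00 : p 0 = 0.
  by have := pZ 0 0 (@inS0 _ _ _ _ pu (- d - 1)); rewrite scale0r cabs0 mul0r.
have [||st|t t0 ht] := @sn_continuous_dilation _ _ _ _ _ _ _ _ _ I
  (fun t i => dil t (a i)) cp _ _ _ tt 1 ltr01.
- exact: inS0.
- by move=> t i t0; exact: dil_inS.
- exact: dil_sn_le.
exists t^-1 => i x Dx; have [S [bS SE] hS] := hp _ (ma i).
rewrite -SE//; apply: le_trans (opnorm_le x bS) _; rewrite ler_wpM2r ?hnorm_ge0//.
apply: le_trans hS _; have := ht i; rewrite /abs_sn p00 subr0 => /ltW.
have -> : p (dil t (a i)) = t * p (a i).
  by rewrite -[dil t _]/(t%:C%C *: a i) pZ// cabs_real gtr0_norm.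
rewrite ger0_norm ?mulr_ge0 ?(ltW t0) ?p0//.
by rewrite -ler_pdivlMl// mulr1.
Qed.

Lemma q_square a x : Sinf a -> D x ->
  hnorm (q a x) ^+ 2 = rip (q (fun v => (a v)^*%C) (q a x)) x.
Proof.
move=> sa Dx; rewrite hnorm_sqr /rip.
have := q_adjoint (inS_inf_conj sa) (q_D sa Dx) Dx.
rewrite (_ : (fun v => ((a v)^*)^*%C) = a); last first.
  by apply/funext => v; case: (a v) => t u; rewrite /= opprK.
by move=> ->.
Qed.

(** The squared norm of [q a x] is the pairing of [q (conj a) (q a x)] with [x]; up to a bounded
    remainder that operator quantizes a symbol of order [m + m]. *)
Lemma order_bounded_half m : order_bounded (m + m) -> order_bounded m.
Proof.
move=> h I a ba; have bc := symb_bounded_conj ba.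
have [C1 h1] := h _ _ (P_bounded bc ba).
have [C2 C20 h2] := composition_remainder bc ba.
(* The square of the norm is bounded with [w = |C1| + C2], and [w <= (w + 1)^2] avoids a square
   root. *)
exists (`|C1| + C2 + 1) => i x Dx; have sa := inS_inf (symb_bounded_inS i ba).
rewrite -(@ler_pXn2r _ 2)// ?nnegrE ?mulr_ge0 ?addr_ge0 ?hnorm_ge0//.
rewrite q_square// -[q _ (q _ _)](subrK (q (P (fun v => (a i v)^*%C) (a i)) x)) ripDl.
have t2 := le_trans (rip_le (q (fun v => (a i v)^*%C) (q (a i) x) -
  q (P (fun v => (a i v)^*%C) (a i)) x) x) (ler_wpM2r (hnorm_ge0 x) (h2 i x Dx)).
have t1 := le_trans (rip_le (q (P (fun v => (a i v)^*%C) (a i)) x) x)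
  (ler_wpM2r (hnorm_ge0 x) (h1 i x Dx)).
have t3 : C1 * hnorm x * hnorm x <= `|C1| * hnorm x * hnorm x.
  by rewrite !ler_wpM2r ?hnorm_ge0// ler_norm.
apply: le_trans (lerD t2 t1) _; rewrite addrC.
apply: le_trans (lerD t3 (lexx _)) _.
rewrite -!mulrDl -mulrA -expr2 exprMn ler_wpM2r ?sqr_ge0//.
have : 0 <= `|C1| + C2 by exact: addr_ge0.
by move: (`|C1| + C2) => w w0; nra.
Qed.

(** Doubling a negative order [k] times reaches [- d - 1] or below as soon as [2 ^ k] exceeds
    [(d + 1) / - m]; the halving step then leads back to [m]. *)
Lemma order_bounded_neg m : m < 0 -> order_bounded m.
Proof.
move=> m0; have [d d0 hd] := order_bounded_base.
have key k : order_bounded (m *+ 2 ^ k) -> order_bounded m.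
  elim: k => [//|k IH h]; apply: IH; apply: order_bounded_half.
  by rewrite -mulrnDr addnn -mul2n -expnS.
pose k := Num.bound ((d + 1) / - m).
apply: (key k); apply: order_bounded_le hd.
have : (d + 1) / - m < k%:R by rewrite archi_boundP// divr_ge0 ?addr_ge0 ?oppr_ge0 ?ltW.
rewrite ltr_pdivrMr ?oppr_gt0// => h.
have : (k%:R : R) <= (2 ^ k)%:R by rewrite ler_nat ltnW// ltn_expl.
rewrite -mulr_natl => h2; nra.
Qed.

(* Hormander's square root trick: after a dilation [|a| <= 1/2], and then
   [q(b)^2 + q(a)^* q(a) - 1] has order [-1] for [b = sqrt (1 - |a|^2)]. *)
Lemma order_bounded0 : order_bounded 0.
Proof.
move=> I a0 ba0; have [C hC] := symb_bounded_sup hmult ba0.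
(* This factor yields [|a| <= 1/2], hence [1 - |a|^2 >= 3/4], safely above the threshold 1/2 under
   which the square root is estimated. *)
pose s := (2 * (`|C| + 1))^-1.
have s0 : 0 < s by rewrite invr_gt0 mulr_gt0 ?ltr_wpDl.
pose a i := dil s (a0 i).
have ba : symb_bounded pu 0 a := symb_boundedZ s%:C%C ba0.
have a12 i v : cabs (a i v) <= 2^-1.
  rewrite /a /dil cabsM cabs_real gtr0_norm// /s invfM -mulrA ler_piMr//.
  rewrite mulrC ler_pdivrMr ?ltr_wpDl// mul1r.
  by rewrite (le_trans (hC i v))// (le_trans (ler_norm _))// lerDl.
suff [C' hC'] : q_bounded a.
  exists (s^-1 * C') => i x Dx; have sa := inS_inf (symb_bounded_inS i ba0).
  have := hC' i x Dx; rewrite /a /dil qZ// hnormZ cabs_real gtr0_norm//.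
  by rewrite -mulrA ler_pdivlMl.
have bc := symb_bounded_conj ba.
pose aa i : symb V := fun v => (a i v)^*%C * a i v.
have baa : symb_bounded pu 0 aa by rewrite -(addr0 0); exact: mul_bounded.
have b1 : symb_bounded pu 0 (fun (_ : I) (_ : tot V) => 1) := symb_bounded1 I hcut.
pose u i : symb V := fun v => 1 - aa i v.
have bu : symb_bounded pu 0 u := symb_boundedB b1 baa.
have aaE i v : aa i v = (cabs (a i v) ^+ 2)%:C%C.
  rewrite /aa cabs_sqr; case: (a i v) => t w; apply/eqP; rewrite eq_complex /=.
  by apply/andP; split; apply/eqP; ring.
have hu i v : complex.Im (u i v) = 0 /\ 2^-1 <= complex.Re (u i v) <= 1.
  rewrite /u aaE /=; split; first by rewrite subr0.
  have := a12 i v; have := cabs_ge0 (a i v); move: (cabs _) => t t0 t2.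
  by apply/andP; split; nra.
have h20 : (0 : R) < 2^-1 by rewrite invr_gt0.
pose b i : symb V := fun v => (Num.sqrt (complex.Re (u i v)))%:C%C.
have bb : symb_bounded pu 0 b.
  by apply: (symb_bounded_sqrt h20 hu) => k; exact: exp_bounded.
have bbE i v : b i v * b i v + (a i v)^*%C * a i v = 1.
  rewrite -[_^*%C * _]/(aa i v) /b -rmorphM /= -expr2 sqr_sqrtr; last first.
    by have [_ /andP[h _]] := hu i v; exact: le_trans (ltW h20) h.
  rewrite /u aaE; apply/eqP; rewrite eq_complex /=; apply/andP; split; apply/eqP; ring.
(* The failure of [P] to be the pointwise product, for both pairs together. Since the pointwise
   products add up to 1, the two values of [P] add up to [1 + c], with [c] of order -1. *)
pose c i : symb V := fun v => (P (b i) (b i) v - b i v * b i v) +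
  (P (fun v => (a i v)^*%C) (a i) v - (a i v)^*%C * a i v).
have bcc : symb_bounded pu (0 + 0 - 1) c.
  exact: symb_boundedD (P_sub_bounded bb bb) (P_sub_bounded bc ba).
have [C1 h1] : q_bounded c by apply: order_bounded_neg bcc; lra.
have [C2 C20 h2] := composition_remainder bb bb.
have [C3 C30 h3] := composition_remainder bc ba.
exists (1 + `|C1| + C2 + C3) => i x Dx.
have sa := inS_inf (symb_bounded_inS i ba).
have sb := inS_inf (symb_bounded_inS i bb).
have sc := inS_inf (symb_bounded_inS i bcc).
have sac := inS_inf_conj sa.
have br : (fun v => (b i v)^*%C) = b i.
  by apply/funext => v; rewrite /b /= oppr0.
have eP : q (P (b i) (b i)) x + q (P (fun v => (a i v)^*%C) (a i)) x = x + q (c i) x.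
  rewrite -qD//; [|exact: P_inf|exact: P_inf].
  rewrite -[X in _ = X + _](q1 Dx) -qD//; last exact: inS_inf inS1.
  congr (q _ x); apply/funext => v; rewrite /c -(bbE i v); ring.
have ea := q_square sa Dx; have eb := q_square sb Dx; rewrite br in eb.
rewrite -(@ler_pXn2r _ 2)// ?nnegrE ?mulr_ge0 ?addr_ge0 ?hnorm_ge0//.
have eb0 : 0 <= hnorm (q (b i) x) ^+ 2 by rewrite sqr_ge0.
set y1 := q (b i) (q (b i) x) in eb; set y2 := q _ (q (a i) x) in ea.
set z1 := q (P (b i) (b i)) x in eP; set z2 := q (P _ _) x in eP.
have r1 : rip y1 x = rip (y1 - z1) x + rip z1 x by rewrite -ripDl subrK.
have r2 : rip y2 x = rip (y2 - z2) x + rip z2 x by rewrite -ripDl subrK.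
have r3 : rip z1 x + rip z2 x = hnorm x ^+ 2 + rip (q (c i) x) x.
  by rewrite -ripDl eP ripDl hnorm_sqr.
have t1 := le_trans (rip_le (y1 - z1) x) (ler_wpM2r (hnorm_ge0 x) (h2 i x Dx)).
have t2 := le_trans (rip_le (y2 - z2) x) (ler_wpM2r (hnorm_ge0 x) (h3 i x Dx)).
have t3 := le_trans (rip_le (q (c i) x) x) (ler_wpM2r (hnorm_ge0 x) (h1 i x Dx)).
have X0 := hnorm_ge0 x.
have t4 : C1 * hnorm x * hnorm x <= `|C1| * hnorm x * hnorm x.
  by rewrite !ler_wpM2r// ler_norm.
have : hnorm (q (a i) x) ^+ 2 <= (1 + `|C1| + C2 + C3) * hnorm x ^+ 2.
  rewrite expr2 in r3; rewrite [in leRHS]expr2 !mulrDl !mulrA !mul1r; lra.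
move/le_trans; apply; rewrite exprMn ler_wpM2r ?sqr_ge0//.
have : 0 <= `|C1| + C2 + C3 by rewrite !addr_ge0.
rewrite -!addrA; move: (`|C1| + _) => w w0; nra.
Qed.

Lemma q_extension a : inS pu 0 a -> exists S, extends_to D (q a) S.
Proof.
move=> ma; have [C hC] := order_bounded0 (inS_bounded ma).
have [S SE _] := bounded_extension WH_hsub WH_dense (q_linear (inS_inf ma)) (hC tt).
by exists S.
Qed.

Lemma extension_unique T S S' : extends_to D T S -> extends_to D T S' -> S = S'.
Proof.
by move=> [bS SE] [bS' SE']; apply: bounded_dense_eq WH_dense bS bS' _ => x Dx;
  rewrite SE ?SE'.
Qed.

(** * Continuity of the extended quantization *)

Section Extension.
Variable Q : symb V -> H -> H.
Hypothesis hQ : forall a, inS pu 0 a -> extends_to D (q a) (Q a).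

Lemma Q_lin (k : R[i]) a b : inS pu 0 a -> inS pu 0 b ->
  Q (fun v => k * a v + b v) = (fun x => k *: Q a x + Q b x).
Proof.
move=> ma mb; have [ba aE] := hQ ma; have [bb bE] := hQ mb.
apply: extension_unique (hQ (inS_lin k ma mb)) _; split.
  case: (ba) (bb) => la [Ca hCa] [lb [Cb hCb]]; split.
    move=> l x y; rewrite la lb !scalerDr !scalerA (mulrC k) -!addrA; congr (_ + _).
    by rewrite addrCA.
  exists (cabs k * Ca + Cb) => x; rewrite (le_trans (hnormD _ _))// mulrDl.
  by rewrite lerD// hnormZ -mulrA ler_wpM2l ?cabs_ge0.
by move=> x Dx; rewrite q_lin ?aE ?bE//; [exact: inS_inf ma|exact: inS_inf mb].
Qed.

Lemma QZ (k : R[i]) a : inS pu 0 a -> Q (fun v => k * a v) = (fun x => k *: Q a x).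
Proof.
move=> ma; have := Q_lin k ma (@inS0 _ _ _ _ pu 0).
under eq_fun do rewrite addr0; move=> ->; apply/funext => x.
have := Q_lin (-1) (@inS0 _ _ _ _ pu 0) (@inS0 _ _ _ _ pu 0).
rewrite (_ : (fun v => _) = fun=> 0); last by apply/funext => v; rewrite mulr0 addr0.
by move=> /funeqP/(_ x) ->; rewrite scaleN1r addNr addr0.
Qed.

Lemma QB a b : inS pu 0 a -> inS pu 0 b ->
  Q (fun v => a v - b v) = (fun x => Q a x - Q b x).
Proof.
move=> ma mb; have := Q_lin (-1) mb ma.
rewrite (_ : (fun v => _) = (fun v => a v - b v)); last first.
  by apply/funext => v; rewrite mulN1r addrC.
by move=> ->; apply/funext => x; rewrite scaleN1r addrC.
Qed.

Lemma opnorm_QZ (k : R[i]) a : inS pu 0 a ->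
  opnorm (Q (fun v => k * a v)) = cabs k * opnorm (Q a).
Proof.
move=> ma; have [ba _] := hQ ma.
have le l b : inS pu 0 b -> opnorm (Q (fun v => l * b v)) <= cabs l * opnorm (Q b).
  move=> mb; have [bb _] := hQ mb; have [bl _] := hQ (inSZ l mb).
  apply: opnorm_ub => //; first by rewrite mulr_ge0 ?cabs_ge0 ?opnorm_ge0.
  by move=> x; rewrite QZ// hnormZ -mulrA ler_wpM2l ?cabs_ge0// opnorm_le.
apply/eqP; rewrite eq_le le//=.
have [->|k0] := eqVneq k 0.
  by rewrite cabs0 mul0r opnorm_ge0//; have [] := hQ (inSZ 0 ma).
(* The reverse inequality is the one already shown, for the factor [k^-1] and the symbol [k a]. *)
have h := le k^-1 _ (inSZ k ma).
rewrite (_ : (fun v => _) = a) in h; last by apply/funext => v; rewrite mulKf.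
rewrite (le_trans (ler_wpM2l (cabs_ge0 k) h))// mulrA -cabsM mulfV//.
by rewrite -[1]/(1%:C%C) cabs_real normr1 mul1r.
Qed.

Lemma opnorm_QD a b : inS pu 0 a -> inS pu 0 b ->
  opnorm (Q (fun v => a v + b v)) <= opnorm (Q a) + opnorm (Q b).
Proof.
move=> ma mb; have [ba _] := hQ ma; have [bb _] := hQ mb.
have [bab _] := hQ (inSD ma mb).
apply: opnorm_ub => //; first by rewrite addr_ge0 ?opnorm_ge0.
move=> x; have := Q_lin 1 ma mb; under eq_fun do rewrite mul1r.
move=> ->; rewrite scale1r (le_trans (hnormD _ _))// mulrDl.
by rewrite lerD// opnorm_le.
Qed.

(** Otherwise there are symbols [a k] whose first [k] seminorms are below [1 / (k + 1)] while
    [Q (a k)] has norm at least [e]. Then the [(k + 1) a k] form a bounded family whose operators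
    have unbounded norms, contradicting [order_bounded0]. *)
Lemma Q_small (e : R) : 0 < e -> exists (s : seq (seq 'I_n * seq 'I_r)) (d : R), 0 < d /\
  forall a, inS pu 0 a -> (forall st, st \in s -> symb_sn pu 0 st a < d) ->
    opnorm (Q a) < e.
Proof.
move=> e0; apply: contrapT => hn.
(* The multi-indices with code below [k]. A fixed one belongs to [s k] for all but finitely many
   [k], so its seminorm on the dilated sequence is at most 1 up to finitely many exceptions. *)
pose s k : seq (seq 'I_n * seq 'I_r) := pmap unpickle (iota 0 k).
have inv k : 0 < (k.+1%:R : R)^-1 by rewrite invr_gt0.
have /choice[a ha] : forall k, exists a, [/\ inS pu 0 a,
    forall st, st \in s k -> symb_sn pu 0 st a < (k.+1%:R)^-1 & e <= opnorm (Q a)].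
  move=> k; apply: contrapT => hk; apply: hn; exists (s k), (k.+1%:R)^-1; split=> //.
  move=> a ma sa; rewrite ltNge; apply/negP => ea; apply: hk; exists a; split=> //.
have bd : symb_bounded pu 0 (fun k => dil k.+1%:R (a k)).
  apply: symb_bounded_of_sn => [k|st]; first by apply: dil_inS; have [] := ha k.
  have small k : (pickle st < k)%N -> symb_sn pu 0 st (dil k.+1%:R (a k)) <= 1.
    move=> hk; have [ma h _] := ha k.
    rewrite (le_trans (symb_snZ _ _ ma))// mulrC -ler_pdivlMr// mul1r ltW// h//.
    rewrite mem_pmap; apply/mapP; exists (pickle st); first by rewrite mem_iota.
    by rewrite pickleK.
  have [C hC] : exists C, forall k, (k <= pickle st)%N ->
      symb_sn pu 0 st (dil k.+1%:R (a k)) <= C.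
    elim: (pickle st) => [|N [C hC]].
      by exists (symb_sn pu 0 st (dil 1 (a 0%N))) => k; rewrite leqn0 => /eqP ->.
    exists (Num.max C (symb_sn pu 0 st (dil N.+2%:R (a N.+1)))) => k.
    by rewrite leq_eqVlt => /orP[/eqP ->|/hC h]; rewrite le_max ?lexx ?orbT ?h.
  exists (Num.max C 1) => k; rewrite le_max.
  by case: (leqP k (pickle st)) => [/hC ->//|/small ->]; rewrite orbT.
have [C hC] := order_bounded0 bd.
have [k hk] : exists k : nat, `|C| / e < k%:R.
  by exists (Num.bound (`|C| / e)); rewrite archi_boundP// divr_ge0// ltW.
have [ma _ ea] := ha k; have [bQ QE] := hQ (dil_inS k.+1%:R ma).
have : opnorm (Q (dil k.+1%:R (a k))) <= `|C|.
  apply: opnorm_ub => // x.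
  apply: (bounded_dense_le x WH_dense bQ) => y Dy; rewrite QE//.
  by rewrite (le_trans (hC k y Dy))// ler_wpM2r ?hnorm_ge0// ler_norm.
rewrite opnorm_QZ// cabs_real normr_nat leNgt => /negP; apply.
move: hk; rewrite ltr_pdivrMr// => /lt_le_trans; apply.
by rewrite ler_pM ?ler_nat// ?(ltW e0).
Qed.

Lemma Q_sn_continuous : sn_continuous (inS pu 0) (symb_sn pu 0) (@opnorm_sn R H) Q.
Proof.
move=> a ma [] e e0; have [s [d [d0 hd]]] := Q_small e0.
exists s, d; split=> // b mb hb; rewrite /opnorm_sn.
have := hd _ (inSB mb ma) hb; rewrite QB//.
Qed.

Lemma opnorm_Q_seminorm :
  continuous_seminorm (inS pu 0) (symb_sn pu 0) (fun a => opnorm (Q a)).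
Proof.
split; first split.
- by move=> a ma; have [ba _] := hQ ma; exact: opnorm_ge0.
- exact: opnorm_QZ.
- exact: opnorm_QD.
move=> a ma [] e e0; have [s [d [d0 hd]]] := Q_small e0.
exists s, d; split=> // b mb hb; rewrite /abs_sn.
have h := hd _ (inSB mb ma) hb; apply: le_lt_trans h.
have h1 := opnorm_QD (inSB mb ma) ma.
have h2 := opnorm_QD (inSZ (-1) (inSB mb ma)) mb.
rewrite opnorm_QZ in h2; last exact: inSB.
rewrite (_ : cabs _ = 1) in h2; last first.
  by rewrite cabsN -[1]/(1%:C%C) cabs_real normr1.
rewrite (_ : (fun v => _) = b) in h1; last by apply/funext => v; rewrite subrK.
rewrite (_ : (fun v => _) = a) in h2; last first.
  by apply/funext => v; rewrite mulN1r opprB subrK.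
rewrite ler_norml; apply/andP; split; lra.
Qed.

End Extension.

(** Compositions of quantizations are quantizations only modulo [W], so parametrices live in this
    larger class. The level [k] is existential because axiom (iv) raises it, and [T] is constrained
    only on the domain. *)
Definition pdo m T := exists a k K,
  [/\ inS pu m a, (0 < k)%N, W k K & forall x, D x -> T x = q a x + K x].

Lemma W_lin l (k : R[i]) T S : (0 < l)%N -> W l T -> W l S ->
  W l (fun x => k *: T x + S x).
Proof. by move=> l0 WT WS; have [_ h] := W_subspace l0; exact: (h k _ _ WT WS). Qed.

Lemma W_zero k : (0 < k)%N -> W k (fun=> 0).
Proof. by move=> /W_subspace[]. Qed.

Lemma W_add l T S : (0 < l)%N -> W l T -> W l S -> W l (fun x => T x + S x).
Proof.
move=> l0 WT WS; have := W_lin 1 l0 WT WS.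
by under eq_fun do rewrite scale1r.
Qed.

(** Axiom (iv) lets [q] act on the left of [W] only. Composition on the right is obtained as the
    adjoint of [q (conj b)] composed with the adjoint of [K]; that adjoint is a bounded extension of
    the product. *)
Lemma W_q k K b : (0 < k)%N -> W k K -> Sinf b ->
  exists2 L, W k.+1 L & forall x, D x -> L x = K (q b x).
Proof.
move=> k0 WK sb; have [m mb] := sb.
have [K' WK' KK'] := W_star k0 WK.
have WM := q_W (inS_conj mb) k0 WK'.
have [L WL ML] := W_star (isT : (0 < k.+1)%N) WM.
exists L => // x Dx; apply: hip_inj => z.
rewrite -ML /= (q_adjoint (inS_inf_conj sb) (WH_W z k0 WK') Dx).
rewrite (_ : (fun v => ((b v)^*)^*%C) = b); last first.
  by apply/funext => v; case: (b v) => t u; rewrite /= opprK.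
by rewrite (adjointC KK').
Qed.

Lemma pdo_q m a : inS pu m a -> pdo m (q a).
Proof.
move=> ma; exists a, 1%N, (fun=> 0); split=> //; first exact: W_zero.
by move=> x _; rewrite addr0.
Qed.

Lemma pdo_le m m' T : m <= m' -> pdo m T -> pdo m' T.
Proof.
by move=> mm [a [k [K [ma k0 WK TE]]]]; exists a, k, K; split=> //; exact: inS_le ma.
Qed.

Lemma pdo_eq m T S : (forall x, D x -> T x = S x) -> pdo m T -> pdo m S.
Proof.
move=> TS [a [k [K [ma k0 WK TE]]]]; exists a, k, K; split=> // x Dx.
by rewrite -TS// TE.
Qed.

Lemma pdo_lin m (k : R[i]) T S : pdo m T -> pdo m S -> pdo m (fun x => k *: T x + S x).
Proof.
move=> [a [i [K [ma i0 WK TE]]]] [b [j [L [mb j0 WL SE]]]].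
have WK' := W_le i0 (leq_addr j i) WK; have WL' := W_le j0 (leq_addl i j) WL.
have ij0 : (0 < i + j)%N by rewrite addn_gt0 i0.
exists (fun v => k * a v + b v), (i + j)%N, (fun x => k *: K x + L x).
split=> //; [exact: inS_lin|exact: W_lin|move=> x Dx].
rewrite q_lin//; [|exact: inS_inf ma|exact: inS_inf mb].
by rewrite TE// SE// scalerDr addrACA.
Qed.

Lemma pdo_D m T x : pdo m T -> D x -> D (T x).
Proof.
move=> [a [k [K [ma k0 WK TE]]]] Dx; rewrite TE//.
by apply: hsubD WH_hsub _ _; [exact: q_D (inS_inf ma) Dx|exact: WH_W WK].
Qed.

Lemma pdo_linear m T : pdo m T -> linear_on D T.
Proof.
move=> [a [k [K [ma k0 WK TE]]]] l x y Dx Dy.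
rewrite !TE//; last by case: WH_hsub => _; exact.
rewrite (q_linear (inS_inf ma))// (bounded_lin (W_bounded k0 WK))//.
by rewrite scalerDr addrACA.
Qed.

Lemma q_comp a b : Sinf a -> Sinf b -> exists2 K, W 1 K &
  forall x, D x -> q a (q b x) = q (P a b) x + K x.
Proof.
move=> sa sb; case: hax => _ [_ [_ [K [hK _]] _ _ _] _].
have [WK KE] := hK a b sa sb; exists (K a b) => // x Dx.
by rewrite KE// addrC subrK.
Qed.

Lemma P_inS m m' a b : inS pu m a -> inS pu m' b -> inS pu (m + m') (P a b).
Proof.
move=> /inS_bounded ba /inS_bounded bb.
exact: (symb_bounded_inS tt (P_bounded ba bb)).
Qed.

Lemma pdo_comp m m' T S : pdo m T -> pdo m' S -> pdo (m + m') (T \o S).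
Proof.
move=> [a [i [K [ma i0 WK TE]]]] pS; have [b [j [L [mb j0 WL SE]]]] := pS.
have sa := inS_inf ma; have sb := inS_inf mb.
have [K1 WK1 K1E] := q_comp sa sb.
have W2 := q_W ma j0 WL; have [K3 W3 K3E] := W_q i0 WK sb.
have W4 := W_comp i0 j0 WK WL.
have le1 : (1 <= (i + j).+1)%N by [].
have le2 : (j.+1 <= (i + j).+1)%N by rewrite ltnS leq_addl.
have le3 : (i.+1 <= (i + j).+1)%N by rewrite ltnS leq_addr.
have le4 : (i + j <= (i + j).+1)%N by [].
have ij0 : (0 < i + j)%N by rewrite addn_gt0 i0.
(* Four smoothing terms arise: the remainder of [q a] with [q b], then [q a L], [K q b] and [K L].
   Level [i + j + 1] contains all of them. *)
have h := W_add (ltn0Sn _) (W_add (ltn0Sn _) (W_le (ltn0Sn 0) le1 WK1)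
  (W_le (ltn0Sn j) le2 W2)) (W_add (ltn0Sn _) (W_le (ltn0Sn i) le3 W3) (W_le ij0 le4 W4)).
exists (P a b), (i + j).+1; eexists; split; [exact: P_inS|by []|exact: h|move=> x Dx /=].
rewrite TE; last exact: pdo_D pS Dx.
rewrite SE// (linear_onD WH_hsub (q_linear sa)); last 2 first.
- exact: q_D.
- exact: WH_W WL.
rewrite (linear_onD (@hsubT _ _) (bounded_lin (W_bounded i0 WK)))// K1E// -K3E//.
by rewrite !addrA.
Qed.

Lemma pdo_adjoint m T : pdo m T -> exists2 T', pdo m T' &
  forall x y, D x -> D y -> hip (T x) y = hip x (T' y).
Proof.
move=> [a [k [K [ma k0 WK TE]]]]; have [K' WK' KK'] := W_star k0 WK.
exists (fun x => q (fun v => (a v)^*%C) x + K' x).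
  by exists (fun v => (a v)^*%C), k, K'; split=> //; exact: inS_conj.
move=> x y Dx Dy; rewrite TE// hipDl hipDr KK' (q_adjoint _ Dx Dy)//.
exact: inS_inf ma.
Qed.

Lemma pdo_extension m T : m <= 0 -> pdo m T -> exists S, extends_to D T S.
Proof.
move=> m0 pT; have [a [k [K [ma k0 WK TE]]]] := pT.
have [C hC] := order_bounded0 (inS_bounded (inS_le m0 ma)).
have [_ [C' hC']] := W_bounded k0 WK.
have [|S SE _] := bounded_extension WH_hsub WH_dense (pdo_linear pT) (C := C + C').
  move=> x Dx; rewrite TE// (le_trans (hnormD _ _))// mulrDl lerD//.
  exact: (hC tt).
by exists S.
Qed.

(** The symbol inverse gives an error of order [-1 = - 2 ^ 0], and each squaring doubles the order.
    A large [k] will make the error at least as regularizing as [B]. *)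
Lemma elliptic_parametrix m a k : elliptic pu m a -> exists B E,
  [/\ pdo (- m) B, pdo (- (2 ^ k)%:R) E & forall x, D x -> q a (B x) = x + E x].
Proof.
move=> [ma [b mb mab]]; elim: k => [|k [B [E [pB pE BE]]]].
  have sa := inS_inf ma; have sb := inS_inf mb.
  have [K WK KE] := q_comp sa sb.
  pose e v := (P a b v - a v * b v) + (a v * b v - 1).
  have me : inS pu (- 1) e.
    apply: inSD => //; have := symb_bounded_inS tt
      (P_sub_bounded (inS_bounded ma) (inS_bounded mb)).
    by rewrite subrr sub0r.
  exists (q b), (fun x => q e x + K x); split; first exact: pdo_q.
    by exists e, 1%N, K; split.
  move=> x Dx; rewrite KE// addrA; congr (_ + _).
  rewrite -[X in X + _](q1 Dx) -qD//; [|exact: inS_inf inS1|exact: inS_inf me].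
  by congr (q _ x); apply/funext => v; rewrite /e; ring.
(* If [A B = 1 + E] then [A B (1 - E) = 1 - E^2]. *)
exists (fun x => (-1) *: B (E x) + B x), (fun x => (-1) *: E (E x) + 0); split.
- apply: pdo_lin => //; apply: pdo_le (pdo_comp pB pE).
  by rewrite gerDl oppr_le0.
(* The zero summand is written as the quantization of the zero symbol, so that closure under linear
   combinations applies. *)
- apply: (@pdo_eq _ (fun x => (-1) *: (E \o E) x + q (fun=> 0) x)).
    by move=> x Dx; rewrite q0.
  apply: pdo_lin; last exact: pdo_q (@inS0 _ _ _ _ _ _).
  have := pdo_comp pE pE.
  by rewrite -opprD -natrD addnn -mul2n -expnS.
- move=> x Dx; have DE := pdo_D pE Dx; have la := q_linear (inS_inf ma).
  rewrite la; [|exact: pdo_D pB DE|exact: pdo_D pB Dx].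
  by rewrite !BE// addr0 !scaleN1r opprD addrC addrA addrK.
Qed.

(** * Essential self-adjointness of real elliptic symbols *)

Lemma graph_closure_seq T (p : H * H) : graph_closure (graph_on D T) p <->
  exists2 u, forall k, D (u k) & hlim u p.1 /\ hlim (T \o u) p.2.
Proof.
split=> [h|[u Du [u1 u2]] e e0]; last first.
  have [N1 h1] := u1 e e0; have [N2 h2] := u2 e e0.
  exists (u (maxn N1 N2), T (u (maxn N1 N2))); first by split; first exact: Du.
  by rewrite /= !(hnormC p.1) !(hnormC p.2) h1 ?h2// ?leq_maxl ?leq_maxr.
have inv k : 0 < (k.+1%:R : R)^-1 by rewrite invr_gt0.
have /choice[u hu] : forall k, exists x, [/\ D x, hnorm (p.1 - x) < (k.+1%:R)^-1 &
    hnorm (p.2 - T x) < (k.+1%:R)^-1].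
  by move=> k; have [[x y] [/= Dx ->] [h1 h2]] := h _ (inv k); exists x.
have lim_of (v : nat -> H) z : (forall k, hnorm (z - v k) < (k.+1%:R)^-1) -> hlim v z.
  move=> hv e e0; exists (Num.truncn e^-1) => k hk.
  have := hv k; rewrite hnormC => /lt_le_trans; apply.
  rewrite -(invrK e) lef_pV2 ?posrE ?invr_gt0 ?ltr0n//.
  by rewrite (le_trans (ltW (truncnS_gt _)))// ler_nat.
exists u; first by move=> k; have [] := hu k.
by split; apply: lim_of => k; have [] := hu k.
Qed.

Lemma hlim_cst x : hlim (fun=> x) x.
Proof. by move=> e e0; exists 0%N => k _; rewrite subrr hnorm0. Qed.

Lemma orth_WH_eq x y : (forall z, D z -> hip z x = hip z y) -> x = y.
Proof.
move=> h; apply: hip_inj => z; have [u Du uz] := dense_seq z WH_dense.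
by apply: (hlim_hip uz uz) => k; exact: h.
Qed.

Lemma elliptic_essentially_self_adjoint m a : elliptic pu m a -> real_symb a ->
  0 <= m -> essentially_self_adjoint D (q a).
Proof.
move=> ela ra m0; have sa : Sinf a := inS_inf ela.1.
have sym : symmetric_on D (q a) by case: hax => -[_ _ [_ _ _ h _]] _; exact: h.
have lina := q_linear sa.
split=> //; first exact: WH_dense.
apply/seteqP; split=> [[y h]|[y h]] /=; last first.
  (* The closure is contained in its adjoint: symmetry on the domain passes to the limit in one
     sequence first, then in the other. *)
  move=> /graph_closure_seq[u Du /= [uy uh]] [x k].
  move=> /graph_closure_seq[v Dv /= [vx vk]].
  have step l : hip k (u l) = hip x (q a (u l)).
    by apply: (hlim_hip vk vx) => i /=; exact: sym.
  rewrite [LHS]hip_conj [RHS]hip_conj; congr (_^*%C).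
  by apply: (hlim_hip uy uh) => i /=; rewrite [LHS]hip_conj [RHS]hip_conj step.
move=> adj.
have {}adj x : D x -> hip (q a x) y = hip x h.
  move=> Dx; apply: (adj (x, q a x)); apply/graph_closure_seq.
  by exists (fun=> x) => //; split; exact: hlim_cst.
(* With [m <= 2 ^ k] the error has order at most [-m], so [q a] composed with its adjoint has order
   at most 0 and is bounded. *)
have [k mk] : exists k, m <= (2 ^ k)%:R.
  exists (Num.bound m); rewrite (le_trans (ltW (archi_boundP m0)))// ler_nat.
  by rewrite ltnW// ltn_expl.
have [B [E [pB pE BE]]] := elliptic_parametrix k ela.
have {}pE : pdo (- m) E by apply: pdo_le pE; rewrite lerN2.
have [B' pB' BB'] := pdo_adjoint pB; have [E' pE' EE'] := pdo_adjoint pE.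
have mN : - m <= 0 by rewrite oppr_le0.
have [Bx [bB BxE]] := pdo_extension mN pB'; have [Ex [bE ExE]] := pdo_extension mN pE'.
have pa : pdo m (q a) by exact: pdo_q ela.1.
have mm : m + - m <= 0 by rewrite subrr.
have [U [bU UE]] := pdo_extension mm (pdo_comp pa pB').
have [U' [bU' U'E]] := pdo_extension mm (pdo_comp pa pE').
(* Testing the equation for the adjoint on the range of [B] gives
   [y = B^* h - E^* y], where [q(a) B^*] and [q(a) E^*] are bounded; hence
   approximations of [h] and [y] in [D] yield one of [(y, h)] in the graph. *)
have [hn Dh hnh] := dense_seq h WH_dense; have [yn Dy yny] := dense_seq y WH_dense.
have limN (u : nat -> H) z : hlim u z -> hlim (fun k => - u k) (- z).
  by apply: (@hlim_lip _ _ _ _ _ _ 1) => i; rewrite -opprD hnormN mul1r.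
pose z i := B' (hn i) - E' (yn i).
have Dz i : D (z i) by apply: hsubB WH_hsub _ _; [exact: pdo_D pB' _|exact: pdo_D pE' _].
have lz : hlim z (Bx h - Ex y).
  have := hlimD (hlim_bounded bB hnh) (limN _ _ (hlim_bounded bE yny)).
  by congr hlim; apply/funext => i; rewrite /= BxE// ExE.
have lAz : hlim (q a \o z) (U h - U' y).
  have := hlimD (hlim_bounded bU hnh) (limN _ _ (hlim_bounded bU' yny)).
  congr hlim; apply/funext => i; rewrite /= UE// U'E//= /z.
  by rewrite (linear_onB WH_hsub lina)//; [exact: pdo_D pB' _|exact: pdo_D pE' _].
have yE : y = Bx h - Ex y.
  apply: orth_WH_eq => x Dx; rewrite hipDr hipNr.
  have e1 : hip (B x) h = hip x (Bx h).
    rewrite [LHS]hip_conj [RHS]hip_conj; congr (_^*%C).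
    apply: (hlim_hip hnh (hlim_bounded bB hnh)) => i /=.
    by rewrite BxE// [LHS]hip_conj [RHS]hip_conj BB'.
  have e2 : hip (E x) y = hip x (Ex y).
    rewrite [LHS]hip_conj [RHS]hip_conj; congr (_^*%C).
    apply: (hlim_hip yny (hlim_bounded bE yny)) => i /=.
    by rewrite ExE// [LHS]hip_conj [RHS]hip_conj EE'.
  have := adj _ (pdo_D pB Dx); rewrite BE// hipDl e1 e2 => <-.
  by rewrite addrK.
rewrite -yE in lz.
(* So far [(y, U h - U' y)] lies in the closed graph. Testing [q a \o z] against the domain,
   symmetry and the adjoint equation for [(y, h)] identify its limit with [h]. *)
suff hE : U h - U' y = h.
  by rewrite hE in lAz; apply/graph_closure_seq; exists z.
apply: orth_WH_eq => x Dx; rewrite -adj//.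
rewrite [LHS]hip_conj [RHS]hip_conj; congr (_^*%C).
by apply: (hlim_hip lAz lz) => i /=; rewrite [LHS]hip_conj [RHS]hip_conj sym.
Qed.

End Quantization.

Theorem proposition2p2 (R : realType) (n r : nat) (V : orth_bundle R n r)
    (g : rmetric V) (nab : oconnection V) (pu : pou V) (hgeo : setting g nab pu)
    (H : hilbert R)
    (W : nat -> set (H -> H)) (wsn : nat -> nat -> (H -> H) -> R)
    (P : symb V -> symb V -> symb V) (q : symb V -> H -> H)
    (hax : quantization_axioms g nab pu W wsn P q) :
  [/\ exists p' : symb V -> R,
        continuous_seminorm (inS pu 0) (symb_sn pu 0) p' /\
        forall a, inS pu 0 a ->
          exists2 S, extends_to (WH W) (q a) S & opnorm S <= p' a,
      (forall a, inS pu 0 a -> exists! S, extends_to (WH W) (q a) S) /\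
      (forall Q : symb V -> H -> H,
         (forall a, inS pu 0 a -> extends_to (WH W) (q a) (Q a)) ->
         sn_continuous (inS pu 0) (symb_sn pu 0)
           (@opnorm_sn R H) Q) &
      forall m a, 0 <= m -> elliptic pu m a -> real_symb a ->
        essentially_self_adjoint (WH W) (q a)].
Proof.
have [hcut hmult] := setting_uniform hgeo.
have [Q hQ] : exists Q : symb V -> H -> H,
    forall a, inS pu 0 a -> extends_to (WH W) (q a) (Q a).
  have /choice[Q hQ] : forall a, exists S, inS pu 0 a -> extends_to (WH W) (q a) S.
    (* Choice needs a value for every function; those outside S^0 receive the identity. *)
    move=> a; have [ma|nma] := pselect (inS pu 0 a); last by exists id.
    by have [S SE] := q_extension hcut hmult hax ma; exists S.
  by exists Q.
split.
- exists (fun a => opnorm (Q a)); split; first exact: (opnorm_Q_seminorm hcut hmult hax hQ).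
  by move=> a ma; exists (Q a) => //; exact: hQ.
- split; last by move=> Q' hQ'; exact: (Q_sn_continuous hcut hmult hax hQ').
  move=> a ma; exists (Q a); split; first exact: hQ.
  by move=> S; apply: (extension_unique hax); exact: hQ.
- by move=> m a m0 ela ra; exact: (elliptic_essentially_self_adjoint hcut hmult hax ela ra m0).
Qed.
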